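(* Let $1\leq q\leq\infty$ and let $\psi_0\in L^q(\mathbb{T}^2)$ be any (real-valued) function. Given any integer $N\geq 0$ and, if $N\geq1$, any $\nu\in\mathbb{R}^N\setminus\{0\}$, there exist sequences (indexed by $n$) of scalar functions $\psi_0^n\in C^\infty(\mathbb{T}^2)$, of constants $c^n>0$, and of non-symmetric smooth embeddings $U^n:\mathbb{T}^N\to C^\infty_{\mathrm{div}}(\mathbb{T}^2,\mathbb{R}^2)$ such that: (i) For each $n$, the solution to the incompressible Euler equations on $\mathbb{T}^2$ with initial datum $u_0^n=\nabla^\perp\psi_0^n$ is $u^n(t,\cdot)=U^n(c^n\nu t)$. (When $N=0$, $\mathbb{T}^0$ is a single point, $U^n$ is a single vector field, and this means that $u^n(t,\cdot)=U^n$ is a stationary solution.) (ii) The sequence $\psi_0^n$ converges to $\psi_0$ in $L^q(\mathbb{T}^2)$ as $n\to\infty$, strongly if $q<\infty$ and weak-$*$ if $q=\infty$ (that is, $\int_{\mathbb{T}^2}\psi_0^n\,g\,dx\to\int_{\mathbb{T}^2}\psi_0\,g\,dx$ for all $g\in L^1(\mathbb{T}^2)$).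
   Context: Here $\mathbb{T}^k:=(\mathbb{R}/2\pi\mathbb{Z})^k$, and for $\nu\in\mathbb{R}^N$ and $s\in\mathbb{R}$ the vector $s\nu$ is regarded as a point of $\mathbb{T}^N$ by reduction modulo $2\pi\mathbb{Z}^N$. $C^\infty_{\mathrm{div}}(\mathbb{T}^2,\mathbb{R}^2)$ denotes the space of smooth divergence-free vector fields on $\mathbb{T}^2$ (with its usual $C^\infty$ Fréchet topology), and $\nabla^\perp\psi:=(\partial_{x_2}\psi,-\partial_{x_1}\psi)$. The incompressible Euler equations on $\mathbb{T}^2$ are $$\partial_t u+u\cdot\nabla u+\nabla p=0,\qquad \operatorname{div}u=0,$$ for the time-dependent velocity field $u(t,x)\in\mathbb{R}^2$ and the scalar pressure $p(t,x)$. A map $U:\mathbb{T}^N\to C^\infty_{\mathrm{div}}(\mathbb{T}^2,\mathbb{R}^2)$ is called non-symmetric if, for all $\theta\in\mathbb{T}^N$, the divergence-free vector field $U(\theta)$ is not invariant under any (nontrivial) 1-parameter group of translations on $\mathbb{T}^2$, i.e. for no $a\in\mathbb{R}^2\setminus\{0\}$ does one have $U(\theta)(x+sa)=U(\theta)(x)$ for all $x\in\mathbb{T}^2$ and $s\in\mathbb{R}$. The case $N=0$ is the degenerate case in which the torus is replaced by a set consisting of a single element, corresponding to stationary solutions. *)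

(* Defs.v *)
From HB Require Import structures.
From mathcomp Require Import all_boot all_order all_algebra.
From mathcomp Require Import all_classical all_reals all_analysis.

Set Implicit Arguments.
Unset Strict Implicit.
Unset Printing Implicit Defensive.

Import Order.TTheory GRing.Theory Num.Theory.
Import numFieldNormedType.Exports.

Local Open Scope classical_set_scope.
Local Open Scope ring_scope.

(* A torus (R / 2 pi Z)^k is handled through its universal cover: functions on
   T^2 are (2 pi Z)^2-periodic functions on R * R, and maps defined on T^N are
   (2 pi Z)^N-invariant maps on 'rV[R]_N. *)

Section Smooth.
Context {R : realType} {V W : normedModType R}.

Definition iter_derive (vs : seq V) (f : V -> W) : V -> W :=
  foldr (fun v g => 'D_v g) f vs.

(* Used for finite-dimensional V only, where it is the usual C^infty. *)
Definition smooth (f : V -> W) : Prop :=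
  forall vs : seq V, continuous (iter_derive vs f) /\
    forall x v, derivable (iter_derive vs f) x v.

Lemma iter_derive_lin (a : R) (f g : V -> W) : smooth f -> smooth g ->
  forall vs, iter_derive vs (a *: f + g) =
             a *: iter_derive vs f + iter_derive vs g.
Proof.
move=> sf sg; elim=> [//|v vs IH] /=; rewrite IH; apply/funext => x.
have [_ df] := sf vs; have [_ dg] := sg vs.
by rewrite deriveD ?deriveZ//; apply: derivableZ.
Qed.

Lemma smooth_lin (a : R) (f g : V -> W) :
  smooth f -> smooth g -> smooth (a *: f + g).
Proof.
move=> sf sg vs; rewrite iter_derive_lin//.
have [cf df] := sf vs; have [cg dg] := sg vs; split=> [x|x v].
  by apply: (@continuousD _ _ _ _ _ x); [exact: (continuousZl_tmp (cf x))|exact: cg].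
by apply: derivableD => //; exact: derivableZ.
Qed.

Lemma smooth0 : smooth (0 : V -> W).
Proof.
have E vs : iter_derive vs (0 : V -> W) = 0.
  elim: vs => [//|v vs /= ->]; apply/funext => x; exact: derive_cst.
move=> vs; rewrite E; split=> [x|x v]; first exact: cst_continuous.
exact: derivable_cst.
Qed.

End Smooth.

Section Plane.
Context {R : realType}.

Definition periodic2 (T : Type) (f : R * R -> T) : Prop :=
  forall (x : R * R) (m n : int),
    f (x + (2 * pi * m%:~R, 2 * pi * n%:~R)) = f x.

Definition d1 (W : normedModType R) (f : R * R -> W) : R * R -> W :=
  'D_((1, 0) : R * R) f.
Definition d2 (W : normedModType R) (f : R * R -> W) : R * R -> W :=
  'D_((0, 1) : R * R) f.

Definition divergence (v : R * R -> R * R) (x : R * R) : R :=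
  (d1 v x).1 + (d2 v x).2.

Definition grad (p : R * R -> R) (x : R * R) : R * R := (d1 p x, d2 p x).

Definition grad_perp (psi : R * R -> R) (x : R * R) : R * R :=
  (d2 psi x, - d1 psi x).

Definition multi_derive (W : normedModType R) (al : nat * nat)
    (f : R * R -> W) : R * R -> W :=
  iter al.1 (@d1 W) (iter al.2 (@d2 W) f).

Definition smooth_div_free : {pred (R * R -> R * R)} :=
  [pred v | `[< [/\ smooth v, periodic2 v & forall x, divergence v x = 0] >]].

Lemma smooth_div_free_submod : submod_closed smooth_div_free.
Proof.
split.
  apply/asboolP; split; [exact: smooth0|by []|move=> x].
  by rewrite /divergence /d1 /d2 !derive_cst addr0.
move=> a u v /asboolP[su pu du] /asboolP[sv pv dv]; apply/asboolP; split.
- exact: smooth_lin.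
- by move=> x m n; rewrite !fctE pu pv.
move=> x; rewrite /divergence /d1 /d2.
have [_ /= deu] := su [::]; have [_ /= dev] := sv [::].
rewrite !deriveD ?deriveZ//; [|exact: derivableZ|exact: derivableZ].
rewrite /= addrACA -mulrDr.
transitivity (a * divergence u x + divergence v x); first by [].
by rewrite du dv mulr0 addr0.
Qed.

HB.instance Definition _ := GRing.isSubmodClosed.Build R (R * R -> R * R)%type
  smooth_div_free smooth_div_free_submod.

End Plane.

Record CinftyDiv (R : realType) := MkCinftyDiv {
  field_of :> R * R -> R * R;
  field_ofP : field_of \in smooth_div_free }.

HB.instance Definition _ (R : realType) := [isSub for @field_of R].
HB.instance Definition _ (R : realType) := [Choice of CinftyDiv R by <:].
HB.instance Definition _ (R : realType) :=
  [SubChoice_isSubLmodule of CinftyDiv R by <:].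
HB.instance Definition _ (R : realType) := isPointed.Build (CinftyDiv R) 0.

(* The C^infty Frechet topology: uniform convergence of all partial
   derivatives of all orders. *)
Definition jet (R : realType) (u : CinftyDiv R) :
    prod_topology (fun _ : nat * nat => {uniform (R * R) -> (R * R)}) :=
  fun al => multi_derive al u.

HB.instance Definition _ (R : realType) :=
  Topological.copy (CinftyDiv R) (initial_topology (@jet R)).

Section TorusMaps.
Context {R : realType} {N : nat}.
Implicit Types (U : 'rV[R]_N -> CinftyDiv R) (th v : 'rV[R]_N).

Definition torus_eq th th' : Prop :=
  exists k : 'rV[int]_N, th' = th + (2 * pi) *: map_mx intr k.

Definition torus_periodic U : Prop :=
  forall th th', torus_eq th th' -> U th = U th'.

Definition diff_quot U th v (h : R) : CinftyDiv R :=
  h^-1 *: (U (h *: v + th) - U th).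

(* The library's 'D_v requires a normed codomain. *)
Definition frechet_derivable U th v : Prop := cvg (diff_quot U th v @ 0^').
Definition frechet_derive v U th : CinftyDiv R := lim (diff_quot U th v @ 0^').

Definition frechet_smooth U : Prop :=
  forall vs : seq 'rV[R]_N, let DU := foldr frechet_derive U vs in
    continuous DU /\ forall th v, frechet_derivable DU th v.

(* The image of each differential is finite dimensional, hence automatically
   complemented, so injectivity of the differential suffices. *)
Definition immersion U : Prop :=
  forall th v, v != 0 -> frechet_derive v U th != 0.

(* The open sets of T^N correspond to the saturated open sets of R^N. *)
Definition homeo_onto_image U : Prop :=
  forall O : set 'rV[R]_N, open O ->
    (forall th th', torus_eq th th' -> O th -> O th') ->
    exists2 A : set (CinftyDiv R), open A & U @^-1` A = O.

Definition smooth_embedding U : Prop :=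
  [/\ torus_periodic U, frechet_smooth U,
      forall th th', U th = U th' -> torus_eq th th',
      immersion U & homeo_onto_image U].

Definition non_symmetric U : Prop :=
  forall th (a : R * R), a != 0 ->
    ~ (forall (x : R * R) (s : R), U th (x + s *: a) = U th x).

End TorusMaps.

Section Euler.
Context {R : realType}.
Implicit Types (u : R -> R * R -> R * R) (p : R -> R * R -> R).

Definition euler_equations u p : Prop :=
  forall (t : R) (x : R * R),
    derive1 (fun s => u s x) t + ((u t x).1 *: d1 (u t) x + (u t x).2 *: d2 (u t) x)
      + grad (p t) x = 0
    /\ divergence (u t) x = 0.

Definition euler_solution (u0 : R * R -> R * R) u : Prop :=
  [/\ smooth (fun z : R * (R * R) => u z.1 z.2),
      forall t, periodic2 (u t),
      exists p, [/\ smooth (fun z : R * (R * R) => p z.1 z.2),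
                    forall t, periodic2 (p t) & euler_equations u p] &
      u 0 = u0].

(* Uniqueness is among smooth solutions defined for all times. *)
Definition the_euler_solution (u0 : R * R -> R * R) u : Prop :=
  euler_solution u0 u /\ forall v, euler_solution u0 v -> v = u.

End Euler.

Section Lebesgue.
Context {R : realType}.

Definition fundamental_square : set (measurableTypeR R * measurableTypeR R) :=
  `[0, 2 * pi[%classic `*` `[0, 2 * pi[%classic.

Lemma measurable_fundamental_square : measurable fundamental_square.
Proof. by apply: measurableX; exact: measurable_itv. Qed.

Definition torus_measure :
    {measure set (measurableTypeR R * measurableTypeR R) -> \bar R} :=
  mrestr (lebesgue_measure \x lebesgue_measure)%E
    measurable_fundamental_square.

(* Elements of L^q are given by Borel measurable representatives. *)
Definition torus_Lq (q : \bar R) (f : R * R -> R) : Prop :=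
  f \in Lfun torus_measure q /\ periodic2 f.

Definition Lq_cvg (q : \bar R) (f : nat -> R * R -> R) (g : R * R -> R) : Prop :=
  Lnorm torus_measure q (EFin \o (fun x => f n x - g x)) @[n --> \oo] --> 0%E.

Definition weak_star_cvg (f : nat -> R * R -> R) (g : R * R -> R) : Prop :=
  forall h : R * R -> R, torus_Lq 1%E h ->
    (\int[torus_measure]_x (f n x * h x)%:E)%E @[n --> \oo] -->
    (\int[torus_measure]_x (g x * h x)%:E)%E.

End Lebesgue.

(* Main.v *)
(* A radial stream function defines a stationary flow, and so does a sum of radial
   stream functions supported in disjoint discs. If such a vortex lies in a
   horizontal strip on which a shear flow has constant speed, it is merely carried
   along at that speed (Crouseilles and Faou). Up to a set of small measure, the
   square minus a thin frame is covered by disjoint discs; vortices with flat cores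
   there reproduce any step function on a dyadic grid, hence approximate any
   [L^q] function. The frame has room for [N] strips, each holding one vortex
   carried at speed [nu i], and for a motionless probe vortex. The positions of the
   [N] vortices are coordinates on an embedded torus: on the central line of a
   strip, the sign of the vertical velocity determines the position of the vortex.
   Following a line perpendicular to a radius of the probe, one leaves the region
   where its velocity is nonzero, so the flow has no translation symmetry. That
   there is no other smooth solution follows from the energy estimate for the
   difference of two solutions and Gronwall's lemma. *)
Require Import Defs.
From mathcomp Require Import all_boot all_order all_algebra.
From mathcomp Require Import all_classical all_reals all_analysis measurable_realfun.
From mathcomp Require Import ring lra zify.

Set Implicit Arguments.
Unset Strict Implicit.
Unset Printing Implicit Defensive.

Import Order.TTheory GRing.Theory Num.Theory.
Import numFieldNormedType.Exports.
Local Open Scope classical_set_scope.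
Local Open Scope ring_scope.

(** * Calculus of smooth maps *)

(** Only stream functions are compared with the target, whereas the prescribed speeds are
    velocities. A shear of speed [nu i] on a strip of width comparable to [eta] has a stream
    function of size at most [C * eta], so thin strips carry arbitrary speeds at no cost and every
    constant [c n] can be 1. Likewise vortices of fixed amplitude may be put in the frame: they
    spoil the approximation only on a set of small measure. What has to be controlled is therefore a
    uniform bound together with closeness off a small set; this single criterion, [rich], yields
    strong convergence for finite [q] and weak-* convergence for [q = +oo]. Discs do not tile, and a
    vortex must be constant on most of its disc. Cells of ever finer grids are filled greedily, each
    disc taking at least a quarter of its cell, so the uncovered area decays geometrically; then
    every disc of the finite packing is slightly enlarged, and the vortex decays to 0 in the annulus
    so gained. The case [N = 0] is covered uniformly: packed vortices and probe form one component
    of speed 0, and the drifting ones are an empty family. *)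

Section SmoothCalculus.
Context {R : realType}.
Implicit Types (V W : normedModType R).

(** The two difference quotients are the same function of the increment. Through this equivalence
    the chain rule and the mean value theorem on the line transfer to directional derivatives. *)
Lemma is_derive_slice V W (f : V -> W) x v (h0 : R) df :
  is_derive (x + h0 *: v) v f df <-> is_derive h0 1 (fun h => f (x + h *: v)) df.
Proof.
have E : (fun h : R => h^-1 *: ((f \o shift (x + h0 *: v)) (h *: v) - f (x + h0 *: v)))
  = (fun h => h^-1 *: (((fun h => f (x + h *: v)) \o shift h0) (h *: 1) - f (x + h0 *: v))).
  apply/funext => h /=.
  by rewrite [h%:A]mulr1 scalerDl addrCA.
split=> -[d e]; split; move: d e; rewrite /derivable /derive /= E //.
Qed.

Lemma is_derive_slice0 V W (f : V -> W) x v df :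
  is_derive x v f df <-> is_derive (0 : R) 1 (fun h => f (x + h *: v)) df.
Proof.
have := @is_derive_slice _ _ f x v 0 df; by rewrite scale0r addr0.
Qed.

Lemma is_derive_comp1 V (h : R -> R) (f : V -> R) x v df dh :
  is_derive x v f df -> is_derive (f x) 1 h dh ->
  is_derive x v (h \o f) (dh * df).
Proof.
move=> /is_derive_slice0 df' dh'; apply/is_derive_slice0.
have := @is_derive1_comp R h (fun h : R => f (x + h *: v)) 0 dh df.
by rewrite scale0r addr0 => /(_ dh' df').
Qed.

Lemma is_derive_affine V V' W (L : V' -> V) (l : V' -> V) (f : V -> W) x v df :
  (forall x v (h : R), L (x + h *: v) = L x + h *: l v) ->
  is_derive (L x) (l v) f df -> is_derive x v (f \o L) df.
Proof.
move=> LE /is_derive_slice0 H; apply/is_derive_slice0.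
by rewrite (_ : (fun _ => _) = fun h => f (L x + h *: l v))//; apply/funext => h /=; rewrite LE.
Qed.

(** Coinduction principle behind the closure properties below: it suffices to exhibit a class of
    functions that is stable under every directional derivative. *)
Lemma smooth_coind V W (P : (V -> W) -> Prop) :
  (forall f, P f -> [/\ continuous f, forall x v, derivable f x v &
                        forall v, P ('D_v f)]) ->
  forall f, P f -> smooth f.
Proof.
move=> H f Pf vs.
suff: P (iter_derive vs f) by move=> /H[].
by elim: vs => //= v vs /H[_ _]; exact.
Qed.

Lemma smooth_cont V W (f : V -> W) : smooth f -> continuous f.
Proof. by case/(_ [::]). Qed.

Lemma smooth_derivable V W (f : V -> W) x v : smooth f -> derivable f x v.
Proof. by case/(_ [::]) => _; exact. Qed.

Lemma smooth_is_derive V W (f : V -> W) x v :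
  smooth f -> is_derive x v f ('D_v f x).
Proof. by move=> sf; apply: derivableP; exact: smooth_derivable. Qed.

Lemma smooth_derive V W (f : V -> W) v : smooth f -> smooth ('D_v f).
Proof.
move=> sf vs; have := sf (rcons vs v).
by rewrite /iter_derive -cats1 foldr_cat.
Qed.

Lemma smooth_cst V W (c : W) : smooth (fun _ : V => c).
Proof.
apply: (@smooth_coind _ _ (fun f => exists c, f = fun _ => c)); last by exists c.
move=> _ [{}c ->]; split.
- by move=> x; exact: cst_continuous.
- by move=> x v; exact: derivable_cst.
- by move=> v; exists 0; apply/funext => x; exact: derive_cst.
Qed.

Lemma smoothD V W (f g : V -> W) : smooth f -> smooth g ->
  smooth (fun x => f x + g x).
Proof. by move=> sf sg; have := @smooth_lin _ _ _ 1 _ _ sf sg; rewrite scale1r. Qed.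

Lemma smoothZ V W (a : R) (f : V -> W) : smooth f -> smooth (fun x => a *: f x).
Proof.
move=> sf; have := smooth_lin a sf (@smooth0 _ V W).
by rewrite addr0.
Qed.

Lemma smoothN V W (f : V -> W) : smooth f -> smooth (fun x => - f x).
Proof.
move=> /(smoothZ (-1)) sf.
by rewrite (_ : (fun x => - f x) = fun x => -1 *: f x)//; apply/funext => x; rewrite scaleN1r.
Qed.

Lemma smoothB V W (f g : V -> W) : smooth f -> smooth g ->
  smooth (fun x => f x - g x).
Proof. by move=> sf /smoothN; exact: smoothD. Qed.

Lemma smooth_sum V W (I : Type) (r : seq I) (P : pred I) (f : I -> V -> W) :
  (forall i, P i -> smooth (f i)) ->
  smooth (fun x => \sum_(i <- r | P i) f i x).
Proof.
move=> sf; elim: r => [|i r IH].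
  rewrite (_ : (fun _ => _) = fun=> 0); first exact: smooth_cst.
  by apply/funext => x; rewrite big_nil.
have [Pi|Pi] := boolP (P i).
  rewrite (_ : (fun _ => _) = fun x => f i x + \sum_(i <- r | P i) f i x).
    by apply: smoothD => //; exact: sf.
  by apply/funext => x; rewrite big_cons Pi.
rewrite (_ : (fun _ => _) = fun x => \sum_(i <- r | P i) f i x)//.
by apply/funext => x; rewrite big_cons (negbTE Pi).
Qed.

(* The class generated by smooth functions under products and postcomposition
   is stable by differentiation, which makes it a coinduction invariant. *)
Inductive alg_smooth V : (V -> R) -> Prop :=
| AlgSmooth f of smooth f : alg_smooth f
| AlgD f g of alg_smooth f & alg_smooth g : alg_smooth (fun x => f x + g x)
| AlgM f g of alg_smooth f & alg_smooth g : alg_smooth (fun x => f x * g x)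
| AlgC (h : R -> R) f of smooth h & alg_smooth f : alg_smooth (h \o f).

Lemma alg_smoothP V (f : V -> R) : alg_smooth f -> smooth f.
Proof.
apply: smooth_coind => {}f; elim=> {f}.
- move=> f sf; split; [exact: smooth_cont|by move=> x v; exact: smooth_derivable|].
  by move=> v; apply: AlgSmooth; exact: smooth_derive.
- move=> f g _ [cf df Df] _ [cg dg Dg]; split.
  + by move=> x; apply: continuousD; [exact: cf|exact: cg].
  + by move=> x v; apply: derivableD.
  + move=> v; rewrite (_ : 'D_v _ = fun x => 'D_v f x + 'D_v g x); last first.
      by apply/funext => x; rewrite deriveD.
    exact: AlgD.
- move=> f g af [cf df Df] ag [cg dg Dg]; split.
  + by move=> x; apply: continuousM; [exact: cf|exact: cg].
  + by move=> x v; apply: derivableM.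
  + move=> v; rewrite (_ : 'D_v _ = fun x => f x * 'D_v g x + g x * 'D_v f x); last first.
      by apply/funext => x; rewrite deriveM.
    by apply: AlgD; apply: AlgM.
- move=> h f sh af [cf df Df].
  have D x v : is_derive x v (h \o f) ('D_1 h (f x) * 'D_v f x).
    by apply: is_derive_comp1; [exact: derivableP|exact: smooth_is_derive].
  split.
  + by move=> x; apply: continuous_comp; [exact: cf|exact: smooth_cont].
  + by move=> x v; have [] := D x v.
  + move=> v; rewrite (_ : 'D_v _ = fun x => ('D_1 h \o f) x * 'D_v f x); last first.
      by apply/funext => x; have [] := D x v.
    apply: (@AlgM _ ('D_1 h \o f)); last exact: Df.
    by apply: AlgC af; exact: smooth_derive.
Qed.

Lemma smoothM V (f g : V -> R) : smooth f -> smooth g ->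
  smooth (fun x => f x * g x).
Proof. by move=> sf sg; apply: alg_smoothP; apply: AlgM; exact: AlgSmooth. Qed.

Lemma smooth_comp1 V (h : R -> R) (f : V -> R) : smooth h -> smooth f ->
  smooth (h \o f).
Proof. by move=> sf sg; apply: alg_smoothP; apply: AlgC => //; exact: AlgSmooth. Qed.

Lemma smooth_affine V V' W (L : V' -> V) (l : V' -> V) (f : V -> W) :
  (forall x v (h : R), L (x + h *: v) = L x + h *: l v) -> continuous L ->
  smooth f -> smooth (f \o L).
Proof.
move=> LE cL sf.
apply: (@smooth_coind _ _ (fun g => exists2 f, smooth f & g = f \o L)); last by exists f.
move=> _ [{sf}f sf ->].
have D x v : is_derive x v (f \o L) ('D_(l v) f (L x)).
  apply: (is_derive_affine (l := l)) => //; exact: smooth_is_derive.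
split.
- by move=> x; apply: continuous_comp; [exact: cL|exact: smooth_cont].
- by move=> x v; have [] := D x v.
- move=> v; exists ('D_(l v) f); first exact: smooth_derive.
  by apply/funext => x; have [] := D x v.
Qed.

Lemma smooth_shift V W (c : V) (f : V -> W) :
  smooth f -> smooth (fun x => f (x + c)).
Proof.
apply: (@smooth_affine V V W (fun x => x + c) id) => [x v h|x].
  by rewrite addrAC.
by apply: continuousD; [exact: id|exact: cst_continuous].
Qed.

Lemma derive_shiftp V W (c : V) (f : V -> W) v x : smooth f ->
  'D_v (fun y => f (y + c)) x = 'D_v f (x + c).
Proof.
move=> sf; have H := smooth_is_derive (x + c) v sf.
have := @is_derive_affine V V W (fun x => x + c) id f x v _ _ H.
by case=> // y w h; rewrite addrAC.
Qed.

Lemma smooth_local V W (f : V -> W) :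
  (forall x0 : V, exists2 g, smooth g & \forall x \near x0, f x = g x) -> smooth f.
Proof.
move: f; apply: smooth_coind => f Hf; split.
- move=> x; have [g sg fg] := Hf x.
  have fgx : f x = g x by exact: (nbhs_singleton fg).
  rewrite /continuous_at fgx.
  apply: cvg_trans (smooth_cont sg (x:=x)).
  by apply: near_eq_cvg; near do apply/esym.
- move=> x v; have [g sg fg] := Hf x.
  apply: (@near_eq_derivable _ _ _ g); last exact: smooth_derivable.
  by near do apply/esym.
- move=> v x; have [g sg fg] := Hf x; exists ('D_v g); first exact: smooth_derive.
  (* Equality of derivatives at [y] requires agreement near [y], hence the passage to the interior
     of the agreement set. *)
  move/nbhs_interior : fg; apply: filterS => y fg.
  exact: near_eq_derive.
Unshelve. all: by end_near. Qed.

Lemma is_derive_pair V W1 W2 (f : V -> W1) (g : V -> W2) x v df dg :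
  is_derive x v f df -> is_derive x v g dg ->
  is_derive x v (fun y => (f y, g y)) (df, dg).
Proof.
move=> [df1 df2] [dg1 dg2].
suff H : (fun h : R => h^-1 *: (((fun y => (f y, g y)) \o shift x) (h *: v) - (f x, g x)))
    @ 0^' --> (df, dg).
  split; first by apply/cvg_ex; exists (df, dg).
  exact: cvg_lim.
have H1 : (fun h : R => h^-1 *: ((f \o shift x) (h *: v) - f x)) @ 0^' --> df.
  by rewrite -df2; exact: df1.
have H2 : (fun h : R => h^-1 *: ((g \o shift x) (h *: v) - g x)) @ 0^' --> dg.
  by rewrite -dg2; exact: dg1.
exact: (cvg_pair H1 H2).
Qed.

Lemma is_derive_fst V W1 W2 (f : V -> W1 * W2) x v df :
  is_derive x v f df -> is_derive x v (fun y => (f y).1) df.1.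
Proof.
move=> [df1 df2].
suff H : (fun h : R => h^-1 *: (((fun y => (f y).1) \o shift x) (h *: v) - (f x).1))
    @ 0^' --> df.1.
  split; first by apply/cvg_ex; exists df.1.
  exact: cvg_lim.
rewrite -df2.
apply: (@cvg_comp _ _ _ (fun h : R => h^-1 *: ((f \o shift x) (h *: v) - f x)) fst _ _ _ df1).
exact: cvg_fst.
Qed.

Lemma is_derive_snd V W1 W2 (f : V -> W1 * W2) x v df :
  is_derive x v f df -> is_derive x v (fun y => (f y).2) df.2.
Proof.
move=> [df1 df2].
suff H : (fun h : R => h^-1 *: (((fun y => (f y).2) \o shift x) (h *: v) - (f x).2))
    @ 0^' --> df.2.
  split; first by apply/cvg_ex; exists df.2.
  exact: cvg_lim.
rewrite -df2.
apply: (@cvg_comp _ _ _ (fun h : R => h^-1 *: ((f \o shift x) (h *: v) - f x)) snd _ _ _ df1).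
exact: cvg_snd.
Qed.

Lemma smooth_pair V W1 W2 (f : V -> W1) (g : V -> W2) : smooth f -> smooth g ->
  smooth (fun x => (f x, g x)).
Proof.
move=> sf sg.
apply: (@smooth_coind _ _ (fun F => exists f g, [/\ smooth f, smooth g & F = fun x => (f x, g x)])); last by exists f, g.
move=> _ [{sf}f [{sg}g [sf sg ->]]].
have D x v : is_derive x v (fun x => (f x, g x)) ('D_v f x, 'D_v g x).
  by apply: is_derive_pair; exact: smooth_is_derive.
split.
- move=> x; apply: cvg_pair => /=; exact: smooth_cont.
- by move=> x v; have [] := D x v.
- move=> v; exists ('D_v f), ('D_v g); split; try exact: smooth_derive.
  by apply/funext => x; have [] := D x v.
Qed.

Lemma smooth_fst V W1 W2 (F : V -> W1 * W2) : smooth F -> smooth (fun x => (F x).1).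
Proof.
move=> sF.
apply: (@smooth_coind _ _ (fun f => exists2 F : V -> W1 * W2, smooth F & f = fun x => (F x).1)); last by exists F.
move=> _ [{sF}F sF ->].
have D x v : is_derive x v (fun x => (F x).1) ('D_v F x).1.
  by apply: is_derive_fst; exact: smooth_is_derive.
split.
- move=> x; apply: (@continuous_comp _ _ _ F fst); [exact: smooth_cont|exact: cvg_fst].
- by move=> x v; have [] := D x v.
- move=> v; exists ('D_v F); first exact: smooth_derive.
  by apply/funext => x; have [] := D x v.
Qed.

Lemma smooth_snd V W1 W2 (F : V -> W1 * W2) : smooth F -> smooth (fun x => (F x).2).
Proof.
move=> sF.
apply: (@smooth_coind _ _ (fun f => exists2 F : V -> W1 * W2, smooth F & f = fun x => (F x).2)); last by exists F.
move=> _ [{sF}F sF ->].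
have D x v : is_derive x v (fun x => (F x).2) ('D_v F x).2.
  by apply: is_derive_snd; exact: smooth_is_derive.
split.
- move=> x; apply: (@continuous_comp _ _ _ F snd); [exact: smooth_cont|exact: cvg_snd].
- by move=> x v; have [] := D x v.
- move=> v; exists ('D_v F); first exact: smooth_derive.
  by apply/funext => x; have [] := D x v.
Qed.

Lemma smooth_id V : smooth (fun x : V => x).
Proof.
apply: (@smooth_coind _ _ (fun f => f = id \/ exists c, f = fun _ => c)); last by left.
move=> _ [->|[c ->]]; split.
- by move=> x; exact: id.
- by move=> x v; exact: derivable_id.
- by move=> v; right; exists v; apply/funext => x; exact: derive_id.
- by move=> x; exact: cst_continuous.
- by move=> x v; exact: derivable_cst.
- by move=> v; right; exists 0; apply/funext => x; exact: derive_cst.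
Qed.

End SmoothCalculus.

(* Otherwise unification unfolds iterated derivatives and limits. *)
#[global] Opaque smooth derive derivable.

(** * Symmetry of second derivatives *)

Section Schwarz.
Context {R : realType} {V : normedModType R}.
Implicit Types f : V -> R.

Lemma line_mvt f x v (h : R) : smooth f -> 0 < h ->
  exists2 s, 0 < s < h & f (x + h *: v) - f x = h * 'D_v f (x + s *: v).
Proof.
move=> sf h0.
have D (s : R) : is_derive s 1 (fun s => f (x + s *: v)) ('D_v f (x + s *: v)).
  exact: (proj1 (@is_derive_slice _ _ _ f x v s _) (smooth_is_derive _ _ sf)).
have [|s sh] := @MVT R (fun s => f (x + s *: v)) (fun s => 'D_v f (x + s *: v)) 0 h h0 (fun s _ => D s).
  apply: continuous_subspaceT => s; apply/differentiable_continuous/derivable1_diffP.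
  by have [] := D s.
rewrite scale0r addr0 subr0 mulrC => E; exists s => //.
Qed.

(** The mean value theorem is applied in direction [v] to [f (. + h w) - f], then in direction [w]
    to ['D_v f]. The left-hand side is symmetric in [v] and [w], the right-hand side is not: this is
    the source of the symmetry of mixed derivatives. *)
Lemma second_difference f x v w (h : R) : smooth f -> 0 < h ->
  exists s t, [/\ 0 < s < h, 0 < t < h &
    f (x + h *: v + h *: w) - f (x + h *: v) - f (x + h *: w) + f x =
    h * h * 'D_w ('D_v f) (x + (s *: v + t *: w))].
Proof.
move=> sf h0.
have sg : smooth (fun y => f (y + h *: w) - f y).
  exact: smoothB (smooth_shift _ sf) sf.
have [s sh E] := line_mvt x v sg h0.
have [t th E2] := line_mvt (x + s *: v) w (smooth_derive v sf) h0.
exists s, t; split; [exact: sh|exact: th|rewrite addrA -mulrA -E2].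
transitivity (f (x + h *: v + h *: w) - f (x + h *: v) - (f (x + h *: w) - f x)).
  by ring.
rewrite E; congr (_ * _).
rewrite deriveB; [|exact: smooth_derivable (smooth_shift _ sf)|exact: smooth_derivable].
by rewrite derive_shiftp.
Qed.

Lemma derive_comm f v w : smooth f -> 'D_v ('D_w f) = 'D_w ('D_v f).
Proof.
move=> sf; apply/funext => x; apply/eqP; rewrite -subr_eq0 -normr_eq0 eq_le normr_ge0 andbT.
apply/ler_addgt0Pl => e e0; rewrite addr0.
have e20 : 0 < e / 2 by rewrite divr_gt0.
have c1 := smooth_cont (smooth_derive v (smooth_derive w sf)) (x:=x).
have c2 := smooth_cont (smooth_derive w (smooth_derive v sf)) (x:=x).
move/cvgrPdist_le : c1 => /(_ _ e20) /nbhs_normP[d1 /= d10 H1].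
move/cvgrPdist_le : c2 => /(_ _ e20) /nbhs_normP[d2 /= d20 H2].
(* Dividing the smaller continuity radius by [k] keeps all intermediate points [x + s v + t w]
   within both radii; the [+ 1] covers the case of two zero directions. *)
pose k := `|v| + `|w| + 1.
have k0 : 0 < k by rewrite ltr_wpDl// addr_ge0.
pose h := Num.min d1 d2 / k.
have m0 : 0 < Num.min d1 d2 by rewrite lt_min d10.
have h0 : 0 < h by rewrite divr_gt0.
have close s t d : 0 < s < h -> 0 < t < h -> Num.min d1 d2 <= d ->
    ball_ Num.norm x d (x + (s *: v + t *: w)).
  move=> /andP[s0 sh] /andP[t0 th] md; rewrite /ball_/= opprD addNKr normrN.
  apply: lt_le_trans md.
  apply: (@le_lt_trans _ _ (h * `|v| + h * `|w|)).
    apply: (le_trans (ler_normD _ _)); rewrite !normrZ !gtr0_norm//.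
    by apply: lerD; rewrite ler_wpM2r// ltW.
  rewrite -mulrDr /h mulrAC ltr_pdivrMr// ltr_pM2l//.
  by rewrite /k ltrDl.
have [s [t [sh th E1]]] := second_difference x w v sf h0.
have [s' [t' [sh' th' E2]]] := second_difference x v w sf h0.
(* Both mixed derivatives, at their own intermediate points, equal the same second difference
   divided by [h * h]. *)
have E : 'D_v ('D_w f) (x + (s *: w + t *: v)) = 'D_w ('D_v f) (x + (s' *: v + t' *: w)).
  have hh : h * h != 0 by rewrite mulf_neq0// gt_eqF.
  have AC : x + h *: w + h *: v = x + h *: v + h *: w by rewrite addrAC.
  apply: (mulfI hh); apply: etrans (esym E1) _; apply: etrans E2.
  by rewrite AC (addrAC (f (x + h *: v + h *: w))).
have := H1 _ (close t s d1 th sh _); rewrite ge_min lexx => /(_ isT).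
have := H2 _ (close s' t' d2 sh' th' _); rewrite ge_min lexx orbT => /(_ isT).
rewrite -E [t *: v + _]addrC.
set A := 'D_v ('D_w f) x; set B := 'D_w ('D_v f) x; set C := 'D_v _ _.
move: C A B => C A B h1 h2.
rewrite (_ : A - B = A - C + (C - B)); last by rewrite addrA subrK.
apply: (le_trans (ler_normD _ _)); rewrite (splitr e); apply: lerD; first exact: h2.
by rewrite distrC.
Qed.

End Schwarz.

(** * Flat functions and cutoffs *)

Section Cutoff.
Context {R : realType}.
Implicit Types f g h : R -> R.

(** In one variable the derivative along [v] is [v] times the derivative along 1, so a single
    derivative has to be tracked; the factor is absorbed by the constant [c] of the invariant. *)
Lemma smooth1_coind (P : (R -> R) -> Prop) :
  (forall f, P f -> exists2 f', P f' & forall x : R, is_derive x 1 f (f' x)) ->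
  forall f, P f -> smooth f.
Proof.
move=> HP f Pf.
apply: (@smooth_coind R R R (fun g => exists c f, P f /\ g = fun x => c * f x)); last first.
  by exists 1, f; split=> //; apply/funext => x; rewrite mul1r.
move=> _ [c [{Pf}f [Pf ->]]]; have [f' Pf' Hf] := HP _ Pf.
have D x v : is_derive x v (fun x => c * f x) (c * v * f' x).
  have H1 : is_derive x v (f \o id) (f' x * v).
    exact: (is_derive_comp1 (is_derive_id x v) (Hf x)).
  by apply: is_derive_eq (is_deriveZ c H1) _; rewrite -mulrA [v * _]mulrC.
split.
- move=> x; apply: (@differentiable_continuous R R R x).
  by apply/derivable1_diffP; have [] := D x 1.
- by move=> x v; have [] := D x v.
- move=> v; exists (c * v), f'; split=> //; apply/funext => x.
  by have [] := D x v.
Qed.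

(** The member [n = 0] is the classical flat function [exp (-1/x)]; the other powers are included
    because differentiation produces them. *)
Definition flat (n : nat) (x : R) : R :=
  if 0 < x then x ^- n * expR (- x^-1) else 0.

(** From [exp (1/x) >= (1/x)^(n+2) / (n+2)!]. A quadratic bound is what makes the derivative at the
    origin exist and vanish. *)
Lemma flat_bound n x : `|flat n x| <= n.+2`!%:R * x ^+ 2.
Proof.
rewrite /flat; case: ltP => [x0|_]; last by rewrite normr0 mulr_ge0// sqr_ge0.
have e0 := expR_gt0 (- x^-1).
rewrite ger0_norm; last by rewrite mulr_ge0// ?expR_ge0// invr_ge0 exprn_ge0// ltW.
have := @expR_ge1Dxn R x^-1 n.+1; rewrite invr_ge0 ltW// => /(_ isT) H.
have {}H : x^-1 ^+ n.+2 / n.+2`!%:R <= expR x^-1.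
  by apply: le_trans H; rewrite lerDr.
have f0 : 0 < n.+2`!%:R :> R by rewrite ltr0n fact_gt0.
rewrite expRN.
rewrite ler_pdivrMr ?expR_gt0//.
apply: (@le_trans _ _ (n.+2`!%:R * x ^+ 2 * (x^-1 ^+ n.+2 / n.+2`!%:R))); last first.
  by apply: ler_wpM2l => //; rewrite mulr_ge0// ?sqr_ge0// ltW.
rewrite (_ : n.+2`!%:R * x ^+ 2 * (x^-1 ^+ n.+2 / n.+2`!%:R) = x ^- n)//.
rewrite !exprVn -[n.+2]addn2 exprD.
have x1 : x != 0 by rewrite gt_eqF.
have xn : x ^+ n != 0 by rewrite expf_neq0.
rewrite addn2.
have f1 : n.+2`!%:R != 0 :> R by rewrite gt_eqF.
by field; rewrite x1 xn f1.
Qed.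

Lemma flat_is_derive n (x : R) :
  is_derive x 1 (flat n) (flat n.+2 x - n%:R * flat n.+1 x).
Proof.
have [x0|x0|->] := ltgtP x 0.
- rewrite /flat !(ltNge 0 x) (ltW x0)/= mulr0 subr0.
  apply: near_eq_is_derive (is_derive_cst 0 x 1).
  near=> y; rewrite /flat ifF//; apply/negbTE; rewrite -leNgt ltW//.
  by near: y; exact: lt_nbhsl.
- have x1 : x != 0 by rewrite gt_eqF.
  have xn : x ^+ n != 0 by rewrite expf_neq0.
  have DV : is_derive x 1 (fun y : R => y^-1) (- x ^- 2).
    apply: is_derive_eq (is_deriveV (f := id) x1 (is_derive_id x 1)) _.
    by rewrite /GRing.scale/= mulr1.
  have DX : is_derive x 1 (fun y : R => y ^- n) (- (x ^- n) ^+ 2 * (n%:R * x ^+ n.-1)).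
    have := is_deriveX n (is_derive_id x (1:R)).
    rewrite (_ : id ^+ n = fun y : R => y ^+ n); last by rewrite exprfctE.
    move=> H; apply: is_derive_eq (is_deriveV (f := fun y : R => y ^+ n) xn H) _.
    by rewrite [_%:A]mulr1 exprVn.
  have DE : is_derive x 1 (fun y : R => expR (- y^-1)) (expR (- x^-1) * x ^- 2).
    have H : is_derive x 1 (fun y : R => - y^-1) (x ^- 2).
      by apply: is_derive_eq (is_deriveN DV) _; rewrite opprK.
    have := is_derive_comp1 H (is_derive_expR _); exact.
  have DXE := is_deriveM DX DE.
  have fE : \forall y \near x, y ^- n * expR (- y^-1) = flat n y.
    near=> y; rewrite /flat ifT//; near: y; exact: lt_nbhsr.
  apply: is_derive_eq (near_eq_is_derive fE DXE) _.
  rewrite /flat x0 /GRing.scale/=.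
  case: n {DX DXE fE} xn => [|n] xn.
    by rewrite /= !expr0; field; rewrite x1.
  have xn' : x ^+ n != 0 by rewrite expf_neq0.
  by rewrite /= !exprS; field; rewrite x1 xn'.
- rewrite {2 3}/flat ltxx mulr0 subr0.
  suff H : (fun h : R => h^-1 *: ((flat n \o shift 0) (h *: 1) - flat n 0)) @ 0^' --> (0:R).
    by split; [apply/cvg_ex; exists 0|exact: cvg_lim].
  apply/cvgrPdist_le => e e0.
  have f0 : 0 < n.+2`!%:R :> R by rewrite ltr0n fact_gt0.
  near=> h.
  have h0 : h != 0 by near: h; exact: nbhs_dnbhs_neq.
  rewrite sub0r normrN /= addr0 [h%:A]mulr1 {2}/flat ltxx subr0 /GRing.scale/= normrM normfV.
  rewrite ler_pdivrMl ?normr_gt0//.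
  apply: (le_trans (flat_bound _ _)).
  rewrite -normr_id -{1}real_normK ?num_real// normr_id expr2 mulrCA ler_wpM2l//.
  rewrite -ler_pdivlMl//.
  near: h; apply: dnbhs0_le; by rewrite mulr_gt0// invr_gt0.
Unshelve. all: by end_near. Qed.

(** The combinations that the derivative formula of [flat] produces; the class is stable under
    differentiation. *)
Inductive flat_span : (R -> R) -> Prop :=
| FlatN n : flat_span (flat n)
| FlatB a f g of flat_span f & flat_span g : flat_span (fun x => f x - a * g x).

Lemma smooth_flat n : smooth (flat n).
Proof.
apply: (@smooth1_coind flat_span); last exact: FlatN.
move=> f; elim=> {f} [{}n|a f g _ [f' f'P Df] _ [g' g'P Dg]].
  exists (fun x => flat n.+2 x - n%:R * flat n.+1 x); last exact: flat_is_derive.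
  by apply: FlatB; exact: FlatN.
exists (fun x => f' x - a * g' x); first exact: FlatB.
by move=> x; apply: is_deriveB; apply: is_deriveZ.
Qed.

End Cutoff.

(** * Smooth primitives and cutoff functions *)

Section Primitive.
Context {R : realType}.
Implicit Types f g h : R -> R.

(** Integration starts at [c], strictly left of [a], so that the fundamental theorem is applied only
    at interior points of an interval; left of [a] the primitive is locally zero. *)
Lemma primitive_right f (c a : R) : continuous f -> c < a ->
  (forall x, x <= a -> f x = 0) ->
  exists F : R -> R, (forall x : R, is_derive x 1 F (f x)) /\
    (forall x, x <= a -> F x = 0).
Proof.
move=> cf ca f0.
pose mu := @lebesgue_measure R.
pose F x := \int[mu]_(t in `[c, x]) f t.
have F0 x : x <= a -> F x = 0.
  move=> xa; rewrite /F (@eq_Rintegral _ _ _ mu `[c, x] (cst 0)).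
    by rewrite Rintegral_cst//= mul0r.
  by move=> t; rewrite inE/= in_itv/= => /andP[_ tx]; rewrite f0// (le_trans tx).
exists F; split=> // x.
have [xa|ax] := ltP x a.
  rewrite f0 ?ltW//.
  apply: near_eq_is_derive (is_derive_cst 0 x 1).
  near=> y; rewrite F0// ltW//; near: y; exact: lt_nbhsl.
have cx : c < x by exact: lt_le_trans ax.
have xx : x < x + 1 by rewrite ltrDl.
have If : mu.-integrable `[c, x + 1] (EFin \o f).
  apply: continuous_compact_integrable; first exact: segment_compact.
  exact: continuous_subspaceT.
have [d e] := continuous_FTC1_closed xx If cx (cf x).
split; [exact: d|by rewrite -derive1E].
Unshelve. all: by end_near. Qed.

Lemma primitive_smooth F f : smooth f -> (forall x : R, is_derive x 1 F (f x)) -> smooth F.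
Proof.
move=> sf DF.
apply: (@smooth1_coind _ (fun g => g = F \/ smooth g)); last by left.
move=> g [->|sg]; first by exists f => //; right.
exists ('D_1 g); first by right; exact: smooth_derive.
by move=> x; exact: smooth_is_derive.
Qed.

Lemma smooth_primitive_right f (a : R) : smooth f ->
  (forall x, x <= a -> f x = 0) ->
  exists F : R -> R, [/\ smooth F, (forall x : R, is_derive x 1 F (f x)) &
    (forall x, x <= a -> F x = 0)].
Proof.
move=> sf f0; have aa : a - 1 < a by rewrite gtrBl.
have [F [DF F0]] := primitive_right (smooth_cont sf) aa f0.
by exists F; split; [exact: primitive_smooth DF|exact: DF|exact: F0].
Qed.

Lemma smooth_opp1 f : smooth f -> smooth (fun x => f (- x)).
Proof. move=> sf; exact: (@smooth_comp1 R R f (fun x => - x) sf (smoothN (@smooth_id R R))). Qed.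

Lemma is_derive_opp1 f (x df : R) : is_derive (- x) 1 f df ->
  is_derive x 1 (fun x => - f (- x)) df.
Proof.
move=> H; have H1 := is_derive_comp1 (is_deriveN (is_derive_id x 1)) H.
by apply: is_derive_eq (is_deriveN H1) _; rewrite mulrN1 opprK.
Qed.

Lemma smooth_primitive_left f (a : R) : smooth f ->
  (forall x, a <= x -> f x = 0) ->
  exists F : R -> R, [/\ smooth F, (forall x : R, is_derive x 1 F (f x)) &
    (forall x, a <= x -> F x = 0)].
Proof.
move=> sf f0.
have [||F [sF DF F0]] := @smooth_primitive_right (fun x => f (- x)) (- a).
- exact: smooth_opp1.
- by move=> x xa; rewrite f0// lerNr.
exists (fun x => - F (- x)); split.
- exact: smoothN (smooth_opp1 sF).
- by move=> x; apply: is_derive_opp1; have := DF (- x); rewrite opprK.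
- by move=> x ax; rewrite F0 ?oppr0// lerN2.
Qed.

Lemma is_derive_cont f (df : R -> R) : (forall x : R, is_derive x 1 f (df x)) -> continuous f.
Proof.
move=> D x; apply: (@differentiable_continuous R R R x).
by apply/derivable1_diffP; have [] := D x.
Qed.

Lemma is_derive_ndecr f (df : R -> R) : (forall x : R, is_derive x 1 f (df x)) ->
  (forall x, 0 <= df x) -> {homo f : x y / x <= y}.
Proof.
move=> D H x y xy.
apply: (@ger0_derive1_ndecr _ f x y _ _ _ x y (lexx x) xy (lexx y)).
- by move=> z _; have [dz _] := D z.
- by move=> z _; rewrite derive1E; have [_ ->] := D z.
- exact: continuous_subspaceT (is_derive_cont D).
Qed.

Definition bump (a b x : R) : R := flat 0 (x - a) * flat 0 (b - x).

Lemma flat_ge0 n (x : R) : 0 <= flat n x.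
Proof.
rewrite /flat; case: ltP => // x0.
by rewrite mulr_ge0 ?expR_ge0// invr_ge0 exprn_ge0// ltW.
Qed.

Lemma flat_gt0 n (x : R) : 0 < x -> 0 < flat n x.
Proof. by move=> x0; rewrite /flat x0 mulr_gt0 ?expR_gt0// invr_gt0 exprn_gt0. Qed.

Lemma flat_eq0 n (x : R) : x <= 0 -> flat n x = 0.
Proof. by move=> x0; rewrite /flat ltNge x0. Qed.

Lemma smooth_bump (a b : R) : smooth (bump a b).
Proof.
apply: smoothM.
  exact: (@smooth_comp1 _ _ _ (fun x => x - a) (smooth_flat 0) (smooth_shift (- a) (@smooth_id R R))).
exact: (@smooth_comp1 _ _ _ (fun x => b - x) (smooth_flat 0) (smoothB (@smooth_cst R R R b) (@smooth_id R R))).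
Qed.

Lemma bump_ge0 (a b x : R) : 0 <= bump a b x.
Proof. by rewrite mulr_ge0 ?flat_ge0. Qed.

Lemma bump_gt0 (a b x : R) : a < x < b -> 0 < bump a b x.
Proof. by move=> /andP[ax xb]; rewrite mulr_gt0// flat_gt0// subr_gt0. Qed.

Lemma bump_eq0 (a b x : R) : x <= a \/ b <= x -> bump a b x = 0.
Proof.
by case=> H; rewrite /bump; [rewrite flat_eq0 ?mul0r|rewrite [X in _ * X]flat_eq0 ?mulr0]; rewrite ?subr_le0.
Qed.

(* [H], a primitive of [4 g'^2], is the pressure of the vortex with stream
   function [g (|z|^2)], up to the factor [1/2]. *)
Lemma cutoff_exists (a b : R) : a < b -> exists g H : R -> R,
  [/\ smooth g, smooth H,
      forall s, s <= a -> g s = 1,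
      (forall s, b <= s -> g s = 0 /\ H s = 0) &
   [/\ forall s, 0 <= g s <= 1,
       forall s, a < s < b -> 'D_1 g s < 0,
       forall s, s <= a \/ b <= s -> 'D_1 g s = 0 &
       forall s, 'D_1 H s = 4 * 'D_1 g s ^+ 2]].
Proof.
move=> ab.
have sb := smooth_bump a b.
have [x xa|F [sF DF F0]] := @smooth_primitive_right (bump a b) a sb.
  by rewrite bump_eq0//; left.
have Fnd := is_derive_ndecr DF (bump_ge0 a b).
have Fb0 : 0 < F b.
  rewrite -(F0 a (lexx a)).
  apply: (@gtr0_derive1_incr _ F a b _ _ _ a b (lexx a) ab (lexx b)).
  - by move=> z _; have [dz _] := DF z.
  - by move=> z; rewrite in_itv/= => zab; rewrite derive1E; have [_ ->] := DF z; exact: bump_gt0.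
  - exact: continuous_subspaceT (is_derive_cont DF).
have Fc s : b <= s -> F s = F b.
  move=> bs.
  have : F s <= F b.
    apply: (@ler0_derive1_nincr _ F b s _ _ _ b s (lexx b) bs (lexx s)).
    - by move=> z _; have [dz _] := DF z.
    - move=> z; rewrite in_itv/= => /andP[/ltW bz _]; rewrite derive1E; have [_ ->] := DF z.
      by rewrite bump_eq0//; right.
    - exact: continuous_subspaceT (is_derive_cont DF).
  by move=> H; apply/eqP; rewrite eq_le H Fnd.
(* A normalized primitive of a bump: constant where the bump vanishes, strictly decreasing between
   [a] and [b]. *)
pose g s := 1 - (F b)^-1 * F s.
have Dg (s : R) : is_derive s 1 g (- ((F b)^-1 * bump a b s)).
  have D := is_deriveB (is_derive_cst (1 : R) s (1 : R)) (is_deriveZ (F b)^-1 (DF s)).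
  by rewrite sub0r in D; exact: D.
have sg : smooth g.
  exact: smoothB (@smooth_cst R R R 1) (smoothZ (F b)^-1 sF).
have Dg' s : 'D_1 g s = - ((F b)^-1 * bump a b s) by have [] := Dg s.
(* Integrating from the right makes the pressure vanish outside the vortex. *)
have [||H [sH DH H0]] := @smooth_primitive_left (fun s => 4 * ('D_1 g s * 'D_1 g s)) b.
- apply: (smoothZ (V := R) (W := R) 4); apply: smoothM; exact: smooth_derive.
- by move=> s bs; rewrite Dg' bump_eq0 ?mulr0 ?oppr0 ?mulr0//; right.
exists g, H; split; [exact: sg|exact: sH| | |].
- by move=> s sa; rewrite /g (F0 s)// mulr0 subr0.
- by move=> s bs; rewrite H0// /g (Fc s)// mulVf ?subrr// gt_eqF.
split.
- move=> s; rewrite /g subr_ge0 gerBl ler_pdivrMl// mulr1 mulr_ge0 ?invr_ge0 ?(ltW Fb0)//.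
  + rewrite andbT; have [sb'|/ltW bs] := leP s b; first exact: Fnd.
    by rewrite Fc.
  + have [sa|/ltW as'] := leP s a; first by rewrite F0.
    by rewrite -(F0 a (lexx a)) Fnd.
- by move=> s sab; rewrite Dg' oppr_lt0 mulr_gt0 ?invr_gt0// bump_gt0.
- by move=> s H1; rewrite Dg' bump_eq0// mulr0 oppr0.
- by move=> s; have [_ ->] := DH s; rewrite expr2.
Qed.

End Primitive.

(** * The Frechet space of divergence-free fields *)

Section CinftyTopology.
Context {R : realType}.
Implicit Types u v w : CinftyDiv R.

(** The topology is initial for [jet], whose target is a product of spaces of uniform convergence;
    hence each partial derivative can be treated separately. *)
Lemma cinfty_cvg {T : Type} (F : set_system T) (FF : Filter F)
    (G : T -> CinftyDiv R) (l : CinftyDiv R) :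
  (forall al (e : R), 0 < e -> \forall t \near F, forall x,
     `|multi_derive al l x - multi_derive al (G t) x| < e) ->
  G @ F --> l.
Proof.
move=> H.
have Hj : (@jet R \o G) @ F --> @jet R l.
  apply/cvg_sup => al A [B [[C oC <-] /= Cl] BA].
  have nC : nbhs (multi_derive al l : {uniform (R * R) -> (R * R)}) C.
    exact: open_nbhs_nbhs.
  move/uniform_nbhs : nC => [E [entE EC]].
  move: entE; rewrite -entourage_ballE => -[e e0 eE].
  have := H al e e0; apply: filterS => t Ht.
  apply: BA => /=; apply: EC => x _; apply: eE => /=.
  rewrite -ball_normE; exact: Ht.
move=> A [B [[C oC <-] /= Cl] BA].
have nC : nbhs (@jet R l) C by exact: open_nbhs_nbhs.
have HC : F [set t | C (@jet R (G t))] by exact: (Hj _ nC).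
exact: (@filterS _ F FF _ _ (fun t Ct => BA (G t) Ct) HC).
Qed.

Lemma cinfty_eval_continuous (x : R * R) : continuous (fun u : CinftyDiv R => u x).
Proof.
move=> u A nA.
have nC : nbhs (@jet R u) [set f | A (f (0%N, 0%N) x)].
  have pc := @proj_continuous _ (fun _ : nat * nat => {uniform (R * R) -> (R * R)}) (0%N,0%N) (@jet R u).
  apply: (pc [set f | A (f x)]).
  apply/uniform_nbhs.
  move: nA; rewrite -nbhs_entourageE => -[E entE EA].
  by exists E; split=> // h /(_ x Logic.I) Eh; apply: EA; apply/xsectionP.
exact: (@initial_continuous _ _ (@jet R) u _ nC).
Qed.

Lemma cinfty_hausdorff : hausdorff_space (CinftyDiv R).
Proof.
move=> u v uv; apply/val_inj/funext => x.
apply: (@norm_hausdorff R (R * R)%type) => A B nA nB.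
have [w [wA wB]] := uv _ _ (@cinfty_eval_continuous x u _ nA) (@cinfty_eval_continuous x v _ nB).
by exists (w x).
Qed.

End CinftyTopology.

(** * Mean value estimates for plane fields and reduction modulo the periods *)

Section FieldCalculus.
Context {R : realType}.
Implicit Types (V : normedModType R).

Lemma mvt1 V (f : V -> R) x v : smooth f ->
  exists2 s, 0 < s < 1 & f (x + v) - f x = 'D_v f (x + s *: v).
Proof.
move=> sf; have [s s01] := line_mvt x v sf ltr01.
by rewrite scale1r mul1r => E; exists s.
Qed.

Lemma derive_dirZ V (f : V -> R) x v (c : R) : smooth f ->
  'D_(c *: v) f x = c * 'D_v f x.
Proof.
move=> sf.
have D : is_derive x (c *: v) f ('D_v f x * c).
  apply/is_derive_slice0.
  have H : is_derive (c * 0) (1:R) (fun k : R => f (x + k *: v)) ('D_v f x).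
    rewrite mulr0; apply: (proj1 (@is_derive_slice0 _ _ _ f x v _)).
    exact: smooth_is_derive.
  have L : is_derive (0 : R) 1 (fun h : R => c * h) c.
    by have := is_deriveZ c (is_derive_id (0:R) 1); rewrite /GRing.scale/= mulr1.
  have := is_derive_comp1 L H.
  rewrite (_ : _ \o _ = fun h => f (x + h *: (c *: v)))//.
  by apply/funext => h /=; rewrite scalerA mulrC.
by have [_ ->] := D; rewrite mulrC.
Qed.

Lemma derive_fst V (f : V -> R * R) x v : smooth f ->
  ('D_v f x).1 = 'D_v (fun y => (f y).1) x.
Proof. by move=> sf; have [_ ->] := is_derive_fst (smooth_is_derive x v sf). Qed.

Lemma derive_snd V (f : V -> R * R) x v : smooth f ->
  ('D_v f x).2 = 'D_v (fun y => (f y).2) x.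
Proof. by move=> sf; have [_ ->] := is_derive_snd (smooth_is_derive x v sf). Qed.

Lemma derive_fst_fun V (f : V -> R * R) v : smooth f ->
  (fun x => ('D_v f x).1) = 'D_v (fun y => (f y).1).
Proof. by move=> sf; apply/funext => x; exact: derive_fst. Qed.

Lemma derive_snd_fun V (f : V -> R * R) v : smooth f ->
  (fun x => ('D_v f x).2) = 'D_v (fun y => (f y).2).
Proof. by move=> sf; apply/funext => x; exact: derive_snd. Qed.

Lemma pair_ext (T U : Type) (p q : T * U) : p.1 = q.1 -> p.2 = q.2 -> p = q.
Proof. by case: p q => [a b] [c d] /= -> ->. Qed.

Lemma derive_comm2 V (f : V -> R * R) v w : smooth f ->
  'D_v ('D_w f) = 'D_w ('D_v f).
Proof.
move=> sf; apply/funext => x.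
have sv := smooth_derive v sf; have sw := smooth_derive w sf.
apply: pair_ext.
  have E u t : smooth ('D_t f) -> ('D_u ('D_t f) x).1 = 'D_u ('D_t (fun y => (f y).1)) x.
    move=> st; apply: etrans (derive_fst x u st) _.
    exact: (f_equal (fun g : V -> R => derive g x u) (derive_fst_fun t sf)).
  apply: etrans (E _ _ sw) _; apply: etrans (esym (E _ _ sv)).
  exact: (f_equal (fun g => g x) (derive_comm v w (smooth_fst sf))).
have E u t : smooth ('D_t f) -> ('D_u ('D_t f) x).2 = 'D_u ('D_t (fun y => (f y).2)) x.
  move=> st; apply: etrans (derive_snd x u st) _.
  exact: (f_equal (fun g : V -> R => derive g x u) (derive_snd_fun t sf)).
apply: etrans (E _ _ sw) _; apply: etrans (esym (E _ _ sv)).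
exact: (f_equal (fun g => g x) (derive_comm v w (smooth_snd sf))).
Qed.

Lemma iter_derive_shift V (W : normedModType R) (f : V -> W) c vs : smooth f ->
  iter_derive vs (fun x => f (x + c)) = fun x => iter_derive vs f (x + c).
Proof.
move=> sf; have sI us : smooth (iter_derive us f).
  by elim: us => [|u us IH /=]; [exact: sf|exact: smooth_derive IH].
elim: vs => [|v vs /= ->]; first by [].
by apply/funext => x; exact: derive_shiftp (sI vs).
Qed.

Lemma smooth_iter_derive V (W : normedModType R) (f : V -> W) vs :
  smooth f -> smooth (iter_derive vs f).
Proof. by move=> sf; elim: vs => [|u us IH /=]; [exact: sf|exact: smooth_derive IH]. Qed.

Lemma iter_derive_comm2 V (f : V -> R * R) v vs : smooth f ->
  iter_derive vs ('D_v f) = 'D_v (iter_derive vs f).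
Proof.
move=> sf; elim: vs => [|u us /= ->]; first by [].
apply: derive_comm2; exact: smooth_iter_derive.
Qed.

Lemma multi_deriveE (W : normedModType R) al (f : R * R -> W) :
  multi_derive al f = iter_derive (nseq al.1 ((1, 0) : R * R) ++ nseq al.2 ((0, 1) : R * R)) f.
Proof.
rewrite /multi_derive /iter_derive foldr_cat.
have H n v g : iter n (fun g : R * R -> W => 'D_v g) g = foldr (fun v g => 'D_v g) g (nseq n v).
  by elim: n => //= n ->.
by rewrite -!H.
Qed.

Lemma norm_pair_le (p : R * R) (e : R) : `|p.1| <= e -> `|p.2| <= e -> `|p| <= e.
Proof. by move=> h1 h2; rewrite prod_normE ge_max h1 h2. Qed.

Lemma norm_fst_le (p : R * R) : `|p.1| <= `|p|.
Proof. by rewrite prod_normE le_max lexx. Qed.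

Lemma norm_snd_le (p : R * R) : `|p.2| <= `|p|.
Proof. by rewrite prod_normE le_max lexx orbT. Qed.

(** The mean value theorem needs scalar functions; it is applied to each component, which loses
    nothing because the norm of a pair is the maximum. *)
Lemma lip_dir (f : R * R -> R * R) v M : smooth f ->
  (forall x, `|'D_v f x| <= M) ->
  forall x (h : R), `|f (x + h *: v) - f x| <= `|h| * M.
Proof.
move=> sf HM x h; apply: norm_pair_le.
  have sg := smooth_fst sf.
  have [s _ E] := mvt1 x (h *: v) sg.
  rewrite [X in `|X|](_ : _ = (f (x + h *: v)).1 - (f x).1)// E derive_dirZ// normrM ler_wpM2l//.
  by rewrite -derive_fst//; apply: le_trans (HM _); exact: norm_fst_le.
have sg := smooth_snd sf.
have [s _ E] := mvt1 x (h *: v) sg.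
rewrite [X in `|X|](_ : _ = (f (x + h *: v)).2 - (f x).2)// E derive_dirZ// normrM ler_wpM2l//.
by rewrite -derive_snd//; apply: le_trans (HM _); exact: norm_snd_le.
Qed.

(** The mean value theorem gives the derivative at an intermediate point, and [lip_dir] compares it
    with the derivative at [x]. The quadratic remainder makes difference quotients converge
    uniformly in [x]. *)
Lemma taylor_dir (f : R * R -> R * R) v M : smooth f ->
  (forall x, `|'D_v ('D_v f) x| <= M) ->
  forall x (h : R), `|f (x + h *: v) - f x - h *: 'D_v f x| <= `|h| * (`|h| * M).
Proof.
move=> sf HM x h.
have sD := smooth_derive v sf.
have L s : 0 < s < 1 -> `|'D_v f (x + s *: (h *: v)) - 'D_v f x| <= `|h| * M.
  move=> /andP[s0 s1]; rewrite scalerA.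
  apply: le_trans (lip_dir sD HM x (s * h)) _.
  have M0 : 0 <= M by apply: le_trans (HM 0).
  by rewrite normrM ler_wpM2r// (ger0_norm (ltW s0)) ler_piMl// ltW.
apply: norm_pair_le.
  have sg := smooth_fst sf.
  have [s s01 E] := mvt1 x (h *: v) sg.
  rewrite [X in `|X|](_ : _ = (f (x + h *: v)).1 - (f x).1 - h * ('D_v f x).1)// E derive_dirZ//.
  rewrite -derive_fst// -mulrBr normrM ler_wpM2l//.
  by apply: le_trans (L s s01); exact: (norm_fst_le ('D_v f (x + s *: (h *: v)) - 'D_v f x)).
have sg := smooth_snd sf.
have [s s01 E] := mvt1 x (h *: v) sg.
rewrite [X in `|X|](_ : _ = (f (x + h *: v)).2 - (f x).2 - h * ('D_v f x).2)// E derive_dirZ//.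
rewrite -derive_snd// -mulrBr normrM ler_wpM2l//.
by apply: le_trans (L s s01); exact: (norm_snd_le ('D_v f (x + s *: (h *: v)) - 'D_v f x)).
Qed.

Lemma twopi_gt0 : 0 < 2 * pi :> R.
Proof. by rewrite mulr_gt0// pi_gt0. Qed.

Definition tmod (y : R) : R := y - 2 * pi * (Num.floor (y / (2 * pi)))%:~R.

Lemma tmod_itv y : 0 <= tmod y < 2 * pi.
Proof.
rewrite /tmod; move: (2 * pi) twopi_gt0 => P p0.
have /andP[h1 h2] := floor_itv (y / P).
move: h1 h2; rewrite ler_pdivlMr// ltr_pdivrMr// intrD mulrDl mul1r => h1 h2.
by rewrite subr_ge0 mulrC h1/= ltrBlDr addrC.
Qed.

Definition trep (x : R * R) : R * R := (tmod x.1, tmod x.2).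

Lemma trep_shift (x : R * R) : exists m n : int,
  x = trep x + (2 * pi * m%:~R, 2 * pi * n%:~R).
Proof.
exists (Num.floor (x.1 / (2 * pi))), (Num.floor (x.2 / (2 * pi))).
by apply: pair_ext; rewrite /= subrK.
Qed.

Lemma periodic2_trep (T : Type) (f : R * R -> T) x : periodic2 f -> f x = f (trep x).
Proof. by move=> pf; have [m [n E]] := trep_shift x; by rewrite {1}E pf. Qed.

End FieldCalculus.

(** * Horizontal translations of divergence-free fields *)

Section Translations.
Context {R : realType}.
Implicit Types (u v w : CinftyDiv R).

Lemma periodic2_bounded (f : R * R -> R * R) : continuous f -> periodic2 f ->
  exists M, forall x, `|f x| <= M.
Proof.
move=> cf pf.
pose K : set (R * R) := `[0, 2 * pi]%classic `*` `[0, 2 * pi]%classic.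
have cK : compact K by apply: compact_setX; exact: segment_compact.
have cc : {within K, continuous (fun x => `|f x|)}.
  apply: continuous_subspaceT => x; apply: continuous_comp; first exact: cf.
  exact: norm_continuous.
have K0 : K !=set0.
  by exists (0, 0); split; rewrite /= in_itv/= lexx ltW ?twopi_gt0.
have [c Kc H] := compact_EVT_max K0 cK cc.
exists `|f c| => x; rewrite (periodic2_trep x pf); apply: H.
have /andP[a1 a2] := tmod_itv x.1; have /andP[b1 b2] := tmod_itv x.2.
by rewrite inE; split; rewrite /= in_itv/= ?a1 ?b1 ltW.
Qed.

Lemma cdivP u : [/\ smooth u, periodic2 u & forall x, divergence u x = 0].
Proof. exact/asboolP/field_ofP. Qed.

Lemma cdiv_smooth u : smooth u. Proof. by case: (cdivP u). Qed.
Lemma cdiv_periodic u : periodic2 u. Proof. by case: (cdivP u). Qed.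
Lemma cdiv_div u x : divergence u x = 0. Proof. by case: (cdivP u) => _ _; exact. Qed.

Lemma iter_derive_periodic (f : R * R -> R * R) vs :
  smooth f -> periodic2 f -> periodic2 (iter_derive vs f).
Proof.
move=> sf pf x m n.
have := iter_derive_shift (2 * pi * m%:~R, 2 * pi * n%:~R) vs sf.
rewrite (_ : (fun x => f (x + _)) = f); last by apply/funext => y; exact: pf.
by move=> /(f_equal (fun g : R * R -> R * R => g x)) E; exact: esym E.
Qed.

Lemma multi_derive_smooth al u : smooth (multi_derive al u).
Proof. rewrite multi_deriveE; exact: smooth_iter_derive (cdiv_smooth u). Qed.

Lemma multi_derive_bounded al u : exists M, forall x, `|multi_derive al u x| <= M.
Proof.
apply: periodic2_bounded; first exact: smooth_cont (multi_derive_smooth al u).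
rewrite multi_deriveE; apply: iter_derive_periodic; [exact: cdiv_smooth|exact: cdiv_periodic].
Qed.

Lemma multi_derive_lin al (a : R) u v x :
  multi_derive al (a *: u + v) x = a *: multi_derive al u x + multi_derive al v x.
Proof.
rewrite !multi_deriveE.
have := iter_derive_lin a (cdiv_smooth u) (cdiv_smooth v).
by move=> /(_ (nseq al.1 ((1, 0) : R * R) ++ nseq al.2 ((0, 1) : R * R))) /(f_equal (fun g => g x)).
Qed.

Lemma multi_deriveD al u v x :
  multi_derive al (u + v) x = multi_derive al u x + multi_derive al v x.
Proof. by have := multi_derive_lin al 1 u v x; rewrite !scale1r. Qed.

Lemma multi_derive0 al x : multi_derive al (0 : CinftyDiv R) x = 0.
Proof.
by have := multi_deriveD al 0 0 x; rewrite addr0 => /eqP; rewrite -subr_eq0 opprD addNKr oppr_eq0 => /eqP.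
Qed.

Lemma multi_deriveZ al (a : R) u x :
  multi_derive al (a *: u) x = a *: multi_derive al u x.
Proof. by have := multi_derive_lin al a u 0 x; rewrite multi_derive0 !addr0. Qed.

Lemma multi_deriveB al u v x :
  multi_derive al (u - v) x = multi_derive al u x - multi_derive al v x.
Proof. by rewrite multi_deriveD -scaleN1r multi_deriveZ scaleN1r. Qed.

Lemma multi_derive_sum al (I : finType) (F : I -> CinftyDiv R) x :
  multi_derive al (\sum_i F i) x = \sum_i multi_derive al (F i) x.
Proof.
apply: (big_morph (fun u : CinftyDiv R => multi_derive al u x)).
  by move=> u v; exact: multi_deriveD.
exact: multi_derive0.
Qed.

Lemma trans_subproof (a : R) w :
  (fun x : R * R => w (x + a *: (-1, 0))) \in smooth_div_free.
Proof.
have sw := cdiv_smooth w; have pw := cdiv_periodic w.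
apply/asboolP; split; first exact: smooth_shift.
- by move=> x m n; rewrite addrAC pw.
- move=> x; rewrite /divergence /d1 /d2 !derive_shiftp//; exact: cdiv_div.
Qed.

(** The argument is shifted by [-a], so the field itself moves by [a] in the positive direction of
    the first axis. *)
Definition trans (a : R) w : CinftyDiv R := MkCinftyDiv (trans_subproof a w).

Lemma dx1_subproof w : 'D_((-1, 0) : R * R) (w : R * R -> R * R) \in smooth_div_free.
Proof.
have sw := cdiv_smooth w; have pw := cdiv_periodic w.
pose e : R * R := (-1, 0).
apply/asboolP; split; first exact: smooth_derive.
- by move=> x m n; exact: (iter_derive_periodic [:: e] sw pw x m n).
- move=> x; pose e1 : R * R := (1, 0); pose e2 : R * R := (0, 1).
  have E1 : ('D_e1 ('D_e w) x).1 = 'D_e (fun y => ('D_e1 w y).1) x.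
    apply: etrans (f_equal (fun g : R * R -> R * R => (g x).1) (derive_comm2 e1 e sw)) _.
    exact: derive_fst x e (smooth_derive e1 sw).
  have E2 : ('D_e2 ('D_e w) x).2 = 'D_e (fun y => ('D_e2 w y).2) x.
    apply: etrans (f_equal (fun g : R * R -> R * R => (g x).2) (derive_comm2 e2 e sw)) _.
    exact: derive_snd x e (smooth_derive e2 sw).
  apply: etrans (f_equal2 +%R E1 E2) _.
  rewrite -deriveD; last 2 first.
  - exact: smooth_derivable (smooth_fst (smooth_derive e1 sw)).
  - exact: smooth_derivable (smooth_snd (smooth_derive e2 sw)).
  rewrite [X in 'D_e X x](_ : _ = cst 0) ?derive_cst//.
  by apply/funext => y; exact: (cdiv_div w y).
Qed.

(** The generator of [trans], hence minus the usual first partial derivative. *)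
Definition dx1 w : CinftyDiv R := MkCinftyDiv (dx1_subproof w).

Lemma multi_derive_trans al a w x :
  multi_derive al (trans a w) x = multi_derive al w (x + a *: (-1, 0)).
Proof. by rewrite !multi_deriveE iter_derive_shift//; exact: cdiv_smooth. Qed.

Lemma multi_derive_dx1 al w x :
  multi_derive al (dx1 w) x = 'D_(-1, 0) (multi_derive al w) x.
Proof. by rewrite !multi_deriveE iter_derive_comm2//; exact: cdiv_smooth. Qed.

(** The derivative of a smooth periodic field is bounded by compactness of the closed period square;
    the constant is therefore uniform in the point and in both translations. *)
Lemma trans_lip al w : exists M, forall x a b,
  `|multi_derive al (trans a w) x - multi_derive al (trans b w) x| <= `|a - b| * M.
Proof.
have [M HM] := multi_derive_bounded al (dx1 w).
exists M => x a b; rewrite !multi_derive_trans.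
have := lip_dir (multi_derive_smooth al w) (v := (-1, 0)) (M := M) _ (x + b *: (-1, 0)) (a - b).
rewrite -addrA -scalerDl [b + _]addrC subrK; apply=> y.
by rewrite -multi_derive_dx1.
Qed.

Lemma trans_taylor al w : exists M, forall x a h,
  `|multi_derive al (trans (a + h) w) x - multi_derive al (trans a w) x
    - h *: multi_derive al (trans a (dx1 w)) x| <= `|h| * (`|h| * M).
Proof.
have [M HM] := multi_derive_bounded al (dx1 (dx1 w)).
exists M => x a h; rewrite !multi_derive_trans.
have := taylor_dir (multi_derive_smooth al w) (v := (-1, 0)) (M := M) _ (x + a *: (-1, 0)) h.
rewrite scalerDl addrA multi_derive_dx1; apply=> y.
rewrite (_ : 'D_(-1, 0) (multi_derive al w) = multi_derive al (dx1 w)).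
  by rewrite -multi_derive_dx1.
by apply/funext => z; rewrite multi_derive_dx1.
Qed.

End Translations.

(** * Sums of independently translated fields *)

Section Quasiperiodic.
Context {R : realType} {N : nat}.
Implicit Types (A : CinftyDiv R) (w : 'I_N -> CinftyDiv R) (th v : 'rV[R]_N).

(** [A] is the part at rest, and [th 0 i] is the horizontal displacement of [w i]: a point of the
    torus is a configuration of positions. *)
Definition drift A w th : CinftyDiv R := A + \sum_i trans (th 0 i) (w i).

Lemma entry_le_norm th i : `|th 0 i| <= `|th|.
Proof.
rewrite /Num.norm/= mx_normrE.
exact: (@le_bigmax _ _ _ (0 : R) (fun ij : 'I_1 * 'I_N => `|th ij.1 ij.2|) (0, i)).
Qed.

Lemma drift_continuous A w : continuous (drift A w).
Proof.
move=> th; apply: (cinfty_cvg (nbhs_filter th)) => al e e0.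
have /choice[M HM] : forall i, exists M, forall x a b,
  `|multi_derive al (trans a (w i)) x - multi_derive al (trans b (w i)) x| <= `|a - b| * M.
  by move=> i; exact: trans_lip.
have M0 i : 0 <= M i.
  by apply: le_trans (normr_ge0 _) _; last (have := HM i 0 1 0; rewrite subr0 normr1 mul1r; exact).
pose S := \sum_i M i + 1.
have S0 : 0 < S by rewrite ltr_wpDl// sumr_ge0.
near=> th' => x.
rewrite !multi_deriveD !multi_derive_sum opprD addrACA subrr add0r -sumrB.
apply: (@le_lt_trans _ _ (\sum_i `|th - th'| * M i)).
  apply: le_trans (ler_norm_sum _ _ _) _; apply: ler_sum => i _.
  apply: le_trans (HM i x _ _) _; rewrite ler_wpM2r//.
  by have := entry_le_norm (th - th') i; rewrite !mxE.
rewrite -mulr_sumr; apply: (@le_lt_trans _ _ (`|th - th'| * S)).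
  by rewrite ler_wpM2l// lerDl.
rewrite -ltr_pdivlMr//.
near: th'; apply: (@cvgr_dist_lt _ _ _ _ _ id th); first exact: cvg_id.
by rewrite divr_gt0.
Unshelve. all: by end_near. Qed.

(** Each summand leaves a Taylor remainder of order [h^2]; after division by [h] it tends to 0
    uniformly in [x], for each partial derivative. *)
Lemma drift_diff_quot A w th v :
  diff_quot (drift A w) th v @ 0^' --> drift 0 (fun i => v 0 i *: dx1 (w i)) th.
Proof.
apply: cinfty_cvg => al e e0.
have /choice[M HM] : forall i, exists M, forall x a h,
  `|multi_derive al (trans (a + h) (w i)) x - multi_derive al (trans a (w i)) x
    - h *: multi_derive al (trans a (dx1 (w i))) x| <= `|h| * (`|h| * M).
  by move=> i; exact: trans_taylor.
have M0 i : 0 <= M i.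
  by apply: le_trans (normr_ge0 _) _; last (have := HM i 0 0 1; rewrite normr1 !mul1r; exact).
pose S := \sum_i `|v 0 i| * (`|v 0 i| * M i) + 1.
have S0 : 0 < S by rewrite ltr_wpDl// sumr_ge0// => i _; rewrite !mulr_ge0.
near=> h => x.
have h0 : h != 0 by near: h; exact: nbhs_dnbhs_neq.
rewrite /diff_quot multi_deriveZ multi_deriveB !multi_deriveD !multi_derive_sum multi_derive0 add0r.
rewrite opprD addrACA subrr add0r -sumrB.
rewrite (_ : _ - _ = - (h^-1 *: \sum_i (multi_derive al (trans (th 0 i + h * v 0 i) (w i)) x
   - multi_derive al (trans (th 0 i) (w i)) x - (h * v 0 i) *: multi_derive al (trans (th 0 i) (dx1 (w i))) x))); last first.
  rewrite !scaler_sumr -sumrB -sumrN; apply: eq_bigr => i _.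
  rewrite !mxE [h * _ + _]addrC [in RHS]scalerBr opprB scalerA mulKf//; congr (_ - _).
  by rewrite !multi_derive_trans multi_deriveZ.
rewrite normrN normrZ normfV ltr_pdivrMl ?normr_gt0//.
apply: (@le_lt_trans _ _ (\sum_i `|h| * (`|h| * (`|v 0 i| * (`|v 0 i| * M i))))).
  apply: le_trans (ler_norm_sum _ _ _) _; apply: ler_sum => i _.
  apply: le_trans (HM i x _ _) _; rewrite !normrM.
  by rewrite (_ : _ * _ = `|h| * (`|h| * (`|v 0 i| * (`|v 0 i| * M i))))//; ring.
rewrite -!mulr_sumr ltr_pM2l ?normr_gt0//.
apply: (@le_lt_trans _ _ (`|h| * S)).
  by rewrite ler_wpM2l// lerDl.
rewrite -ltr_pdivlMr//.
by near: h; apply: dnbhs0_lt; rewrite divr_gt0.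
Unshelve. all: by end_near. Qed.

Lemma frechet_derive_drift A w v :
  frechet_derive v (drift A w) = drift 0 (fun i => v 0 i *: dx1 (w i)).
Proof.
apply/funext => th; apply: cvg_lim; first exact: cinfty_hausdorff.
exact: drift_diff_quot.
Qed.

(** A directional derivative of a drift is again a drift, with zero resting part and fields
    [v 0 i *: dx1 (w i)]; so all iterated derivatives stay in one family of continuous, derivable
    maps. *)
Lemma drift_frechet_smooth A w : frechet_smooth (drift A w).
Proof.
move=> vs; pose DU := foldr frechet_derive (drift A w) vs.
have [B [z E]] : exists B z, DU = drift B z.
  rewrite /DU; elim: vs {DU} => [|v vs [B [z IH]]]; first by exists A, w.
  by rewrite /= IH; do 2 eexists; exact: frechet_derive_drift.
rewrite -/DU E /=; split; first exact: drift_continuous.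
by move=> th v; apply/cvg_ex; eexists; exact: drift_diff_quot.
Qed.

Lemma torus_eq_sym th th' : torus_eq th th' -> torus_eq th' th.
Proof.
move=> [k ->]; exists (- k); rewrite -addrA -scalerDr.
by rewrite (_ : map_mx intr k + map_mx intr (- k) = 0) ?scaler0 ?addr0//; apply/matrixP => i j; rewrite !mxE intrN subrr.
Qed.

Lemma trans_period (a : R) (u : CinftyDiv R) (k : int) : trans (a + 2 * pi * k%:~R) u = trans a u.
Proof.
apply/val_inj/funext => x /=.
rewrite -[RHS](cdiv_periodic u _ (-k) 0); congr (u _).
rewrite scalerDl addrA; congr (_ + _).
by apply: pair_ext; rewrite /= /GRing.scale/= ?mulrN1 ?intrN ?mulrN ?mulr0.
Qed.

Lemma drift_torus_periodic A w : torus_periodic (drift A w).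
Proof.
move=> th _ [k ->]; congr (_ + _); apply: eq_bigr => i _; rewrite !mxE.
by rewrite trans_period.
Qed.

(** A continuous injection of a compact space into a Hausdorff space is an embedding. The torus
    enters through the closed cube [K]: the image of the part of [K] outside [O] is compact, hence
    closed, and its complement is the required open set. *)
Lemma homeo_of_compact (U : 'rV[R]_N -> CinftyDiv R) : continuous U ->
  torus_periodic U -> (forall th th', U th = U th' -> torus_eq th th') ->
  homeo_onto_image U.
Proof.
move=> cU pU iU O oO satO.
pose K : set 'rV[R]_N := [set th | forall i, th 0 i \in `[0, 2 * pi]].
have cK : compact K.
  have := @rV_compact _ _ (fun _ : 'I_N => `[0, 2 * pi]%classic : set R) (fun _ => @segment_compact R 0 (2 * pi)).
  by congr compact; apply/seteqP; split => th H i; have := H i; rewrite /= ?inE.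
pose C := U @` (K `&` ~` O).
have cC : compact C.
  apply: continuous_compact; first exact: continuous_subspaceT.
  by apply: compact_closedI => //; exact: open_closedC.
exists (~` C); first by apply: closed_openC; apply: compact_closed cC; exact: cinfty_hausdorff.
apply/seteqP; split => th /=.
  move=> nC; apply: contrapT => nO; apply: nC.
  pose th' := \row_i tmod (th 0 i).
  have E : torus_eq th th'.
    exists (\row_i - (Num.floor (th 0 i / (2 * pi)))).
    by apply/matrixP => i j; rewrite !mxE ord1 intrN mulrN.
  exists th'; last by rewrite (pU _ _ E).
  split; last by move=> O'; apply: nO; exact: satO (torus_eq_sym E) O'.
  move=> i; rewrite mxE in_itv/=; have /andP[-> /ltW ->] := tmod_itv (th 0 i); by [].
move=> Oth [th' [_ nO] E]; apply: nO; apply: satO Oth; exact/iU.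
Qed.

End Quasiperiodic.

(** * The dyadic grid of the square *)

Section Grid.
Context {R : realType}.
Local Notation plane := (measurableTypeR R * measurableTypeR R)%type.

Definition mu2 : {measure set plane -> \bar R} :=
  (@lebesgue_measure R \x @lebesgue_measure R)%E.

Definition mesh (k : nat) : R := 2 * pi / 2 ^+ k.

Lemma mesh_gt0 k : 0 < mesh k.
Proof. by rewrite divr_gt0 ?twopi_gt0// exprn_gt0. Qed.

Lemma mesh_half k : mesh k = 2 * mesh k.+1.
Proof. by rewrite /mesh exprS; field; rewrite expf_neq0. Qed.

Definition gindex k (x : R * R) : int * int :=
  (Num.floor (x.1 / mesh k), Num.floor (x.2 / mesh k)).

Definition gcell k (i : int * int) : set plane := [set x | gindex k x = i].

Lemma floor_divP (h y : R) (m : int) : 0 < h ->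
  (Num.floor (y / h) == m) = (m%:~R * h <= y < m%:~R * h + h).
Proof.
by move=> h0; rewrite floor_eq ler_pdivlMr// ltr_pdivrMr// intrD mulrDl mul1r.
Qed.

Lemma gcellE k i : gcell k i =
  `[i.1%:~R * mesh k, i.1%:~R * mesh k + mesh k[%classic `*`
  `[i.2%:~R * mesh k, i.2%:~R * mesh k + mesh k[%classic.
Proof.
case: i => m n; apply/seteqP; split => -[x y]; rewrite /gcell/= /gindex/= !in_itv/=.
  by move=> [/eqP + /eqP]; rewrite !floor_divP ?mesh_gt0.
by rewrite -!floor_divP ?mesh_gt0// => -[/eqP -> /eqP ->].
Qed.

Lemma measurable_gcell k i : measurable (gcell k i).
Proof. by rewrite gcellE; apply: measurableX; exact: measurable_itv. Qed.

Lemma mu2_rect (a b c d : R) : a <= b -> c <= d ->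
  mu2 (`[a, b[%classic `*` `[c, d[%classic) = ((b - a) * (d - c))%:E.
Proof.
move=> ab cd.
have L (u v : R) : u <= v -> lebesgue_measure (`[u, v[%classic : set R) = (v - u)%:E.
  rewrite lebesgue_measure_itv/= lte_fin -EFinB.
  by rewrite le_eqVlt => /orP[/eqP ->|->//]; rewrite ltxx subrr.
rewrite EFinM -(L a b ab) -(L c d cd).
by apply: product_measure1E; exact: measurable_itv.
Qed.

Lemma mu2_gcell k i : mu2 (gcell k i) = (mesh k * mesh k)%:E.
Proof.
have E (a h : R) : a + h - a = h by rewrite addrAC subrr add0r.
have h0 := ltW (mesh_gt0 k).
by rewrite gcellE mu2_rect ?lerDl// !E.
Qed.

(** [floor (2 a)] is [2 floor a] or [2 floor a + 1], so a cell determines its parent. *)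
Lemma gindex_refine k (x y : R * R) : gindex k.+1 x = gindex k.+1 y -> gindex k x = gindex k y.
Proof.
have H (a b : R) : Num.floor (a / mesh k.+1) = Num.floor (b / mesh k.+1) ->
    Num.floor (a / mesh k) = Num.floor (b / mesh k).
  have E c : c / mesh k.+1 = 2 * (c / mesh k).
    by rewrite (mesh_half k); field; rewrite gt_eqF ?mesh_gt0.
  rewrite !E; move: (a / mesh k) (b / mesh k) => {E}{}a {}b E.
  have /andP[a1 a2] := floor_itv a.
  have /andP[c1 c2] := floor_itv (2 * a); have /andP[d1 d2] := floor_itv (2 * b).
  rewrite -E in d1 d2.
  set m := Num.floor a in a1 a2 *; set p := Num.floor (2 * a) in c1 c2 d1 d2.
  have p1 : 2 * m <= p.
    by rewrite floor_ge_int_tmp intrM ler_wpM2l.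
  have p2 : p < 2 * m + 2.
    rewrite -(ltr_int R); apply: le_lt_trans c1 _.
    by rewrite intrD intrM; move: a2; rewrite intrD; lra.
  apply/esym/floor_def; rewrite intrD.
  have q1 : (2 * m)%:~R <= p%:~R :> R by rewrite ler_int.
  have q2 : (p + 1)%:~R <= (2 * m + 2)%:~R :> R by rewrite ler_int; lia.
  move: q1 q2 d2; rewrite !intrD !intrM; lra.
by move=> [h1 h2]; rewrite /gindex (H _ _ h1) (H _ _ h2).
Qed.

Lemma gindex_coarsen k l (x y : R * R) : (k <= l)%N -> gindex l x = gindex l y -> gindex k x = gindex k y.
Proof.
move=> /subnK <-; elim: (l - k)%N => //= j IH.
by rewrite addSn => /gindex_refine.
Qed.

Lemma gindex_close k (x y : R * R) : gindex k x = gindex k y -> `|x - y| < mesh k.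
Proof.
have h0 := mesh_gt0 k.
have H (a b : R) : Num.floor (a / mesh k) = Num.floor (b / mesh k) -> `|a - b| < mesh k.
  move=> E.
  have := floor_divP a (Num.floor (a / mesh k)) h0; rewrite eqxx => /esym/andP[].
  have := floor_divP b (Num.floor (a / mesh k)) h0; rewrite {1}E eqxx => /esym/andP[].
  by move=> *; rewrite ltr_norml; apply/andP; split; lra.
by move=> [h1 h2]; rewrite prod_normE gt_max !H.
Qed.

Lemma mesh_small (e : R) : 0 < e -> exists k, mesh k < e.
Proof.
move=> e0; have p0 := @twopi_gt0 R.
exists (Num.bound (2 * pi / e)).
rewrite /mesh ltr_pdivrMr ?exprn_gt0// [e * _]mulrC -ltr_pdivrMr//.
apply: (lt_le_trans (archi_boundP (divr_ge0 (ltW p0) (ltW e0)))).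
by rewrite -natrX ler_nat ltnW// ltn_expl.
Qed.

(** The union of the level-[k] cells contained in [O]. For open [O] it increases to [O] with [k],
    which reduces questions on open sets to countable unions of cells. *)
Definition ginner k (O : set plane) : set plane :=
  [set x | forall y, gindex k y = gindex k x -> O y].

Lemma ginnerE k O : ginner k O = \bigcup_(i in [set i | gcell k i `<=` O]) gcell k i.
Proof.
apply/seteqP; split => x.
  by move=> Hx; exists (gindex k x) => //= y; exact: Hx.
by move=> [i iO /= xi] y yx; apply: iO; rewrite /gcell/= yx.
Qed.

Lemma ginner_sub k O : ginner k O `<=` O.
Proof. by move=> x; exact. Qed.

Lemma measurable_ginner k O : measurable (ginner k O).
Proof.
rewrite ginnerE bigcup_mkcond; apply: countable_bigcupT_measurable => [|i].
  exact: countableP.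
by case: ifPn => // _; exact: measurable_gcell.
Qed.

Lemma ginner_mono O : {homo ginner ^~ O : k l / (k <= l)%N >-> k `<=` l}.
Proof. by move=> k l kl x Hx y /(gindex_coarsen kl); exact: Hx. Qed.

Lemma ginner_bigcup (O : set (R * R)) : open O -> \bigcup_k ginner k O = O.
Proof.
move=> oO; apply/seteqP; split => [x [k _]|x Ox]; first exact: ginner_sub.
have : nbhs x O by exact: open_nbhs_nbhs.
move=> /nbhs_normP[e /= e0 H]; have [k ke] := mesh_small e0.
exists k => // y yx; apply: H; rewrite /ball_/=.
exact: lt_trans (gindex_close (esym yx)) ke.
Qed.

(** The sigma-algebra of the plane is the product one, so the Borel property is obtained by
    exhausting an open set with cells, which are rectangles. *)
Lemma open_measurable2 (O : set (R * R)) : open O -> measurable (O : set plane).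
Proof.
move=> oO; rewrite -(ginner_bigcup oO); apply: bigcupT_measurable => k.
exact: measurable_ginner.
Qed.

Lemma closed_measurable2 (O : set (R * R)) : closed O -> measurable (O : set plane).
Proof. by move=> cO; rewrite -(setCK O); apply: measurableC; apply: open_measurable2; exact: closed_openC. Qed.

Lemma continuous_measurable2 (f : R * R -> R) : continuous f ->
  measurable_fun setT (f : plane -> R).
Proof.
move=> cf; apply: (measurability _ (measurable_realfun.RGenOInfty.measurableE R)) => _ /= -[_ [r ->] <-].
rewrite setTI; apply: open_measurable2.
move/continuousP : cf; apply; exact: interval_open.
Qed.

Lemma fundamental_squareE : @fundamental_square R = gcell 0 (0, 0).
Proof. by rewrite gcellE /= /mesh expr0 divr1 !mul0r !add0r. Qed.

Lemma mu2_square_fin : (mu2 fundamental_square < +oo)%E.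
Proof. by rewrite fundamental_squareE mu2_gcell ltry. Qed.

Lemma bounded_integrable2 (D : set plane) (f : R * R -> R) M : measurable D ->
  (mu2 D < +oo)%E -> continuous f -> (forall x, D x -> `|f x| <= M) ->
  mu2.-integrable D (EFin \o f).
Proof.
move=> mD Dfin cf HM; apply: measurable_bounded_integrable => //.
  exact: measurable_funTS (continuous_measurable2 cf).
exists M; split; first exact: num_real.
by move=> N MN x Dx; apply: le_trans (HM x Dx) (ltW MN).
Qed.

End Grid.

(** * Uniqueness of smooth Euler flows *)

Section SquareIntegral.
Context {R : realType}.
Local Notation plane := (measurableTypeR R * measurableTypeR R)%type.
Local Notation S := (@fundamental_square R).
Implicit Types f g : R * R -> R.

Lemma smooth_d1 (W : normedModType R) (f : R * R -> W) : smooth f -> smooth (d1 f).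
Proof. exact: smooth_derive. Qed.

Lemma smooth_d2 (W : normedModType R) (f : R * R -> W) : smooth f -> smooth (d2 f).
Proof. exact: smooth_derive. Qed.

Lemma fundamental_squareP (x : R * R) :
  S x <-> 0 <= x.1 < 2 * pi /\ 0 <= x.2 < 2 * pi.
Proof. by rewrite /fundamental_square/= /setX/= !in_itv. Qed.

Lemma trep_square (x : R * R) : S (trep x).
Proof. by apply/fundamental_squareP; split; exact: tmod_itv. Qed.

Lemma compact_closed_square : compact (`[0, 2 * pi]%classic `*` `[0, 2 * pi]%classic : set (R * R)).
Proof. by apply: compact_setX; exact: segment_compact. Qed.

Lemma compact_abs_bounded (T : topologicalType) (K : set T) (f : T -> R) :
  compact K -> continuous f -> exists2 M, 0 <= M & forall x, K x -> `|f x| <= M.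
Proof.
move=> cK cf.
have [K0|/set0P K0] := eqVneq K set0; first by exists 0 => // x; rewrite K0.
have cc : {within K, continuous (fun x => `|f x|)}.
  apply: continuous_subspaceT => x; apply: continuous_comp; first exact: cf.
  exact: norm_continuous.
have [c Kc H] := compact_EVT_max K0 cK cc.
by exists `|f c| => // x Kx; apply: H; rewrite inE.
Qed.

Lemma square_bounded f : continuous f -> exists2 M, 0 <= M & forall x, S x -> `|f x| <= M.
Proof.
move=> /(compact_abs_bounded compact_closed_square)[M M0 HM]; exists M => // x.
move=> /fundamental_squareP[/andP[a b] /andP[c d]]; apply: HM; split;
  by rewrite /= in_itv/= ?a ?c ltW.
Qed.

Lemma integrable_square f : continuous f -> mu2.-integrable S (EFin \o f).
Proof.
move=> cf; have [M _ HM] := square_bounded cf.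
apply: bounded_integrable2 HM => //; [exact: measurable_fundamental_square|exact: mu2_square_fin].
Qed.

Lemma line_integral_periodic (g dg : R -> R) : continuous dg ->
  (forall y : R, is_derive y 1 g (dg y)) -> g (2 * pi) = g 0 ->
  (\int[lebesgue_measure]_(y in `[0%R, (2 * pi)%R[%classic) (dg y)%:E = 0)%E.
Proof.
move=> cdg D E.
have p0 := @twopi_gt0 R.
have cg : continuous g by exact: is_derive_cont D.
rewrite integral_itv_bndo_bndc; last first.
  apply/measurable_EFinP; apply: measurable_funTS; exact: continuous_measurable_fun.
rewrite (@continuous_FTC2 _ dg g 0 (2 * pi) p0).
- by rewrite E -EFinB subrr.
- exact: continuous_subspaceT.
- split.
  + by move=> y _; have [dy _] := D y.
  + by apply: cvg_at_right_filter; exact: cg.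
  + by apply: cvg_at_left_filter; exact: cg.
- by move=> y _; rewrite derive1E; have [_ ->] := D y.
Qed.

Lemma integral_square_iter1 f : mu2.-integrable S (EFin \o f) ->
  (forall y, (\int[lebesgue_measure]_(x in `[0%R, (2 * pi)%R[%classic) (f (x, y))%:E = 0)%E) ->
  (\int[mu2]_(z in S) (f z)%:E = 0)%E.
Proof.
move=> If H; rewrite integral_mkcond.
rewrite -integral21_prod_meas1; last first.
  by have := If; rewrite integrable_mkcond//; exact: measurable_fundamental_square.
rewrite [LHS](_ : _ = \int[lebesgue_measure]_(y in setT) (cst 0 y))%E; first by rewrite integral0.
apply: eq_integral => y _; rewrite /fubini_G.
have [yI|yI] := boolP (y \in `[0, 2 * pi[).
  rewrite -[RHS](H y) [RHS]integral_mkcond; apply: eq_integral => x _.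
  rewrite !patchE; congr (if _ then _ else _).
  by apply/idP/idP; rewrite !inE /fundamental_square/=; [case|split].
rewrite /= integral0_eq// => x _; rewrite patchE ifF//; apply/negbTE.
by apply/negP; rewrite inE /fundamental_square => -[_ /=]; apply/negP.
Qed.

Lemma integral_square_iter2 f : mu2.-integrable S (EFin \o f) ->
  (forall x, (\int[lebesgue_measure]_(y in `[0%R, (2 * pi)%R[%classic) (f (x, y))%:E = 0)%E) ->
  (\int[mu2]_(z in S) (f z)%:E = 0)%E.
Proof.
move=> If H; rewrite integral_mkcond.
rewrite -integral12_prod_meas1; last first.
  by have := If; rewrite integrable_mkcond//; exact: measurable_fundamental_square.
rewrite [LHS](_ : _ = \int[lebesgue_measure]_(y in setT) (cst 0 y))%E; first by rewrite integral0.
apply: eq_integral => x _; rewrite /fubini_F.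
have [xI|xI] := boolP (x \in `[0, 2 * pi[).
  rewrite -[RHS](H x) [RHS]integral_mkcond; apply: eq_integral => y _.
  rewrite !patchE; congr (if _ then _ else _).
  by apply/idP/idP; rewrite !inE /fundamental_square/=; [case|split].
rewrite /= integral0_eq// => y _; rewrite patchE ifF//; apply/negbTE.
by apply/negP; rewrite inE /fundamental_square => -[/= + _]; apply/negP.
Qed.

Lemma continuous_pairl (y : R) : continuous (fun x : R => (x, y) : R * R).
Proof.
move=> x; have H : (fun x : R => x) @ x --> x by exact: cvg_id.
have H2 : (fun _ : R => y) @ x --> y by exact: cvg_cst.
exact: (cvg_pair H H2).
Qed.

Lemma continuous_pairr (x : R) : continuous (fun y : R => (x, y) : R * R).
Proof.
move=> y; have H : (fun y : R => y) @ y --> y by exact: cvg_id.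
have H2 : (fun _ : R => x) @ y --> x by exact: cvg_cst.
exact: (cvg_pair H2 H).
Qed.

Lemma integral_d1 f : smooth f -> periodic2 f ->
  \int[mu2]_(z in S) d1 f z = 0.
Proof.
move=> sf pf; have c1 : continuous (d1 f) by exact: smooth_cont (smooth_d1 sf).
rewrite /Rintegral (@integral_square_iter1 (d1 f))//; first exact: integrable_square.
move=> y; apply: (@line_integral_periodic (fun x => f (x, y)) (fun x => d1 f (x, y))).
- by move=> x; apply: (@continuous_comp _ _ _ (fun x => (x, y)) (d1 f)); [exact: continuous_pairl|exact: c1].
- move=> x; have := proj1 (@is_derive_slice _ _ _ f (0, y) (1, 0) x _) (smooth_is_derive _ _ sf).
  have E s : (0, y) + s *: ((1, 0) : R * R) = (s, y) :> R * R.
    by apply: pair_ext; rewrite /= /GRing.scale/= ?mulr1 ?mulr0 ?addr0 ?add0r.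
  rewrite E (_ : (fun h => f (_ + _)) = fun x => f (x, y))//.
  by apply/funext => s; rewrite E.
- have := pf (0, y) 1 0; rewrite mulr1 mulr0 => <-; congr f.
  by apply: pair_ext; rewrite /= ?add0r ?addr0.
Qed.

Lemma integral_d2 f : smooth f -> periodic2 f ->
  \int[mu2]_(z in S) d2 f z = 0.
Proof.
move=> sf pf; have c1 : continuous (d2 f) by exact: smooth_cont (smooth_d2 sf).
rewrite /Rintegral (@integral_square_iter2 (d2 f))//; first exact: integrable_square.
move=> y; apply: (@line_integral_periodic (fun x => f (y, x)) (fun x => d2 f (y, x))).
- by move=> x; apply: (@continuous_comp _ _ _ (fun x => (y, x)) (d2 f)); [exact: continuous_pairr|exact: c1].
- move=> x; have := proj1 (@is_derive_slice _ _ _ f (y, 0) (0, 1) x _) (smooth_is_derive _ _ sf).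
  have E s : (y, 0) + s *: ((0, 1) : R * R) = (y, s) :> R * R.
    by apply: pair_ext; rewrite /= /GRing.scale/= ?mulr1 ?mulr0 ?addr0 ?add0r.
  rewrite E (_ : (fun h => f (_ + _)) = fun x => f (y, x))//.
  by apply/funext => s; rewrite E.
- have := pf (y, 0) 0 1; rewrite mulr1 mulr0 => <-; congr f.
  by apply: pair_ext; rewrite /= ?add0r ?addr0.
Qed.

(** A positive value persists, up to a factor 1/2, on a whole grid cell around the point, and cells
    have positive measure. Half-open cells make this work on the edges of the square as well. *)
Lemma integral_square_pos f : continuous f -> (forall x, 0 <= f x) -> periodic2 f ->
  \int[mu2]_(z in S) f z = 0 -> forall x, f x = 0.
Proof.
move=> cf f0 pf I0 x; rewrite (periodic2_trep x pf).
move: (trep x) (trep_square x) => {}x Sx.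
apply/eqP; rewrite eq_le f0 andbT leNgt; apply/negP => fx.
pose c := f x / 2; have c0 : 0 < c by rewrite divr_gt0.
have : nbhs x [set y | c < f y].
  have fc : c < f x by rewrite /c; lra.
  exact: (cvgr_gt (f x) (cf x) c fc).
move=> /nbhs_normP[e /= e0 H]; have [k ke] := mesh_small e0.
pose C : set plane := gcell k (gindex k x).
have CS : C `<=` S.
  move=> y yx; move: Sx; rewrite fundamental_squareE /gcell/=.
  by rewrite -(gindex_coarsen (leq0n k) yx).
have HC y : C y -> c < f y.
  by move=> yx; apply: H; rewrite /ball_/=; apply: lt_trans ke; exact: gindex_close (esym yx).
have : (\int[mu2]_(z in C) (cst c%:E z) <= \int[mu2]_(z in S) (f z)%:E)%E.
  apply: (@le_trans _ _ (\int[mu2]_(z in C) (f z)%:E)%E).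
    apply: ge0_le_integral.
    - exact: measurable_gcell.
    - by move=> z _; rewrite lee_fin ltW.
    - exact: measurable_cst.
    - apply/measurable_EFinP; exact: measurable_funTS (continuous_measurable2 cf).
    - by move=> z Cz; rewrite lee_fin ltW// HC.
  apply: ge0_subset_integral => //.
  - exact: measurable_gcell.
  - exact: measurable_fundamental_square.
  - apply/measurable_EFinP; exact: measurable_funTS (continuous_measurable2 cf).
  - by move=> z _; rewrite lee_fin.
rewrite integral_cst; last exact: measurable_gcell.
have -> : (\int[mu2]_(z in S) (f z)%:E)%E = 0%:E.
  rewrite -I0 /Rintegral fineK//; apply: integrable_fin_num; last exact: integrable_square.
  exact: measurable_fundamental_square.
rewrite mu2_gcell -EFinM lee_fin leNgt => /negP; apply.
by rewrite mulr_gt0// mulr_gt0// mesh_gt0.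
Qed.

End SquareIntegral.

(** * Gronwall's lemma *)

Section Gronwall.
Context {R : realType}.

(** The function [exp (- K s) * E s] does not increase on [[0, T]]. *)
Lemma gronwall_pos (E dE : R -> R) (T K : R) : 0 < T ->
  (forall t : R, is_derive t 1 E (dE t)) ->
  E 0 = 0 -> (forall t, 0 <= t <= T -> dE t <= K * E t) -> E T <= 0.
Proof.
move=> T0 D E0 H.
pose h s := expR (- K * s) * E s.
have Dexp (s : R) : is_derive s 1 (fun s => expR (- K * s)) (expR (- K * s) * - K).
  have L := is_deriveZ (- K) (is_derive_id s (1 : R)).
  have := is_derive_comp1 L (is_derive_expR _).
  by rewrite [_%:A]mulr1.
have Dh (s : R) : is_derive s 1 h (expR (- K * s) * (dE s - K * E s)).
  have := is_deriveM (Dexp s) (D s).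
  move=> H'; apply: is_derive_eq H' _; rewrite /GRing.scale/=; ring.
have : h T <= h 0.
  apply: (@ler0_derive1_nincr _ h 0 T _ _ _ 0 T (lexx 0) (ltW T0) (lexx T)).
  - by move=> s _; have [d _] := Dh s.
  - move=> s; rewrite in_itv/= => /andP[s0 sT]; rewrite derive1E; have [_ ->] := Dh s.
    by rewrite mulr_ge0_le0 ?expR_ge0// subr_le0 H// !ltW.
  - exact: continuous_subspaceT (is_derive_cont Dh).
by rewrite {2}/h E0 mulr0 /h pmulr_rle0 ?expR_gt0.
Qed.

(** Negative times are treated through [s |-> E (- s)]; bounding the absolute value of [dE] serves
    both directions of time. *)
Lemma gronwall (E dE : R -> R) :
  (forall t : R, is_derive t 1 E (dE t)) ->
  E 0 = 0 -> (forall t, 0 <= E t) ->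
  (forall T, exists K, forall t, `|t| <= T -> `|dE t| <= K * E t) ->
  forall t, E t = 0.
Proof.
move=> D E0 Ege HK t; apply/eqP; rewrite eq_le Ege andbT.
have [t0|t0|->] := ltgtP t 0; last by rewrite E0.
  have nt0 : 0 < - t by rewrite oppr_gt0.
  have [K {}HK] := HK (- t).
  have := @gronwall_pos (fun s => E (- s)) (fun s => - dE (- s)) (- t) K nt0.
  rewrite opprK; apply.
  - move=> s; have := is_derive_opp1 (D (- s)).
    move=> H; have := is_deriveN H.
    by rewrite (_ : - (fun x : R => - E (- x)) = fun s => E (- s))//; apply/funext => x; rewrite !fctE opprK.
  - by rewrite oppr0.
  - move=> s /andP[s0 st]; apply: le_trans (ler_norm _) _; rewrite normrN HK//.
    by rewrite normrN ger0_norm.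
have [K {}HK] := HK t.
apply: (gronwall_pos (K := K) t0 D E0) => s /andP[s0 st].
by apply: le_trans (ler_norm _) _; rewrite HK// ger0_norm.
Qed.

End Gronwall.

(** * Integrals over the square depending on time *)

Section SpaceTime.
Context {R : realType}.
Local Notation S := (@fundamental_square R).
Local Notation spacetime := (R * (R * R))%type.
Definition et : spacetime := (1, 0).
Definition ex (v : R * R) : spacetime := (0, v).

Lemma smooth_space (W : normedModType R) (F : spacetime -> W) t : smooth F ->
  smooth (fun x => F (t, x)).
Proof.
apply: (@smooth_affine _ _ _ W (fun x => (t, x)) ex).
  by move=> x v h; apply: pair_ext; rewrite /= ?mulr0 ?scaler0 ?addr0.
move=> x; have H : (fun y : R * R => y) @ x --> x by exact: cvg_id.
have H2 : (fun _ : R * R => t) @ x --> t by exact: cvg_cst.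
exact: (cvg_pair H2 H).
Qed.

Lemma time_is_derive (W : normedModType R) (F : spacetime -> W) (t : R) x : smooth F ->
  is_derive t 1 (fun s => F (s, x)) ('D_et F (t, x)).
Proof.
move=> sF; have := proj1 (@is_derive_slice _ _ _ F (0, x) et t _) (smooth_is_derive _ _ sF).
have E s : (0, x) + s *: et = (s, x).
  by apply: pair_ext; rewrite /= ?scaler0 ?addr0 ?add0r// [s%:A]mulr1.
rewrite E (_ : (fun h => F (_ + _)) = fun s => F (s, x))//.
by apply/funext => s; rewrite E.
Qed.

Lemma spacetime_bounded (F : spacetime -> R) T : continuous F ->
  exists2 M, 0 <= M & forall t x, `|t| <= T -> S x -> `|F (t, x)| <= M.
Proof.
move=> cF.
have cK : compact (`[- T, T]%classic `*` (`[0, 2 * pi]%classic `*` `[0, 2 * pi]%classic) : set spacetime).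
  by apply: compact_setX; [exact: segment_compact|exact: compact_closed_square].
have [M M0 HM] := compact_abs_bounded cK cF; exists M => // t x tT.
move=> /fundamental_squareP[/andP[a b] /andP[c d]]; apply: HM.
split; first by rewrite /= in_itv/= -ler_norml.
by split; rewrite /= in_itv/= ?a ?c ltW.
Qed.

(** Differentiation under the integral sign. The dominating function is a constant, available
    because times near [t] and the closed square form a compact set. *)
Lemma square_integral_is_derive (F : spacetime -> R) (t : R) : smooth F ->
  is_derive t 1 (fun s => \int[mu2]_(x in S) F (s, x))
    (\int[mu2]_(x in S) 'D_et F (t, x)).
Proof.
move=> sF.
have [M M0 HM] := spacetime_bounded (`|t| + 1) (smooth_cont (smooth_derive et sF)).
have It : `]t - 1, t + 1[%classic t by rewrite /= in_itv/=; apply/andP; split; lra.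
have Ib s : `]t - 1, t + 1[%classic s -> `|s| <= `|t| + 1.
  rewrite /= in_itv/= => /andP[h1 h2].
  rewrite -[s](subrK t) addrC; apply: le_trans (ler_normD _ _) _; rewrite lerD2l.
  by rewrite ler_norml; apply/andP; split; lra.
have mS := @measurable_fundamental_square R.
have intF s : `]t - 1, t + 1[%classic s -> mu2.-integrable S (EFin \o (fun x => F (s, x))).
  by move=> _; apply: integrable_square; exact: smooth_cont (smooth_space s sF).
have dF s x : `]t - 1, t + 1[%classic s -> S x -> derivable (fun s => F (s, x)) s 1.
  by move=> _ _; have [] := time_is_derive s x sF.
have G0 (x : R * R) : 0 <= cst M x by [].
have IG : mu2.-integrable S (EFin \o (cst M : R * R -> R)).
  by apply: integrable_square => x; exact: cst_continuous.
have E s x : partial1of2 (fun s x => F (s, x)) s x = 'D_et F (s, x).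
  by rewrite partial1of2E; have [_ ->] := time_is_derive s x sF.
have GM s x : `]t - 1, t + 1[%classic s -> S x ->
   `|partial1of2 (fun s x => F (s, x)) s x| <= cst M x.
  by move=> ts Sx; rewrite E HM//; exact: Ib.
have d := @derivable_under_integral R _ _ mu2 (fun s x => F (s, x)) S mS t _ _ It intF dF (cst M) G0 IG GM.
have e := @differentiation_under_integral R _ _ mu2 (fun s x => F (s, x)) S mS t _ _ It intF dF (cst M) G0 IG GM.
split; first exact: d.
rewrite -derive1E e; apply: eq_Rintegral => x _; exact: E.
Qed.

End SpaceTime.

Section Uniqueness.
Context {R : realType}.
Local Notation S := (@fundamental_square R).
Local Notation spacetime := (R * (R * R))%type.

Lemma isD_add (V : normedModType R) (f g : V -> R) x v df dg :
  is_derive x v f df -> is_derive x v g dg -> is_derive x v (fun y => f y + g y) (df + dg).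
Proof. by move=> H1 H2; exact: is_deriveD H1 H2. Qed.

Lemma isD_sub (V : normedModType R) (f g : V -> R) x v df dg :
  is_derive x v f df -> is_derive x v g dg -> is_derive x v (fun y => f y - g y) (df - dg).
Proof. by move=> H1 H2; exact: is_deriveB H1 H2. Qed.

Lemma isD_mul (V : normedModType R) (f g : V -> R) x v df dg :
  is_derive x v f df -> is_derive x v g dg ->
  is_derive x v (fun y => f y * g y) (f x * dg + g x * df).
Proof. by move=> H1 H2; exact: is_deriveM H1 H2. Qed.

Lemma isD_scale (V : normedModType R) (c : R) (f : V -> R) x v df :
  is_derive x v f df -> is_derive x v (fun y => c * f y) (c * df).
Proof. by move=> H1; exact: is_deriveZ H1. Qed.

Lemma space_derive (W : normedModType R) (F : spacetime -> W) t x v : smooth F ->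
  'D_v (fun y => F (t, y)) x = 'D_(ex v) F (t, x).
Proof.
move=> sF; have := @is_derive_affine R _ _ W (fun y => (t, y)) ex F x v _ _ (smooth_is_derive (t, x) (ex v) sF).
case=> // y w h; apply: pair_ext; by rewrite /= ?mulr0 ?scaler0 ?addr0.
Qed.

Lemma euler_components (u : R -> R * R -> R * R) p (t : R) x :
  smooth (fun z : spacetime => u z.1 z.2) -> euler_equations u p ->
  let a1 z := (u z.1 z.2).1 in let a2 z := (u z.1 z.2).2 in
  let A1 y := (u t y).1 in let A2 y := (u t y).2 in
  [/\ 'D_et a1 (t, x) = - (A1 x * d1 A1 x + A2 x * d2 A1 x) - d1 (p t) x,
      'D_et a2 (t, x) = - (A1 x * d1 A2 x + A2 x * d2 A2 x) - d2 (p t) x &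
      d2 A2 x = - d1 A1 x].
Proof.
move=> sU /(_ t x)[E Dv] a1 a2 A1 A2.
have su : smooth (u t) by exact: (smooth_space t sU).
have E1 : derive1 (fun s => u s x) t = 'D_et (fun z : spacetime => u z.1 z.2) (t, x).
  by rewrite derive1E; have [_ ->] := time_is_derive t x sU.
have move_two (a b c : R) : a + b + c = 0 -> a = - b - c by lra.
have move_one (a b : R) : a + b = 0 -> b = - a by lra.
have F11 : (d1 (u t) x).1 = d1 A1 x by exact: (derive_fst x _ su).
have F21 : (d2 (u t) x).1 = d2 A1 x by exact: (derive_fst x _ su).
have F12 : (d1 (u t) x).2 = d1 A2 x by exact: (derive_snd x _ su).
have F22 : (d2 (u t) x).2 = d2 A2 x by exact: (derive_snd x _ su).
have G1 := derive_fst (t, x) et sU.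
have G2 := derive_snd (t, x) et sU.
rewrite E1 in E; split.
- rewrite -F11 -F21 -[LHS]G1; apply: move_two; exact: (f_equal fst E).
- rewrite -F12 -F22 -[LHS]G2; apply: move_two; exact: (f_equal snd E).
- rewrite -F11 -F22; apply: move_one; exact: Dv.
Qed.

(** The flux gathers the transport of [W = |w|^2] by [B] and the work of the pressure difference
    [P]. The terms with the divergence of [B] or of [w] drop out by incompressibility. *)
Lemma flux_divergence (A1 A2 B1 B2 P : R * R -> R) x :
  smooth A1 -> smooth A2 -> smooth B1 -> smooth B2 -> smooth P ->
  d2 A2 x = - d1 A1 x -> d2 B2 x = - d1 B1 x ->
  let w1 y := B1 y - A1 y in let w2 y := B2 y - A2 y in
  let W y := w1 y * w1 y + w2 y * w2 y in
  d1 (fun y => B1 y * W y + 2 * (w1 y * P y)) x + d2 (fun y => B2 y * W y + 2 * (w2 y * P y)) x =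
  B1 x * (2 * w1 x * (d1 B1 x - d1 A1 x) + 2 * w2 x * (d1 B2 x - d1 A2 x)) +
  B2 x * (2 * w1 x * (d2 B1 x - d2 A1 x) + 2 * w2 x * (d2 B2 x - d2 A2 x)) +
  2 * (w1 x * d1 P x + w2 x * d2 P x).
Proof.
move=> sA1 sA2 sB1 sB2 sP EA EB w1 w2 W.
have D (f : R * R -> R) v : smooth f -> is_derive x v f ('D_v f x).
  by move=> sf; exact: smooth_is_derive.
have Dw1 v := isD_sub (D B1 v sB1) (D A1 v sA1).
have Dw2 v := isD_sub (D B2 v sB2) (D A2 v sA2).
have DW v := isD_add (isD_mul (Dw1 v) (Dw1 v)) (isD_mul (Dw2 v) (Dw2 v)).
have DF1 v := isD_add (isD_mul (D B1 v sB1) (DW v)) (isD_scale 2 (isD_mul (Dw1 v) (D P v sP))).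
have DF2 v := isD_add (isD_mul (D B2 v sB2) (DW v)) (isD_scale 2 (isD_mul (Dw2 v) (D P v sP))).
have [_ E1] := DF1 (1, 0); have [_ E2] := DF2 (0, 1).
apply: etrans (f_equal2 +%R E1 E2) _.
change ('D_(1, 0) B1 x) with (d1 B1 x) in *.
rewrite -!/(d1 _ x) -!/(d2 _ x) EA EB /w1 /w2; ring.
Qed.

End Uniqueness.

Section UniquenessMain.
Context {R : realType}.
Local Notation S := (@fundamental_square R).
Local Notation spacetime := (R * (R * R))%type.

(** Uses [2 |w1 w2| <= w1^2 + w2^2] for the two cross terms; each then costs as much as half the
    diagonal, whence the constant 4. *)
Lemma quadratic_bound (w1 w2 a b c d K : R) :
  `|a| <= K -> `|b| <= K -> `|c| <= K -> `|d| <= K ->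
  `|2 * (w1 * (w1 * a + w2 * b) + w2 * (w1 * c + w2 * d))| <= 4 * K * (w1 * w1 + w2 * w2).
Proof.
move=> ha hb hc hd.
have K0 : 0 <= K by apply: le_trans ha.
have H1 : `|w1 * w1 * a| <= w1 * w1 * K by rewrite normrM ger0_norm -?expr2 ?sqr_ge0// ler_wpM2l ?sqr_ge0.
have H4 : `|w2 * w2 * d| <= w2 * w2 * K by rewrite normrM ger0_norm -?expr2 ?sqr_ge0// ler_wpM2l ?sqr_ge0.
have N : `|w1 * w2| * 2 <= w1 * w1 + w2 * w2.
  rewrite normrM; have : 0 <= (`|w1| - `|w2|) ^+ 2 by exact: sqr_ge0.
  have e1 : `|w1| * `|w1| = w1 * w1 by rewrite -!expr2 real_normK ?num_real.
  have e2 : `|w2| * `|w2| = w2 * w2 by rewrite -!expr2 real_normK ?num_real.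
  rewrite -e1 -e2; nra.
have H2 : `|w1 * w2 * b| <= `|w1 * w2| * K by rewrite normrM ler_wpM2l.
have H3 : `|w1 * w2 * c| <= `|w1 * w2| * K by rewrite normrM ler_wpM2l.
have -> : 2 * (w1 * (w1 * a + w2 * b) + w2 * (w1 * c + w2 * d)) =
  2 * (w1 * w1 * a + w1 * w2 * b + (w1 * w2 * c + w2 * w2 * d)) by ring.
rewrite normrM (ger0_norm (_ : 0 <= 2))//.
have : `|w1 * w1 * a + w1 * w2 * b + (w1 * w2 * c + w2 * w2 * d)| <=
   w1 * w1 * K + `|w1 * w2| * K + (`|w1 * w2| * K + w2 * w2 * K).
  apply: le_trans (ler_normD _ _) _; apply: lerD.
    by apply: le_trans (ler_normD _ _) _; apply: lerD.
  by apply: le_trans (ler_normD _ _) _; apply: lerD.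
have NK : `|w1 * w2| * 2 * K <= (w1 * w1 + w2 * w2) * K by rewrite ler_wpM2r.
nra.
Qed.

(** The difference [w = v - u] satisfies [w_t + v.grad w + w.grad u + grad (q - p) = 0]. Multiplied
    by [2 w], this is an equation for [|w|^2] in which only the term with [grad u] is not a
    divergence. *)
Lemma euler_energy (u v : R -> R * R -> R * R) p q :
  smooth (fun z : spacetime => u z.1 z.2) -> smooth (fun z : spacetime => v z.1 z.2) ->
  smooth (fun z : spacetime => p z.1 z.2) -> smooth (fun z : spacetime => q z.1 z.2) ->
  (forall t, periodic2 (u t)) -> (forall t, periodic2 (v t)) ->
  (forall t, periodic2 (p t)) -> (forall t, periodic2 (q t)) ->
  euler_equations u p -> euler_equations v q -> u 0 = v 0 -> v = u.
Proof.
move=> sU sV sp sq pu pv pp pq Eu Ev uv0.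
pose a1 (z : spacetime) := (u z.1 z.2).1; pose a2 (z : spacetime) := (u z.1 z.2).2.
pose b1 (z : spacetime) := (v z.1 z.2).1; pose b2 (z : spacetime) := (v z.1 z.2).2.
have sa1 : smooth a1 by exact: smooth_fst sU.
have sa2 : smooth a2 by exact: smooth_snd sU.
have sb1 : smooth b1 by exact: smooth_fst sV.
have sb2 : smooth b2 by exact: smooth_snd sV.
pose w1 z := b1 z - a1 z; pose w2 z := b2 z - a2 z.
have sw1 : smooth w1 by exact: smoothB.
have sw2 : smooth w2 by exact: smoothB.
pose W z := w1 z * w1 z + w2 z * w2 z.
have sW : smooth W by apply: smoothD; apply: smoothM.
pose E t := \int[mu2]_(x in S) W (t, x).
pose dE t := \int[mu2]_(x in S) 'D_et W (t, x).
have mS := @measurable_fundamental_square R.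
have DE (t : R) : is_derive t 1 E (dE t) by exact: square_integral_is_derive.
have W0 z : 0 <= W z by rewrite addr_ge0// -expr2 sqr_ge0.
have cW t : continuous (fun x => W (t, x)) by exact: smooth_cont (smooth_space t sW).
have E0 t : 0 <= E t by apply: Rintegral_ge0.
have HE : forall t, E t = 0.
  apply: (gronwall DE) => //.
    rewrite /E (@eq_Rintegral _ _ _ mu2 S (cst 0)).
      by rewrite Rintegral_cst// mul0r.
    by move=> x _; rewrite /W /w1 /w2 /a1 /a2 /b1 /b2 /= uv0 !subrr mul0r addr0.
  move=> T.
  have c1 (a : spacetime -> R) e : smooth a -> continuous ('D_(ex e) a).
    by move=> sa; exact: smooth_cont (smooth_derive (ex e) sa).
  have [K1 K10 HK1] := spacetime_bounded T (c1 a1 (1, 0) sa1).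
  have [K2 K20 HK2] := spacetime_bounded T (c1 a1 (0, 1) sa1).
  have [K3 K30 HK3] := spacetime_bounded T (c1 a2 (1, 0) sa2).
  have [K4 K40 HK4] := spacetime_bounded T (c1 a2 (0, 1) sa2).
  pose K := K1 + K2 + K3 + K4; exists (4 * K) => t tT.
  pose A1 y := (u t y).1; pose A2 y := (u t y).2.
  pose B1 y := (v t y).1; pose B2 y := (v t y).2.
  pose P y := q t y - p t y.
  have sA1 : smooth A1 by exact: (smooth_space t sa1).
  have sA2 : smooth A2 by exact: (smooth_space t sa2).
  have sB1 : smooth B1 by exact: (smooth_space t sb1).
  have sB2 : smooth B2 by exact: (smooth_space t sb2).
  have spt : smooth (p t) by exact: (smooth_space t sp).
  have sqt : smooth (q t) by exact: (smooth_space t sq).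
  have sP : smooth P by exact: smoothB sqt spt.
  pose V1 y := B1 y - A1 y; pose V2 y := B2 y - A2 y.
  have sV1 : smooth V1 by exact: smoothB.
  have sV2 : smooth V2 by exact: smoothB.
  pose WW y := V1 y * V1 y + V2 y * V2 y.
  have sWW : smooth WW by apply: smoothD; apply: smoothM.
  pose F1 y := B1 y * WW y + 2 * (V1 y * P y).
  pose F2 y := B2 y * WW y + 2 * (V2 y * P y).
  have sF1 : smooth F1.
    by apply: smoothD; [exact: smoothM|apply: (smoothZ (W := R) 2); exact: smoothM].
  have sF2 : smooth F2.
    by apply: smoothD; [exact: smoothM|apply: (smoothZ (W := R) 2); exact: smoothM].
  have pF1 : periodic2 F1.
    by move=> x m n; rewrite /F1 /WW /V1 /V2 /B1 /B2 /A1 /A2 /P pu pv pp pq.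
  have pF2 : periodic2 F2.
    by move=> x m n; rewrite /F2 /WW /V1 /V2 /B1 /B2 /A1 /A2 /P pu pv pp pq.
  (* The term [2 w . (w . grad) u], the only one that survives integration over a period. *)
  pose Q y := 2 * (V1 y * (V1 y * d1 A1 y + V2 y * d2 A1 y) + V2 y * (V1 y * d1 A2 y + V2 y * d2 A2 y)).
  have sQ : smooth Q.
    exact: (smoothZ (W := R) 2 (smoothD
      (smoothM sV1 (smoothD (smoothM sV1 (smooth_d1 sA1)) (smoothM sV2 (smooth_d2 sA1))))
      (smoothM sV2 (smoothD (smoothM sV1 (smooth_d1 sA2)) (smoothM sV2 (smooth_d2 sA2)))))).
  have key x : 'D_et W (t, x) = - d1 F1 x - d2 F2 x - Q x.
    have [ua1 ua2 ua3] := euler_components t x sU Eu.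
    have [va1 va2 va3] := euler_components t x sV Ev.
    have Dt (a : spacetime -> R) : smooth a -> is_derive (t, x) et a ('D_et a (t, x)).
      by move=> sa; exact: smooth_is_derive.
    have Dw1 := isD_sub (Dt b1 sb1) (Dt a1 sa1).
    have Dw2 := isD_sub (Dt b2 sb2) (Dt a2 sa2).
    have [_ DW] := isD_add (isD_mul Dw1 Dw1) (isD_mul Dw2 Dw2).
    apply: etrans DW _.
    have DP1 : d1 P x = d1 (q t) x - d1 (p t) x.
      by have [_ e] := isD_sub (smooth_is_derive x ((1, 0) : R * R) sqt) (smooth_is_derive x _ spt); exact: e.
    have DP2 : d2 P x = d2 (q t) x - d2 (p t) x.
      by have [_ e] := isD_sub (smooth_is_derive x ((0, 1) : R * R) sqt) (smooth_is_derive x _ spt); exact: e.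
    have FD := flux_divergence sA1 sA2 sB1 sB2 sP ua3 va3.
    rewrite -opprD FD DP1 DP2 ua1 ua2 va1 va2 /Q /V1 /V2 /A1 /A2 /B1 /B2 /b1 /b2 /a1 /a2 /=.
    ring.
  have i1 := integrable_square (smooth_cont (smooth_d1 sF1)).
  have i2 := integrable_square (smooth_cont (smooth_d2 sF2)).
  have i1N : mu2.-integrable S (EFin \o (fun x => - d1 F1 x)).
    exact: integrable_square (smooth_cont (smoothN (smooth_d1 sF1))).
  have iQ := integrable_square (smooth_cont sQ).
  have i12 : mu2.-integrable S (EFin \o (fun x => - d1 F1 x - d2 F2 x)).
    exact: integrable_square (smooth_cont (smoothB (smoothN (smooth_d1 sF1)) (smooth_d2 sF2))).
  have -> : dE t = - \int[mu2]_(x in S) Q x.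
    rewrite /dE (@eq_Rintegral _ _ _ mu2 S (fun x => (- d1 F1 x - d2 F2 x) - Q x)); last first.
      by move=> x _; exact: key.
    rewrite RintegralB// RintegralB// integral_d2// subr0.
    rewrite (@eq_Rintegral _ _ _ mu2 S (fun x => -1 * d1 F1 x)); last by move=> x _; rewrite mulN1r.
    by rewrite RintegralZl// integral_d1// mulr0 sub0r.
  rewrite normrN; apply: (le_trans (le_normr_Rintegral mS iQ)).
  rewrite /E -RintegralZl//; last exact: integrable_square (cW t).
  apply: le_Rintegral => //.
  - apply: integrable_square => x; apply: continuous_comp; first exact: smooth_cont sQ x.
    exact: norm_continuous.
  - exact: integrable_square (smooth_cont (smoothZ (W := R) (4 * K) (smooth_space t sW))).
  - move=> x Sx; apply: quadratic_bound.
    + rewrite (_ : d1 A1 x = 'D_(ex (1, 0)) a1 (t, x)); last exact: (space_derive t x (1, 0) sa1).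
      by apply: le_trans (HK1 t x tT Sx) _; rewrite /K; lra.
    + rewrite (_ : d2 A1 x = 'D_(ex (0, 1)) a1 (t, x)); last exact: (space_derive t x (0, 1) sa1).
      by apply: le_trans (HK2 t x tT Sx) _; rewrite /K; lra.
    + rewrite (_ : d1 A2 x = 'D_(ex (1, 0)) a2 (t, x)); last exact: (space_derive t x (1, 0) sa2).
      by apply: le_trans (HK3 t x tT Sx) _; rewrite /K; lra.
    + rewrite (_ : d2 A2 x = 'D_(ex (0, 1)) a2 (t, x)); last exact: (space_derive t x (0, 1) sa2).
      by apply: le_trans (HK4 t x tT Sx) _; rewrite /K; lra.
apply/funext => t; apply/funext => x.
have := @integral_square_pos R (fun x => W (t, x)) (cW t) (fun x => W0 (t, x)) _ (HE t) x.
have pW : periodic2 (fun x => W (t, x)).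
  by move=> y m n; rewrite /W /w1 /w2 /a1 /a2 /b1 /b2 /= pu pv.
move=> /(_ pW) /eqP; rewrite /W paddr_eq0 -?expr2 ?sqr_ge0// !sqrf_eq0 => /andP[/eqP h1 /eqP h2].
apply: pair_ext; apply/eqP; rewrite -subr_eq0; apply/eqP; [exact: h1|exact: h2].
Qed.

Lemma euler_unique u0 (u v : R -> R * R -> R * R) :
  euler_solution u0 u -> euler_solution u0 v -> v = u.
Proof.
move=> [sU pu [p [sp pp Eu]] u0E] [sV pv [q [sq pq Ev]] v0E].
by apply: (euler_energy sU sV sp sq) => //; rewrite u0E.
Qed.

End UniquenessMain.

(** * Periodized steady flows *)

Section Periodization.
Context {R : realType}.
Implicit Types (f g F p : R * R -> R).

Definition vanish_off (A : set (R * R)) f := forall x, ~ A x -> f x = 0.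

Lemma vanish_near (A : set (R * R)) f x : closed A -> vanish_off A f -> ~ A x ->
  \forall y \near x, f y = 0.
Proof.
move=> cA fA nAx; have : nbhs x (~` A).
  by apply: open_nbhs_nbhs; split=> //; exact: closed_openC.
by apply: filterS => y; exact: fA.
Qed.

Lemma vanish_derive A f v : closed A -> vanish_off A f -> vanish_off A ('D_v f).
Proof.
move=> cA fA x nAx.
have H : \near x, f x = cst 0 x by exact: vanish_near cA fA nAx.
by rewrite (near_eq_derive v H) derive_cst.
Qed.

Lemma tmod_id (y : R) : 0 <= y < 2 * pi -> tmod y = y.
Proof.
move=> H; rewrite /tmod.
have /eqP -> : Num.floor (y / (2 * pi)) == 0.
  by rewrite floor_divP ?twopi_gt0// mul0r add0r.
by rewrite mulr0 subr0.
Qed.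

Lemma tmod_addz (y : R) (k : int) : tmod (y + 2 * pi * k%:~R) = tmod y.
Proof.
rewrite /tmod; set P : R := 2 * pi.
have P0 : P != 0 by rewrite gt_eqF ?twopi_gt0.
have -> : (y + P * k%:~R) / P = y / P + k%:~R by field.
have -> : Num.floor (y / P + k%:~R) = Num.floor (y / P) + k.
  apply: floor_def; have /andP[a b] := floor_itv (y / P).
  move: b; rewrite !intrD => b; apply/andP; split; lra.
rewrite intrD; ring.
Qed.

(** Near [y0], reduction modulo the period is the translation that reduces [y0], unless a boundary
    of the period is crossed; then both the translated and the reduced point lie outside
    [[rho, 2 pi - rho]]. *)
Lemma tmod_close (rho y y0 : R) : 0 < rho -> `|y - y0| < rho ->
  let z := y + (tmod y0 - y0) in
  (0 <= z < 2 * pi /\ tmod y = z) \/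
  ((z < rho \/ 2 * pi - rho < z) /\ (tmod y < rho \/ 2 * pi - rho < tmod y)).
Proof.
move=> r0; rewrite ltr_norml => /andP[h1 h2] z.
have /andP[t1 t2] := tmod_itv y0.
have Ez : tmod z = tmod y.
  rewrite /z {1}/tmod /=.
  have -> : y + (y0 - 2 * pi * (Num.floor (y0 / (2 * pi)))%:~R - y0)
    = y + 2 * pi * (- Num.floor (y0 / (2 * pi)))%:~R by rewrite intrN; ring.
  exact: tmod_addz.
have p0 := @twopi_gt0 R.
have /andP[s1 s2] := tmod_itv y.
have [z0|z0] := ltP z 0.
  right; split; first by left; lra.
  right; move: Ez; rewrite -(tmod_addz z 1) => Ez.
  have [zz|zz] := leP 0 (z + 2 * pi).
    by rewrite -Ez mulr1 tmod_id; [rewrite /z; lra|apply/andP; split; lra].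
  by rewrite /z in zz; lra.
have [z2|z2] := ltP z (2 * pi).
  by left; split => //; rewrite -Ez tmod_id//; apply/andP; split.
right; split; first by right; lra.
left; move: Ez; rewrite -(tmod_addz z (-1)) => Ez.
have [zz|zz] := ltP (z - 2 * pi) (2 * pi).
  by rewrite -Ez mulrN1 tmod_id; [rewrite /z; lra|apply/andP; split; lra].
by rewrite /z in zz; lra.
Qed.

Definition box (rho : R) : set (R * R) :=
  [set x | rho <= x.1 <= 2 * pi - rho /\ rho <= x.2 <= 2 * pi - rho].

Lemma closed_box rho : closed (box rho).
Proof.
have -> : box rho = (fst @^-1` `[rho, 2 * pi - rho]%classic) `&` (snd @^-1` `[rho, 2 * pi - rho]%classic).
  by apply/seteqP; split => x; rewrite /box/= !in_itv.
apply: closedI; apply: closed_comp.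
- by move=> x _; exact: cvg_fst.
- exact: interval_closed.
- by move=> x _; exact: cvg_snd.
- exact: interval_closed.
Qed.

(** Precomposition with the reduction, instead of a sum over translates: for a function supported
    inside the square the two agree, and this one is an equality at each point without any
    series. *)
Definition per f x := f (trep x).

(** Where the reduction jumps, both values of [f] are 0, as [f] vanishes near the edges of the
    square. So [per f] is locally a translate of [f], and smoothness and derivatives are
    inherited. *)
Lemma per_local (rho : R) (x0 : R * R) : 0 < rho ->
  \forall x \near x0, forall f, vanish_off (box rho) f ->
    per f x = f (x + (trep x0 - x0)).
Proof.
move=> r0; apply/nbhs_normP; exists rho => //= x.
rewrite /ball_/= distrC prod_normE gt_max => /andP[h1 h2] f fA.
have [[_ E1] | [q1 T1]] := tmod_close r0 h1.
  have [[_ E2] | [q2 T2]] := tmod_close r0 h2.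
    by rewrite /per /trep E1 E2; congr f; apply: pair_ext.
  rewrite /per !fA//.
    move=> [_] /=; case/andP => a b; case: q2; rewrite /= => ?; lra.
  move=> [_] /=; case/andP => a b; case: T2; rewrite /= => ?; lra.
rewrite /per !fA//.
  by case=> /= /andP[a b] _; case: q1 => ?; lra.
by case=> /= /andP[a b] _; case: T1 => ?; lra.
Qed.

Lemma per_smooth rho f : 0 < rho -> vanish_off (box rho) f -> smooth f -> smooth (per f).
Proof.
move=> r0 fA sf; apply: smooth_local => x0.
exists (fun x => f (x + (trep x0 - x0))); first exact: smooth_shift.
have := per_local x0 r0; apply: filterS => x; exact.
Qed.

Lemma per_derive rho f v : 0 < rho -> vanish_off (box rho) f -> smooth f ->
  'D_v (per f) = per ('D_v f).
Proof.
move=> r0 fA sf; apply/funext => x0.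
have H : \forall x \near x0, per f x = (fun x => f (x + (trep x0 - x0))) x.
  by have := per_local x0 r0; apply: filterS => x; exact.
rewrite (near_eq_derive v H) derive_shiftp// /per.
by rewrite addrC subrK.
Qed.

Lemma trep_addz (x : R * R) (m n : int) :
  trep (x + (2 * pi * m%:~R, 2 * pi * n%:~R)) = trep x.
Proof. by rewrite /trep/= !tmod_addz. Qed.

Lemma per_periodic f : periodic2 (per f).
Proof. by move=> x m n; rewrite /per trep_addz. Qed.

(* The stationary Euler equations for the velocity [grad_perp F] and the
   pressure [p]. *)
Definition steady F p := forall x,
  d2 F x * d1 (d2 F) x - d1 F x * d2 (d2 F) x + d1 p x = 0 /\
  d1 F x * d2 (d1 F) x - d2 F x * d1 (d1 F) x + d2 p x = 0.

Lemma steady_per rho F p : 0 < rho -> vanish_off (box rho) F -> vanish_off (box rho) p ->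
  smooth F -> smooth p -> steady F p -> steady (per F) (per p).
Proof.
move=> r0 FA pA sF sp st x.
have cB := @closed_box rho.
have D v : vanish_off (box rho) ('D_v F) by exact: vanish_derive.
have sD v : smooth ('D_v F) by exact: smooth_derive.
have E v : 'D_v (per F) x = 'D_v F (trep x).
  exact: (f_equal (fun g : R * R -> R => g x) (per_derive v r0 FA sF)).
have Ep v : 'D_v (per p) x = 'D_v p (trep x).
  exact: (f_equal (fun g : R * R -> R => g x) (per_derive v r0 pA sp)).
have E2 v w : 'D_w ('D_v (per F)) x = 'D_w ('D_v F) (trep x).
  apply: etrans (f_equal (fun g : R * R -> R => derive g x w) (per_derive v r0 FA sF)) _.
  exact: (f_equal (fun g : R * R -> R => g x) (per_derive w r0 (D v) (sD v))).
have T (a a' b b' c c' d d' e e' : R) : a = a' -> b = b' -> c = c' -> d = d' -> e = e' ->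
  a * b - c * d + e = a' * b' - c' * d' + e' by move=> -> -> -> -> ->.
have [s1 s2] := st (trep x); split.
  by apply: etrans s1; apply: T; [exact: E|exact: E2|exact: E|exact: E2|exact: Ep].
by apply: etrans s2; apply: T; [exact: E|exact: E2|exact: E|exact: E2|exact: Ep].
Qed.

Definition eddy (A : set (R * R)) F p :=
  [/\ closed A, smooth F /\ smooth p, vanish_off A F, vanish_off A p & steady F p].

Lemma eddy0 : eddy set0 (fun=> 0) (fun=> 0).
Proof.
have s0 : smooth (fun _ : R * R => 0 : R) by exact: smooth_cst.
split=> //; first exact: closed0.
move=> x; have E v : 'D_v (fun _ : R * R => 0 : R) x = 0 by exact: derive_cst.
have T (a b c d e : R) : a = 0 -> c = 0 -> e = 0 -> a * b - c * d + e = 0.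
  by move=> -> -> ->; rewrite !mul0r subrr addr0.
by split; apply: T; exact: E.
Qed.

Lemma decoupled_sum (a a1 a2 b b1 b2 c c1 c2 d d1 d2 m m1 m2 : R) :
  a = a1 + a2 -> b = b1 + b2 -> c = c1 + c2 -> d = d1 + d2 -> m = m1 + m2 ->
  a1 * b1 - c1 * d1 + m1 = 0 -> a2 * b2 - c2 * d2 + m2 = 0 ->
  (a2 = 0 /\ b2 = 0 /\ c2 = 0 /\ d2 = 0) \/ (a1 = 0 /\ b1 = 0 /\ c1 = 0 /\ d1 = 0) ->
  a * b - c * d + m = 0.
Proof.
move=> -> -> -> -> -> H1 H2.
by case=> -[z1 [z2 [z3 z4]]]; move: H1 H2; rewrite z1 z2 z3 z4; lra.
Qed.

(** At each point the stream function of at least one of the flows vanishes together with its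
    derivatives, because the supports are closed; the cross terms of the quadratic equation are
    therefore zero. *)
Lemma eddyU A B F p G q : eddy A F p -> eddy B G q -> A `&` B = set0 ->
  eddy (A `|` B) (fun x => F x + G x) (fun x => p x + q x).
Proof.
move=> [cA [sF sp] FA pA stF] [cB [sG sq] GB qB stG] AB.
split.
- exact: closedU.
- by split; exact: smoothD.
- by move=> x /not_orP[nA nB]; rewrite FA ?GB ?addr0.
- by move=> x /not_orP[nA nB]; rewrite pA ?qB ?addr0.
have DD (f g : R * R -> R) v : smooth f -> smooth g ->
    'D_v (fun x => f x + g x) = fun x => 'D_v f x + 'D_v g x.
  move=> sf sg; apply/funext => x.
  by have [_ e] := isD_add (smooth_is_derive x v sf) (smooth_is_derive x v sg); exact: e.
move=> x.
have e1 v : 'D_v (fun x => F x + G x) = fun x => 'D_v F x + 'D_v G x by exact: DD.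
have e2 v w : 'D_w ('D_v (fun x => F x + G x)) = fun x => 'D_w ('D_v F) x + 'D_w ('D_v G) x.
  exact: etrans (f_equal (fun g : R * R -> R => 'D_w g) (e1 v))
    (DD _ _ w (smooth_derive v sF) (smooth_derive v sG)).
have e3 v : 'D_v (fun x => p x + q x) = fun x => 'D_v p x + 'D_v q x by exact: DD.
have [F1 F2] := stF x; have [G1 G2] := stG x.
have VF v : ~ A x -> 'D_v F x = 0 by move=> nA; exact: (@vanish_derive A F v cA FA x nA).
have VFF v w : ~ A x -> 'D_w ('D_v F) x = 0.
  by move=> nA; exact: (@vanish_derive A _ w cA (@vanish_derive A F v cA FA) x nA).
have VG v : ~ B x -> 'D_v G x = 0 by move=> nA; exact: (@vanish_derive B G v cB GB x nA).
have VGG v w : ~ B x -> 'D_w ('D_v G) x = 0.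
  by move=> nA; exact: (@vanish_derive B _ w cB (@vanish_derive B G v cB GB) x nA).
have X1 v := f_equal (fun g : R * R -> R => g x) (e1 v).
have X2 v w := f_equal (fun g : R * R -> R => g x) (e2 v w).
have X3 v := f_equal (fun g : R * R -> R => g x) (e3 v).
have Z : ~ B x \/ ~ A x.
  have [Ax|nA] := pselect (A x); last by right.
  by left=> Bx; have : (A `&` B) x by []; rewrite AB.
split.
  apply: (decoupled_sum (X1 _) (X2 _ _) (X1 _) (X2 _ _) (X3 _) F1 G1).
  case: Z => n; [left|right].
    exact: (conj (VG _ n) (conj (VGG _ _ n) (conj (VG _ n) (VGG _ _ n)))).
  exact: (conj (VF _ n) (conj (VFF _ _ n) (conj (VF _ n) (VFF _ _ n)))).
apply: (decoupled_sum (X1 _) (X2 _ _) (X1 _) (X2 _ _) (X3 _) F2 G2).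
case: Z => n; [left|right].
  exact: (conj (VG _ n) (conj (VGG _ _ n) (conj (VG _ n) (VGG _ _ n)))).
exact: (conj (VF _ n) (conj (VFF _ _ n) (conj (VF _ n) (VFF _ _ n)))).
Qed.

End Periodization.

(** * Radial vortices *)

Section Vortex.
Context {R : realType}.

(** The squared distance is used throughout, as it stays smooth at the centre. *)
Definition rsq (c x : R * R) : R :=
  (x.1 - c.1) * (x.1 - c.1) + (x.2 - c.2) * (x.2 - c.2).

Lemma smooth_coord1 : smooth (fun x : R * R => x.1).
Proof. exact: smooth_fst (@smooth_id R (R * R)%type). Qed.

Lemma smooth_coord2 : smooth (fun x : R * R => x.2).
Proof. exact: smooth_snd (@smooth_id R (R * R)%type). Qed.

Lemma is_derive_coord1 (x v : R * R) : is_derive x v (fun x : R * R => x.1) v.1.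
Proof. exact: is_derive_fst (is_derive_id x v). Qed.

Lemma is_derive_coord2 (x v : R * R) : is_derive x v (fun x : R * R => x.2) v.2.
Proof. exact: is_derive_snd (is_derive_id x v). Qed.

Lemma smooth_rsq c : smooth (rsq c).
Proof.
have s1 : smooth (fun x : R * R => x.1 - c.1).
  exact: smoothB smooth_coord1 (@smooth_cst R _ R c.1).
have s2 : smooth (fun x : R * R => x.2 - c.2).
  exact: smoothB smooth_coord2 (@smooth_cst R _ R c.2).
exact: smoothD (smoothM s1 s1) (smoothM s2 s2).
Qed.

Lemma is_derive_rsq c x v :
  is_derive x v (rsq c) (2 * ((x.1 - c.1) * v.1 + (x.2 - c.2) * v.2)).
Proof.
have s1 : is_derive x v (fun x : R * R => x.1 - c.1) v.1.
  by have := isD_sub (is_derive_coord1 x v) (is_derive_cst c.1 x v); rewrite subr0.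
have s2 : is_derive x v (fun x : R * R => x.2 - c.2) v.2.
  by have := isD_sub (is_derive_coord2 x v) (is_derive_cst c.2 x v); rewrite subr0.
by apply: is_derive_eq (isD_add (isD_mul s1 s1) (isD_mul s2 s2)) _; ring.
Qed.

Lemma derive_radial (g : R -> R) c x v : smooth g ->
  'D_v (fun y => g (rsq c y)) x = 'D_1 g (rsq c x) * (2 * ((x.1 - c.1) * v.1 + (x.2 - c.2) * v.2)).
Proof.
move=> sg.
by have [_ e] := is_derive_comp1 (is_derive_rsq c x v) (smooth_is_derive (rsq c x) 1 sg); exact: e.
Qed.

Lemma derive2_radial (g : R -> R) c x v w : smooth g ->
  'D_w ('D_v (fun y => g (rsq c y))) x =
  'D_1 g (rsq c x) * (2 * (w.1 * v.1 + w.2 * v.2)) +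
  2 * ((x.1 - c.1) * v.1 + (x.2 - c.2) * v.2) *
   ('D_1 ('D_1 g) (rsq c x) * (2 * ((x.1 - c.1) * w.1 + (x.2 - c.2) * w.2))).
Proof.
move=> sg.
have E : 'D_v (fun y => g (rsq c y)) = fun y => 'D_1 g (rsq c y) * (2 * ((y.1 - c.1) * v.1 + (y.2 - c.2) * v.2)).
  by apply/funext => y; exact: derive_radial.
apply: etrans (f_equal (fun f : R * R -> R => derive f x w) E) _.
have D1 : is_derive x w (fun y => 'D_1 g (rsq c y)) ('D_1 ('D_1 g) (rsq c x) * (2 * ((x.1 - c.1) * w.1 + (x.2 - c.2) * w.2))).
  have sg' : smooth ('D_(1 : R) g) by exact: smooth_derive.
  exact: (@is_derive_comp1 _ _ ('D_(1 : R) g) (rsq c) x w _ _ (is_derive_rsq c x w) (smooth_is_derive (rsq c x) (1 : R) sg')).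
have s1 : is_derive x w (fun y : R * R => (y.1 - c.1) * v.1) (w.1 * v.1).
  have := isD_scale v.1 (isD_sub (is_derive_coord1 x w) (is_derive_cst c.1 x w)).
  rewrite subr0 mulrC (_ : (fun _ => _) = fun y : R * R => (y.1 - c.1) * v.1)//.
  by apply/funext => y; rewrite mulrC.
have s2 : is_derive x w (fun y : R * R => (y.2 - c.2) * v.2) (w.2 * v.2).
  have := isD_scale v.2 (isD_sub (is_derive_coord2 x w) (is_derive_cst c.2 x w)).
  rewrite subr0 mulrC (_ : (fun _ => _) = fun y : R * R => (y.2 - c.2) * v.2)//.
  by apply/funext => y; rewrite mulrC.
by have [_ e] := isD_mul D1 (isD_scale 2 (isD_add s1 s2)); exact: e.
Qed.

(** The parameter [b] is the squared radius. *)
Definition disc (c : R * R) (b : R) : set (R * R) := [set x | rsq c x <= b].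

Lemma closed_disc c b : closed (disc c b).
Proof.
have -> : disc c b = rsq c @^-1` [set y | y <= b] by [].
apply: closed_comp; last exact: closed_le.
by move=> x _; exact: smooth_cont (smooth_rsq c) x.
Qed.

Lemma scaled_radial (k : R) (g : R -> R) : smooth g -> smooth (fun s => k * g s).
Proof. by move=> sg; exact: (smoothZ (W := R) k sg). Qed.

(** The fluid rotates with angular speed [2 al g'], so its acceleration is [-4 al^2 g'^2 (x - c)].
    As [H' = 4 g'^2], this is minus the gradient of [al^2 / 2 * H (rsq c x)]. *)
Lemma eddy_vortex (g H : R -> R) c al b : smooth g -> smooth H ->
  (forall s, b <= s -> g s = 0 /\ H s = 0) ->
  (forall s, 'D_1 H s = 4 * 'D_1 g s ^+ 2) ->
  eddy (disc c b) (fun x => al * g (rsq c x)) (fun x => al ^+ 2 / 2 * H (rsq c x)).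
Proof.
move=> sg sH gH dH.
have sag := scaled_radial al sg; have saH := scaled_radial (al ^+ 2 / 2) sH.
split.
- exact: closed_disc.
- split; first exact: smooth_comp1 sag (smooth_rsq c).
  exact: smooth_comp1 saH (smooth_rsq c).
- by move=> x /negP; rewrite -ltNge => /ltW /gH[-> _]; rewrite mulr0.
- by move=> x /negP; rewrite -ltNge => /ltW /gH[_ ->]; rewrite mulr0.
move=> x.
have d1g s : 'D_1 (fun s => al * g s) s = al * 'D_1 g s.
  by have [_ e] := isD_scale al (smooth_is_derive s 1 sg); exact: e.
have d2g s : 'D_1 ('D_1 (fun s => al * g s)) s = al * 'D_1 ('D_1 g) s.
  have E : 'D_1 (fun s => al * g s) = fun s => al * 'D_1 g s by apply/funext.
  apply: etrans (f_equal (fun f : R -> R => derive f s 1) E) _.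
  by have [_ e] := isD_scale al (smooth_is_derive s (1 : R) (smooth_derive (1 : R) sg)); exact: e.
have d1H s : 'D_1 (fun s => al ^+ 2 / 2 * H s) s = al ^+ 2 / 2 * (4 * 'D_1 g s ^+ 2).
  by have [_ e] := isD_scale (al ^+ 2 / 2) (smooth_is_derive s 1 sH); rewrite -dH; exact: e.
have E1 v := derive_radial c x v sag.
have E2 v w := derive2_radial c x v w sag.
have E3 v := derive_radial c x v saH.
have T (a a' h h' k k' d d' e e' : R) : a = a' -> h = h' -> k = k' -> d = d' -> e = e' ->
  a' * h' - k' * d' + e' = 0 -> a * h - k * d + e = 0 by move=> -> -> -> -> ->.
split.
  apply: (T _ _ _ _ _ _ _ _ _ _ (E1 _) (E2 _ _) (E1 _) (E2 _ _) (E3 _)).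
  by rewrite d1g d2g d1H /=; field.
apply: (T _ _ _ _ _ _ _ _ _ _ (E1 (1, 0)) (E2 (1, 0) (0, 1)) (E1 (0, 1)) (E2 (1, 0) (1, 0)) (E3 (0, 1))).
by rewrite d1g d2g d1H /=; field.
Qed.

End Vortex.

(** * Vortices carried by a shear flow *)

Section Superposition.
Context {R : realType}.
Local Notation spacetime := (R * (R * R))%type.

Lemma isD_sum (V : normedModType R) (I : Type) (r : seq I) (f : I -> V -> R) (df : I -> R) x v :
  (forall i, is_derive x v (f i) (df i)) ->
  is_derive x v (fun y => \sum_(i <- r) f i y) (\sum_(i <- r) df i).
Proof.
move=> H; elim: r => [|i r IH].
  rewrite big_nil (_ : (fun _ => _) = cst 0); first exact: is_derive_cst.
  by apply/funext => y; rewrite big_nil.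
rewrite big_cons (_ : (fun _ => _) = fun y => f i y + \sum_(j <- r) f j y).
  exact: isD_add.
by apply/funext => y; rewrite big_cons.
Qed.

Lemma derive_periodic2 (W : normedModType R) (f : R * R -> W) v :
  smooth f -> periodic2 f -> periodic2 ('D_v f).
Proof.
move=> sf pf x m n.
have E : (fun y => f (y + (2 * pi * m%:~R, 2 * pi * n%:~R))) = f.
  by apply/funext => y; exact: pf.
have := derive_shiftp (2 * pi * m%:~R, 2 * pi * n%:~R) v x sf.
by rewrite E => ->.
Qed.

Definition west : R * R := (-1, 0).

Lemma derive_west (f : R * R -> R) x : smooth f -> 'D_west f x = - d1 f x.
Proof.
move=> sf; have := derive_dirZ x ((1, 0) : R * R) (-1) sf.
rewrite mulN1r (_ : -1 *: _ = west)//.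
by apply: pair_ext; rewrite /= /GRing.scale/= ?mulr1 ?mulr0.
Qed.

Lemma smooth_travelling (W : normedModType R) (s : R) (f : R * R -> W) : smooth f ->
  smooth (fun z : spacetime => f (z.2 + (s * z.1) *: west)).
Proof.
apply: (@smooth_affine R _ _ W (fun z : spacetime => z.2 + (s * z.1) *: west)
  (fun z : spacetime => z.2 + (s * z.1) *: west)).
  move=> z v h; rewrite /= scalerDr !scalerA mulrDr scalerDl addrACA; congr (_ + (_ + _ *: _)).
  by rewrite /GRing.scale/= mulrCA.
have s1 : smooth (fun z : spacetime => s * z.1).
  exact: (smoothZ (W := R) s (smooth_fst (@smooth_id R spacetime))).
have s2 : smooth (fun z : spacetime => (s * z.1) *: west).
  exact: (smooth_pair (smoothM s1 (@smooth_cst R spacetime R (-1))) (smoothM s1 (@smooth_cst R spacetime R 0))).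
exact: smooth_cont (smoothD (smooth_snd (@smooth_id R spacetime)) s2).
Qed.

Lemma travelling_time (s t : R) (f : R * R -> R) x : smooth f ->
  is_derive t 1 (fun t => f (x + (s * t) *: west)) (- (s * d1 f (x + (s * t) *: west))).
Proof.
move=> sf.
have L : forall (y v h : R), x + (s * (y + h *: v)) *: west = x + (s * y) *: west + h *: ((s * v) *: west).
  by move=> y v h; rewrite -addrA scalerA -scalerDl mulrDr /GRing.scale/= mulrCA.
have := @is_derive_affine R _ _ _ (fun t : R => x + (s * t) *: west) (fun t : R => (s * t) *: west) f t 1 _ L
   (smooth_is_derive _ _ sf).
by rewrite derive_dirZ// derive_west// mulr1 mulrN.
Qed.

Context (n : nat) (Psi Pi : 'I_n -> R * R -> R) (s : 'I_n -> R).
Context (Y : 'I_n -> R -> Prop) (b : R -> R).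

Definition shifted i t (x : R * R) := x + (s i * t) *: west.

(* The [i]-th steady flow is carried along [x1] at speed [s i], which is also the
   speed of the shear flow [b'] on the strip [Y i] containing its support. *)
Definition velocity (t : R) (x : R * R) : R * R :=
  ('D_1 b x.2 + \sum_i d2 (Psi i) (shifted i t x),
   - \sum_i d1 (Psi i) (shifted i t x)).

Definition pressure (t : R) (x : R * R) : R := \sum_i Pi i (shifted i t x).

Context (sPsi : forall i, smooth (Psi i)) (sPi : forall i, smooth (Pi i)).
Context (pPsi : forall i, periodic2 (Psi i)) (pPi : forall i, periodic2 (Pi i)).
Context (stPsi : forall i, steady (Psi i) (Pi i)).
Context (offY : forall i (x : R * R), ~ Y i x.2 ->
  (forall v, 'D_v (Psi i) x = 0) /\ (forall v w, 'D_w ('D_v (Psi i)) x = 0)).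
Context (disjY : forall i j y, Y i y -> Y j y -> i = j).
Context (sb : smooth b).
Context (pb : forall y (k : int), b (y + 2 * pi * k%:~R) = b y).
Context (bY : forall i y, Y i y -> 'D_1 b y = s i /\ 'D_1 ('D_1 b) y = 0).

Lemma shifted_snd i t x : (shifted i t x).2 = x.2.
Proof. by rewrite /shifted /= scaler0 addr0. Qed.

Lemma shifted_period i t x c : shifted i t (x + c) = shifted i t x + c.
Proof. by rewrite /shifted addrAC. Qed.

Lemma velocity_smooth : smooth (fun z : spacetime => velocity z.1 z.2).
Proof.
have sx2 : smooth (fun z : spacetime => z.2.2).
  exact: smooth_snd (smooth_snd (@smooth_id R spacetime)).
apply: smooth_pair.
  apply: smoothD; first exact: (smooth_comp1 (smooth_derive (1 : R) sb) sx2).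
  apply: smooth_sum => i _; apply: (smooth_travelling (s i)); exact: smooth_d2.
apply: smoothN; apply: smooth_sum => i _; apply: (smooth_travelling (s i)); exact: smooth_d1.
Qed.

Lemma pressure_smooth : smooth (fun z : spacetime => pressure z.1 z.2).
Proof. by apply: smooth_sum => i _; apply: (smooth_travelling (s i)). Qed.

Lemma velocity_periodic t : periodic2 (velocity t).
Proof.
move=> x m k; apply: pair_ext; rewrite /=.
  congr (_ + _).
    have E : (fun y => b (y + 2 * pi * k%:~R)) = b by apply/funext => y; exact: pb.
    by have := derive_shiftp (2 * pi * k%:~R) (1 : R) x.2 sb; rewrite E => ->.
  apply: eq_bigr => i _; rewrite shifted_period; exact: derive_periodic2.
congr (- _); apply: eq_bigr => i _; rewrite shifted_period; exact: derive_periodic2.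
Qed.

Lemma pressure_periodic t : periodic2 (pressure t).
Proof. by move=> x m k; apply: eq_bigr => i _; rewrite shifted_period pPi. Qed.

Lemma shifted_derive (f : R * R -> R) i t x v : smooth f ->
  is_derive x v (fun y => f (shifted i t y)) ('D_v f (shifted i t x)).
Proof.
move=> sf; rewrite -(derive_shiftp ((s i * t) *: west) v x sf).
exact: smooth_is_derive (smooth_shift _ sf).
Qed.

(** Strips are disjoint, so at a given height only one of the travelling flows is alive and each sum
    reduces to one term. *)
Lemma sum_localized (F : 'I_n -> R) k y : Y k y -> (forall i, ~ Y i y -> F i = 0) ->
  \sum_i F i = F k.
Proof.
move=> Yk F0; rewrite (bigD1 k)//= big1 ?addr0// => i ik; apply: F0 => Yi.
by move/eqP : ik; apply; exact: disjY Yi Yk.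
Qed.

(** On a strip, advection by the constant shear speed [sk] cancels the time derivative of the
    travelling flow, and the stationary equation remains. Elsewhere the flow is a pure shear, for
    which every term vanishes. *)
Lemma momentum_balance (b1 b2 A B c11 c12 c21 c22 P1 P2 sk : R) :
  A * c12 - B * c22 + P1 = 0 -> B * c21 - A * c11 + P2 = 0 ->
  (b1 = sk /\ b2 = 0) \/ [/\ B = 0, c11 = 0 & c12 = 0] ->
  - (sk * c12) + ((b1 + A) * c12 + - B * (b2 + c22)) + P1 = 0 /\
  sk * c11 + ((b1 + A) * (- c11) + - B * (- c21)) + P2 = 0.
Proof.
move=> H1 H2 [[-> ->]|[z1 z2 z3]]; split.
- by rewrite -[RHS]H1; ring.
- by rewrite -[RHS]H2; ring.
- by rewrite -[RHS]H1 z1 z3; ring.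
- by rewrite -[RHS]H2 z1 z2; ring.
Qed.

Lemma velocity_euler : euler_equations velocity pressure.
Proof.
move=> t x.
have s1 i : smooth (d1 (Psi i)) by exact: smooth_d1.
have s2 i : smooth (d2 (Psi i)) by exact: smooth_d2.
have Dt : is_derive t 1 (fun t => velocity t x)
  (0 + \sum_i - (s i * d1 (d2 (Psi i)) (shifted i t x)),
   - \sum_i - (s i * d1 (d1 (Psi i)) (shifted i t x))).
  apply: is_derive_pair.
    apply: (isD_add (is_derive_cst _ t 1)); apply: isD_sum => i; exact: travelling_time.
  by apply: is_deriveN; apply: isD_sum => i; exact: travelling_time.
have Db v : is_derive x v (fun y => 'D_1 b y.2) ('D_1 ('D_1 b) x.2 * v.2).
  have sb' : smooth ('D_(1 : R) b) by exact: smooth_derive.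
  exact: (is_derive_comp1 (is_derive_coord2 x v) (smooth_is_derive x.2 (1 : R) sb')).
have Dx v : is_derive x v (velocity t)
  ('D_1 ('D_1 b) x.2 * v.2 + \sum_i 'D_v (d2 (Psi i)) (shifted i t x),
   - \sum_i 'D_v (d1 (Psi i)) (shifted i t x)).
  apply: is_derive_pair.
    apply: (isD_add (Db v)); apply: isD_sum => i; exact: shifted_derive.
  by apply: is_deriveN; apply: isD_sum => i; exact: shifted_derive.
have Dp v : is_derive x v (pressure t) (\sum_i 'D_v (Pi i) (shifted i t x)).
  by apply: isD_sum => i; exact: shifted_derive.
have Et : derive1 (fun t => velocity t x) t =
  (0 + \sum_i - (s i * d1 (d2 (Psi i)) (shifted i t x)),
   - \sum_i - (s i * d1 (d1 (Psi i)) (shifted i t x))).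
  by rewrite derive1E; have [_ e] := Dt; exact: e.
have E1 : d1 (velocity t) x = (\sum_i d1 (d2 (Psi i)) (shifted i t x),
   - \sum_i d1 (d1 (Psi i)) (shifted i t x)).
  have [_ e] := Dx (1, 0); apply: etrans e _; congr (_, _).
  by rewrite mulr0 add0r.
have E2 : d2 (velocity t) x = ('D_1 ('D_1 b) x.2 + \sum_i d2 (d2 (Psi i)) (shifted i t x),
   - \sum_i d2 (d1 (Psi i)) (shifted i t x)).
  have [_ e] := Dx (0, 1); apply: etrans e _; congr (_, _).
  by rewrite mulr1.
have Ep : grad (pressure t) x = (\sum_i d1 (Pi i) (shifted i t x), \sum_i d2 (Pi i) (shifted i t x)).
  by have [_ e1] := Dp (1, 0); have [_ e2] := Dp (0, 1); congr (_, _); [exact: e1|exact: e2].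
have st i := stPsi i (shifted i t x).
have Z i : ~ Y i x.2 -> [/\ d1 (Psi i) (shifted i t x) = 0, d2 (Psi i) (shifted i t x) = 0 &
   [/\ d1 (d1 (Psi i)) (shifted i t x) = 0, d1 (d2 (Psi i)) (shifted i t x) = 0,
       d2 (d1 (Psi i)) (shifted i t x) = 0 & d2 (d2 (Psi i)) (shifted i t x) = 0]].
  rewrite -(shifted_snd i t x) => /offY[z1 z2].
  by split; [exact: z1|exact: z1|split; exact: z2].
(* Off its strip a flow has zero velocity, so the stationary equation forces its pressure gradient
   to vanish there too. *)
have ZP i : ~ Y i x.2 -> d1 (Pi i) (shifted i t x) = 0 /\ d2 (Pi i) (shifted i t x) = 0.
  move=> nY; have [z1 z2 [z3 z4 z5 z6]] := Z i nY; have [st1 st2] := stPsi i (shifted i t x).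
  have T (a c d e f : R) : a = 0 -> d = 0 -> a * c - d * e + f = 0 -> f = 0.
    by move=> -> ->; rewrite !mul0r subrr add0r.
  by split; [exact: T z2 z1 st1|exact: T z1 z2 st2].
split; last first.
  have D12 i : d1 (d2 (Psi i)) (shifted i t x) = d2 (d1 (Psi i)) (shifted i t x).
    exact: (f_equal (fun f : R * R -> R => f (shifted i t x)) (derive_comm _ _ (sPsi i))).
  rewrite /divergence E1 E2 /=; apply/eqP; rewrite subr_eq0; apply/eqP.
  by apply: eq_bigr => i _; exact: D12.
have [sk [A [B [c11 [c12 [c21 [c22 [P1 [P2]]]]]]]]] : exists sk A B c11 c12 c21 c22 P1 P2 : R,
  [/\ [/\ \sum_i d2 (Psi i) (shifted i t x) = A, \sum_i d1 (Psi i) (shifted i t x) = B,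
       \sum_i s i * d1 (d2 (Psi i)) (shifted i t x) = sk * c12 &
       \sum_i s i * d1 (d1 (Psi i)) (shifted i t x) = sk * c11],
      [/\ \sum_i d1 (d1 (Psi i)) (shifted i t x) = c11, \sum_i d1 (d2 (Psi i)) (shifted i t x) = c12,
       \sum_i d2 (d1 (Psi i)) (shifted i t x) = c21 & \sum_i d2 (d2 (Psi i)) (shifted i t x) = c22],
      (\sum_i d1 (Pi i) (shifted i t x) = P1 /\ \sum_i d2 (Pi i) (shifted i t x) = P2),
      (A * c12 - B * c22 + P1 = 0 /\ B * c21 - A * c11 + P2 = 0) &
      ('D_1 b x.2 = sk /\ 'D_1 ('D_1 b) x.2 = 0) \/ [/\ B = 0, c11 = 0 & c12 = 0]].
  (* Either the point lies on the strip of one flow, which then supplies every sum, or all the flows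
     are at rest there. *)
  have [[k Yk]|nY] := pselect (exists k, Y k x.2).
    have L (F : 'I_n -> R) : (forall i, ~ Y i x.2 -> F i = 0) -> \sum_i F i = F k by move=> F0; exact: (@sum_localized F k _ Yk F0).
    do 9 eexists; split.
    - split; apply: L => i /Z [z1 z2 [z3 z4 z5 z6]]; [exact: z2|exact: z1|by rewrite z4 mulr0|by rewrite z3 mulr0].
    - split; apply: L => i /Z [z1 z2 [z3 z4 z5 z6]]; [exact: z3|exact: z4|exact: z5|exact: z6].
    - split; apply: L => i /ZP [z1 z2]; [exact: z1|exact: z2].
    - exact: st.
    - by left; exact: bY.
  have nYi i : ~ Y i x.2 by move=> Yi; apply: nY; exists i.
  have L (F : 'I_n -> R) : (forall i, ~ Y i x.2 -> F i = 0) -> \sum_i F i = 0.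
    by move=> H; rewrite big1// => i _; exact: H.
  exists 0, 0, 0, 0, 0, 0, 0, 0, 0; split.
  - split; [| |rewrite mulr0|rewrite mulr0]; apply: L => i /Z [z1 z2 [z3 z4 z5 z6]]; [exact: z2|exact: z1|by rewrite z4 mulr0|by rewrite z3 mulr0].
  - split; apply: L => i /Z [z1 z2 [z3 z4 z5 z6]]; [exact: z3|exact: z4|exact: z5|exact: z6].
  - split; apply: L => i /ZP [z1 z2]; [exact: z1|exact: z2].
  - by rewrite !mulr0 subrr addr0.
  - by right.
move=> [[e1 e2 e3 e4] [e5 e6 e7 e8] [e9 e10] [m1 m2] m3].
have [M1 M2] := momentum_balance m1 m2 m3.
rewrite Et E1 E2 Ep; apply: pair_ext.
  apply: etrans M1; rewrite -e3 -e1 -e2 -e6 -e8 -e9 /= sumrN add0r; by [].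
apply: etrans M2; rewrite -e4 -e1 -e2 -e5 -e7 -e10 /= sumrN opprK; by [].
Qed.

Lemma velocity_solution : euler_solution (velocity 0) velocity.
Proof.
split=> //; [exact: velocity_smooth|exact: velocity_periodic|].
exists pressure; split; [exact: pressure_smooth|exact: pressure_periodic|exact: velocity_euler].
Qed.

End Superposition.

(** * Filling the square with discs *)

Section Packing.
Context {R : realType}.
Local Notation plane := (measurableTypeR R * measurableTypeR R)%type.
Local Notation S := (@fundamental_square R).
Implicit Types (K : set (R * R)) (D : seq ((R * R) * R)).

Definition hull k (c : R * R) : set (R * R) := (gcell k (gindex k c) : set (R * R))°.

Fixpoint discs D : set (R * R) :=
  if D is d :: D' then disc d.1 d.2 `|` discs D' else set0.

(** Each disc joins the obstacle [K] seen by the following ones, which encodes pairwise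
    disjointness. *)
Fixpoint packed k K D : Prop :=
  if D is d :: D' then
    [/\ disc d.1 d.2 `&` K = set0, disc d.1 d.2 `<=` hull k d.1 &
        packed k (K `|` disc d.1 d.2) D']
  else True.

Lemma closed_discs D : closed (discs D).
Proof.
elim: D => [|d D IH] /=; first exact: closed0.
by apply: closedU => //; exact: closed_disc.
Qed.

Lemma discs_cat D1 D2 : discs (D1 ++ D2) = discs D1 `|` discs D2.
Proof. by elim: D1 => [|d D IH] /=; rewrite ?set0U// IH setUA. Qed.

Lemma packed_cat k K D1 D2 : packed k K D1 -> packed k (K `|` discs D1) D2 ->
  packed k K (D1 ++ D2).
Proof.
elim: D1 K => [|d D IH] K /=; first by rewrite setU0.
move=> [h1 h2 h3] h4; split=> //; apply: IH => //; by rewrite -setUA.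
Qed.

Definition gcenter k (i : int * int) : R * R :=
  ((i.1%:~R + 2^-1) * mesh k, (i.2%:~R + 2^-1) * mesh k).

(** The radius is [2/5] of the mesh, leaving a margin of a tenth of the mesh inside the cell. *)
Definition gdisc k (i : int * int) : (R * R) * R :=
  (gcenter k i, 4 / 25 * (mesh k * mesh k)).

Lemma gindexE k (x : R * R) (i : int * int) :
  i.1%:~R * mesh k <= x.1 < i.1%:~R * mesh k + mesh k ->
  i.2%:~R * mesh k <= x.2 < i.2%:~R * mesh k + mesh k -> gindex k x = i.
Proof.
case: i => m n /= h1 h2; rewrite /gindex.
by congr (_, _); apply/eqP; rewrite floor_divP ?mesh_gt0.
Qed.

Lemma sq_le_abs (a r : R) : 0 <= r -> a * a <= r * r -> `|a| <= r.
Proof.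
move=> r0; rewrite -!expr2 => H.
by rewrite -(ler_pXn2r (n := 2)) ?nnegrE// real_normK ?num_real.
Qed.

Lemma gdisc_coords k i x : disc (gdisc k i).1 (gdisc k i).2 x ->
  `|x.1 - (gcenter k i).1| <= 2 / 5 * mesh k /\ `|x.2 - (gcenter k i).2| <= 2 / 5 * mesh k.
Proof.
have h0 := @mesh_gt0 R k.
move=> Hx; have H : rsq (gcenter k i) x <= 4 / 25 * (mesh k * mesh k) by exact: Hx.
rewrite /rsq in H; have E : 2 / 5 * mesh k * (2 / 5 * mesh k) = 4 / 25 * (mesh k * mesh k) :> R by field.
have p1 : 0 <= (x.1 - (gcenter k i).1) * (x.1 - (gcenter k i).1) by rewrite -expr2 sqr_ge0.
have p2 : 0 <= (x.2 - (gcenter k i).2) * (x.2 - (gcenter k i).2) by rewrite -expr2 sqr_ge0.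
have r0 : 0 <= 2 / 5 * mesh k :> R by rewrite mulr_ge0 ?ltW//; lra.
by split; apply: sq_le_abs => //; rewrite E; apply: le_trans H; rewrite ?lerDl ?lerDr.
Qed.

Lemma near_gdisc k i (x y : R * R) : disc (gdisc k i).1 (gdisc k i).2 x ->
  `|x - y| < mesh k / 20 -> gindex k y = i.
Proof.
move=> /gdisc_coords[]; rewrite !ler_norml prod_normE gt_max !ltr_norml /gcenter /=.
have h0 := @mesh_gt0 R k; set h : R := mesh k in h0 *.
move=> /andP[a1 a2] /andP[b1 b2] /andP[/andP[c1 c2] /andP[d1 d2]].
by apply: gindexE; rewrite -/h; apply/andP; split; lra.
Qed.

Lemma gdisc_gcell k i : disc (gdisc k i).1 (gdisc k i).2 `<=` gcell k i.
Proof.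
move=> x Hx; apply: near_gdisc Hx _.
by rewrite subrr normr0 divr_gt0 ?mesh_gt0.
Qed.

Lemma gdisc_center k i : disc (gdisc k i).1 (gdisc k i).2 (gcenter k i).
Proof.
rewrite /disc/= /rsq !subrr !mulr0 addr0; have h0 := @mesh_gt0 R k.
by have := mulr_gt0 h0 h0; lra.
Qed.

Lemma gdisc_hull k0 k i : (k0 <= k)%N ->
  disc (gdisc k i).1 (gdisc k i).2 `<=` hull k0 (gdisc k i).1.
Proof.
move=> k0k x Hx.
pose G : set (R * R) := [set y | gindex k0 y = gindex k0 (gdisc k i).1].
suff : nbhs (x : R * R) G by [].
have [_] := nbhs_normP x G; apply; exists (mesh k / 20); first by rewrite /= divr_gt0 ?mesh_gt0.
move=> y Hy; rewrite /G/=; apply: (gindex_coarsen k0k).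
rewrite (near_gdisc Hx Hy); apply/esym; exact: gdisc_gcell (gdisc_center k i).
Qed.

(** The disc contains the concentric square of side half the mesh, since [1/8 <= 4/25]; that square
    has a quarter of the area of the cell. This avoids computing the area of a disc. *)
Lemma gdisc_measure k i :
  (mu2 (gcell k i `\` disc (gdisc k i).1 (gdisc k i).2 : set plane) <= (3 / 4 * (mesh k * mesh k))%:E)%E.
Proof.
have h0 := @mesh_gt0 R k; set h : R := mesh k in h0 *.
pose c := gcenter k i.
pose Q : set plane := `[c.1 - h / 4, c.1 + h / 4[%classic `*` `[c.2 - h / 4, c.2 + h / 4[%classic.
have mQ : measurable Q by apply: measurableX; exact: measurable_itv.
have muQ : mu2 Q = (h * h / 4)%:E.
  by rewrite mu2_rect; [congr (_%:E); field|lra|lra].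
have Qd : Q `<=` disc (gdisc k i).1 (gdisc k i).2.
  move=> x; rewrite /Q/= !in_itv/= => -[/andP[a1 a2] /andP[b1 b2]].
  have H (y cc : R) : cc - h / 4 <= y -> y < cc + h / 4 -> (y - cc) * (y - cc) <= h * h / 16.
    by move=> ? ?; nra.
  have e1 := H _ _ a1 a2; have e2 := H _ _ b1 b2.
  suff : rsq c x <= 4 / 25 * (h * h) by [].
  by have hh := mulr_gt0 h0 h0; apply: (le_trans (lerD e1 e2)); lra.
have Qc : Q `<=` gcell k i by apply: subset_trans Qd (@gdisc_gcell k i).
have mc := @measurable_gcell R k i.
have mcf : (@mu2 R (@gcell R k i) < +oo)%E by rewrite mu2_gcell ltry.
apply: (@le_trans _ _ (mu2 (gcell k i `\` Q))).
  apply: le_measure; rewrite ?inE.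
  - by apply: measurableD => //; apply: closed_measurable2; exact: closed_disc.
  - exact: measurableD.
  - by apply: setDS.
have -> : @mu2 R (gcell k i `\` Q) = (@mu2 R (gcell k i) - @mu2 R Q)%E.
  by rewrite measureD// (setIidr Qc).
by rewrite mu2_gcell muQ -/h -EFinB lee_fin; lra.
Qed.

Definition gcells (l : seq (int * int)) k : set plane := \big[setU/set0]_(i <- l) gcell k i.

Lemma measurable_gcells l k : measurable (gcells l k).
Proof. by apply: bigsetU_measurable => i _; exact: measurable_gcell. Qed.

Lemma mem_gcells l k x : gcells l k x <-> gindex k x \in l.
Proof.
rewrite /gcells; elim: l => [|i l IH]; first by rewrite big_nil.
rewrite big_cons inE; split.
  by case=> [<-|/IH ->]; rewrite ?eqxx ?orbT.
by case/orP => [/eqP H|/IH H]; [left|right].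
Qed.

Lemma gdiscs_measure k l : uniq l ->
  (mu2 (gcells l k `\` discs (map (gdisc k) l) : set plane) <= (3 / 4)%:E * mu2 (gcells l k))%E.
Proof.
elim: l => [|i l IH] /=.
  by rewrite /gcells big_nil set0D measure0 mule0.
move=> /andP[il ul].
have E : gcells (i :: l) k = gcell k i `|` gcells l k by rewrite /gcells big_cons.
have mc := @measurable_gcell R k i; have ml := measurable_gcells l k.
have md : measurable (disc (gdisc k i).1 (gdisc k i).2 : set plane).
  by apply: closed_measurable2; exact: closed_disc.
have mD : measurable (discs (map (gdisc k) l) : set plane).
  by apply: closed_measurable2; exact: closed_discs.
have m1 : measurable (gcell k i `\` disc (gdisc k i).1 (gdisc k i).2 : set plane) by exact: measurableD.
have m2 : measurable (gcells l k `\` discs (map (gdisc k) l) : set plane) by exact: measurableD.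
rewrite E measureU//; last first.
  apply/seteqP; split => x // -[]; rewrite /gcell/= => xi /mem_gcells.
  by rewrite xi (negbTE il).
rewrite ge0_muleDr//.
apply: (@le_trans _ _ (mu2 ((gcell k i `\` disc (gdisc k i).1 (gdisc k i).2) `|`
    (gcells l k `\` discs (map (gdisc k) l)) : set plane))).
  apply: le_measure; rewrite ?inE.
  - exact: measurableD (measurableU _ _ mc ml) (measurableU _ _ md mD).
  - exact: measurableU m1 m2.
  - by move=> x [[xi|xl] /not_orP[n1 n2]]; [left|right].
apply: (le_trans (measureU2 _ m1 m2)).
apply: leeD; last exact: IH.
apply: le_trans (gdisc_measure k i) _; rewrite EFinM.
by apply: lee_wpmul2l; rewrite ?lee_fin// -(@mu2_gcell R k i).
Qed.

Lemma gdiscs_packed k0 k K l : (k0 <= k)%N -> uniq l ->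
  (forall i, i \in l -> gcell k i `&` K = set0) -> packed k0 K (map (gdisc k) l).
Proof.
move=> k0k; elim: l K => [//|i l IH] K /= /andP[il ul] HK; split.
- have := HK i (mem_head _ _); rewrite -!subset0 => H x [xd xK]; apply: H; split=> //.
  exact: gdisc_gcell.
- exact: gdisc_hull.
apply: IH => // j jl.
have := HK j; rewrite inE jl orbT => /(_ isT) H.
apply/seteqP; split => x // -[xj [xK|xd]].
  by rewrite -H.
have := gdisc_gcell xd; rewrite /gcell/= => xi; move: xj; rewrite /gcell/= xi => ij.
by rewrite ij jl in il.
Qed.

Definition square_cells (k : nat) : seq (int * int) :=
  [seq (Posz m, Posz n) | m <- iota 0 (2 ^ k), n <- iota 0 (2 ^ k)].

Lemma square_cells_uniq k : uniq (square_cells k).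
Proof.
by apply: allpairs_uniq; rewrite ?iota_uniq// => -[a b] [c d] _ _ /= [-> ->].
Qed.

Lemma mesh_total k : (2 ^ k)%N%:R * mesh k = 2 * pi :> R.
Proof. by rewrite natrX /mesh; field; rewrite expf_neq0. Qed.

Lemma square_cellsP k (x : R * R) : S x <-> gindex k x \in square_cells k.
Proof.
have h0 := @mesh_gt0 R k.
have tot := mesh_total k.
have H (y : R) : 0 <= y < 2 * pi <-> exists2 m : nat, (m < 2 ^ k)%N & Num.floor (y / mesh k) = Posz m.
  split.
    move=> /andP[y0 y1].
    have : 0 <= Num.floor (y / mesh k) by rewrite floor_ge_int_tmp divr_ge0// ltW.
    case E : (Num.floor (y / mesh k)) => [m|//] _; exists m => //.
    have := floor_divP y (Posz m) h0; rewrite E eqxx => /esym/andP[a b].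
    by rewrite -(ltr_nat R) -(ltr_pM2r h0) tot; apply: le_lt_trans y1; exact: a.
  move=> [m mk /eqP]; rewrite floor_divP// => /andP[a b]; apply/andP; split.
    by apply: le_trans a; rewrite mulr_ge0// ltW.
  apply: (lt_le_trans b); rewrite -tot -[X in _ + X]mul1r -mulrDl ler_wpM2r ?(ltW h0)//.
  have : m.+1%:R <= (2 ^ k)%N%:R :> R by rewrite ler_nat.
  by rewrite -natr1.
rewrite fundamental_squareP; split.
  move=> [/H[m mk e1] /H[n nk e2]]; apply/allpairsP; exists (m, n) => /=.
  by rewrite !mem_iota !add0n; split=> //; rewrite /gindex e1 e2.
move=> /allpairsP[[m n] /= []]; rewrite !mem_iota !add0n /= => mk nk [e1 e2].
by split; apply/H; [exists m|exists n].
Qed.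

(** Cells of a fine grid that avoid [K] exhaust [S \ K] up to measure [eta], and placing a disc in
    each of them uncovers at most three quarters of their area. *)
Lemma packing_step k0 K (eta : R) : closed K -> 0 < eta -> exists D, packed k0 K D /\
  (mu2 (S `\` (K `|` discs D) : set plane) <= (3 / 4)%:E * mu2 (S `\` K : set plane) + eta%:E)%E.
Proof.
move=> cK eta0.
have oK : open (~` K) by exact: closed_openC.
have mS := @measurable_fundamental_square R.
have mK : measurable (K : set plane) by exact: closed_measurable2.
pose A k : set plane := S `&` ginner k (~` K).
have mA k : measurable (A k) by apply: measurableI => //; exact: measurable_ginner.
have UA : \bigcup_k A k = S `\` K.
  by rewrite /A -setI_bigcupr (ginner_bigcup oK).
have Acvg : (mu2 \o A) k @[k --> \oo] --> mu2 (S `\` K : set plane).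
  rewrite -UA; apply: nondecreasing_cvg_mu => //.
    by rewrite UA; exact: measurableD.
  by move=> k l kl; apply/subsetPset; apply: setIS; exact: ginner_mono.
have Sfin : (mu2 (S `\` K : set plane) < +oo)%E.
  apply: le_lt_trans (@mu2_square_fin R); apply: le_measure; rewrite ?inE//.
  exact: measurableD.
(* Continuity from below along the increasing sets [A k]; the level is also taken at least [k0] so
   that discs respect the cells of the step function. *)
have [k [k0k Hk]] : exists k, (k0 <= k)%N /\ (mu2 (S `\` K : set plane) <= mu2 (A k) + eta%:E)%E.
  have fS : mu2 (S `\` K : set plane) \is a fin_num by rewrite ge0_fin_numE.
  have fA k : mu2 (A k) \is a fin_num.
    rewrite ge0_fin_numE//; apply: le_lt_trans Sfin; apply: le_measure; rewrite ?inE//.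
      exact: measurableD.
    by move=> x [Sx Hx]; split=> //; exact: ginner_sub Hx.
  have Acvg' : fine (mu2 (A k)) @[k --> \oo] --> fine (mu2 (S `\` K : set plane)).
    by apply: fine_cvg; rewrite fineK.
  have lt_eta : fine (mu2 (S `\` K : set plane)) - eta < fine (mu2 (S `\` K : set plane)).
    by rewrite gtrBl.
  have [k1 _ H] := cvgr_gt _ Acvg' _ lt_eta.
  exists (maxn k0 k1); rewrite leq_maxl; split=> //.
  have /= := H (maxn k0 k1) (leq_maxr _ _).
  by rewrite ltrBlDr -(fineK fS) -(fineK (fA _)) -EFinD lee_fin => /ltW.
pose l := [seq i <- square_cells k | `[< gcell k i `&` K = set0 >]].
have ul : uniq l by apply: filter_uniq; exact: square_cells_uniq.
have El : gcells l k = A k.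
  apply/seteqP; split => x.
    move=> /mem_gcells; rewrite mem_filter => /andP[/asboolP H1 H2].
    split; first by apply/(square_cellsP k).
    by move=> y yx Ky; suff : (gcell k (gindex k x) `&` K) y by rewrite H1.
  move=> [Sx Hx]; apply/mem_gcells; rewrite mem_filter; apply/andP; split; last by apply/square_cellsP.
  by apply/asboolP/seteqP; split => y // -[yx Ky]; exact: (Hx y yx Ky).
exists (map (gdisc k) l); split.
  by apply: gdiscs_packed => // i; rewrite mem_filter => /andP[/asboolP].
have mD : measurable (discs (map (gdisc k) l) : set plane) by apply: closed_measurable2; exact: closed_discs.
have mAD : measurable (A k `\` discs (map (gdisc k) l) : set plane) by exact: measurableD.
have mSA : measurable (S `\` K `\` A k : set plane) by apply: measurableD => //; exact: measurableD.
apply: (@le_trans _ _ (mu2 ((A k `\` discs (map (gdisc k) l)) `|` (S `\` K `\` A k) : set plane))).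
  apply: le_measure; rewrite ?inE.
  - by apply: measurableD => //; exact: measurableU.
  - exact: measurableU.
  - move=> x [Sx /not_orP[nK nD]]; have [Ax|nA] := pselect (A k x); [by left|by right].
apply: (le_trans (measureU2 _ _ _)) => //.
apply: leeD.
  rewrite -El; apply: le_trans (gdiscs_measure k ul) _; rewrite El.
  apply: lee_wpmul2l; first by rewrite lee_fin.
  apply: le_measure; rewrite ?inE//; first exact: measurableD.
  by move=> x [Sx Hx]; split=> //; exact: ginner_sub Hx.
have AS : A k `<=` S `\` K by move=> x [Sx Hx]; split=> //; exact: ginner_sub Hx.
rewrite measureD//; [|exact: measurableD].
rewrite (setIidr AS) leeBlDl//.
rewrite ge0_fin_numE//; apply: le_lt_trans Sfin; apply: le_measure; rewrite ?inE//; exact: measurableD.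
Qed.

End Packing.

(** * Exhausting the square and building the filling flow *)

Section Filling.
Context {R : realType}.
Local Notation plane := (measurableTypeR R * measurableTypeR R)%type.
Local Notation S := (@fundamental_square R).
Implicit Types (K L : set (R * R)) (D : seq ((R * R) * R)).

Lemma geometric_small (M e : R) : 0 < e -> exists n, (3 / 4) ^+ n * M <= e.
Proof.
move=> e0; have H : (3 / 4 : R) ^+ n @[n --> \oo] --> (0 : R).
  by apply: cvg_expr; rewrite ger0_norm; lra.
have M0 : 0 < `|M| + 1 by rewrite ltr_wpDl.
have : 0 < e / (`|M| + 1) by rewrite divr_gt0.
move/cvgrPdist_le : H => H /H [n _ /(_ n (leqnn n))] /=.
rewrite sub0r normrN => h; exists n.
apply: le_trans (ler_norm _) _; rewrite normrM.
apply: (@le_trans _ _ (e / (`|M| + 1) * `|M|)); first by rewrite ler_wpM2r.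
by rewrite mulrAC ler_pdivrMr// ler_pM2l// lerDl.
Qed.

Lemma packing_exhaust k0 K (e : R) : closed K -> 0 < e -> exists D, packed k0 K D /\
  (mu2 (S `\` (K `|` discs D) : set plane) <= e%:E)%E.
Proof.
move=> cK e0.
have fS : @mu2 R S \is a fin_num by rewrite ge0_fin_numE ?mu2_square_fin.
pose M := fine (@mu2 R S).
have mS := @measurable_fundamental_square R.
have mK : measurable (K : set plane) by exact: closed_measurable2.
have H n : exists D, packed k0 K D /\
    (mu2 (S `\` (K `|` discs D) : set plane) <= ((3 / 4) ^+ n * M + e / 2)%:E)%E.
  elim: n => [|n [D [pD HD]]].
    exists [::]; split=> //=; rewrite setU0 expr0 mul1r.
    apply: (@le_trans _ _ (@mu2 R S)).
      by apply: le_measure; rewrite ?inE//; exact: measurableD.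
    by rewrite -(fineK fS) lee_fin lerDl divr_ge0// ltW.
  have cKD : closed (K `|` discs D) by apply: closedU => //; exact: closed_discs.
  (* The error [e / 2] reproduces itself: [3/4 * (e / 2) + e / 8 = e / 2]. *)
  have e8 : 0 < e / 8 by rewrite divr_gt0.
  have [D2 [pD2 HD2]] := packing_step k0 cKD e8.
  exists (D ++ D2); split; first exact: packed_cat.
  rewrite discs_cat setUA; apply: (le_trans HD2).
  apply: (@le_trans _ _ ((3 / 4)%:E * ((3 / 4) ^+ n * M + e / 2)%:E + (e / 8)%:E)%E).
    by apply: leeD => //; apply: lee_wpmul2l => //; rewrite lee_fin.
  by rewrite -EFinM -EFinD lee_fin exprS; lra.
have e2 : 0 < e / 2 by rewrite divr_gt0.
have [n Hn] := geometric_small M e2; have [D [pD HD]] := H n.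
exists D; split=> //; apply: (le_trans HD); rewrite lee_fin; lra.
Qed.

Lemma compact_disc (c : R * R) b : compact (disc c b).
Proof.
apply: (@subclosed_compact _ _ (`[c.1 - (b + 1), c.1 + (b + 1)]%classic `*`
  `[c.2 - (b + 1), c.2 + (b + 1)]%classic)).
- exact: closed_disc.
- by apply: compact_setX; exact: segment_compact.
move=> x Hx; have H : rsq c x <= b by exact: Hx.
rewrite /rsq in H.
have p1 : 0 <= (x.1 - c.1) * (x.1 - c.1) by rewrite -expr2 sqr_ge0.
have p2 : 0 <= (x.2 - c.2) * (x.2 - c.2) by rewrite -expr2 sqr_ge0.
have b0 : 0 <= b by lra.
have T (a : R) : a * a <= b -> `|a| <= b + 1.
  by move=> ab; apply: sq_le_abs; nra.
have h1 := T _ (le_trans (_ : _ <= _) H).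
have : `|x.1 - c.1| <= b + 1 by apply: T; lra.
have : `|x.2 - c.2| <= b + 1 by apply: T; lra.
rewrite !ler_norml => /andP[a1 a2] /andP[a3 a4].
by split; rewrite /= in_itv/=; apply/andP; split; lra.
Qed.

(** By compactness the squared distance from [c] attains its minimum on the part of [L] within
    [b + 1]; that minimum exceeds [b], and the midpoint is a valid larger squared radius. *)
Lemma disc_inflate (c : R * R) b L : closed L -> disc c b `&` L = set0 ->
  exists2 b', b < b' & disc c b' `&` L = set0.
Proof.
move=> cL dL.
have [E|/set0P N] := eqVneq (disc c (b + 1) `&` L) set0.
  by exists (b + 1) => //; rewrite ltrDl.
have cK : compact (disc c (b + 1) `&` L) by apply: compact_closedI => //; exact: compact_disc.
have cc : {within (disc c (b + 1) `&` L), continuous (rsq c)}.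
  by apply: continuous_subspaceT; exact: smooth_cont (smooth_rsq c).
have [p Kp H] := compact_EVT_min N cK cc.
have [pd pL] : (disc c (b + 1) `&` L) p by move: Kp; rewrite inE.
have bp : b < rsq c p.
  rewrite ltNge; apply/negP => pb.
  by have : (disc c b `&` L) p by []; rewrite dL.
have pb1 : rsq c p <= b + 1 by exact: pd.
exists ((b + rsq c p) / 2); first by lra.
apply/seteqP; split => // x [xd xL].
have xd' : rsq c x <= (b + rsq c p) / 2 by exact: xd.
have := H x; rewrite inE => /(_ _); apply: contraPP => _ HH.
have : rsq c p <= rsq c x by apply: HH; split=> //; suff : rsq c x <= b + 1 by []; lra.
lra.
Qed.

Lemma packed_disjoint k K D : packed k K D -> discs D `&` K = set0.
Proof.
elim: D K => [|d D IH] K /=; first by rewrite set0I.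
move=> [h1 h2 /IH]; rewrite setIUr setU_eq0 => -[hK _].
by rewrite setIUl h1 set0U.
Qed.

(** The relations among the discs do not involve the obstacle, which can thus be exchanged for any
    set that the discs avoid, in particular when one disc is enlarged. *)
Lemma packed_change k K K' D : packed k K D -> discs D `&` K' = set0 -> packed k K' D.
Proof.
elim: D K K' => [//|d D IH] K K' /= [h1 h2 h3].
rewrite setIUl setU_eq0 => -[e1 e2]; split=> //.
apply: (IH _ _ h3); rewrite setIUr e2 set0U.
by have := packed_disjoint h3; rewrite setIUr setU_eq0 => -[_ ->].
Qed.

(** An entry [(c, b, b')] records the squared radius [b] of the flat core and [b'] of the whole
    vortex. *)
Definition outer (D : seq ((R * R) * R * R)) := [seq (d.1.1, d.2) | d <- D].
Definition inner (D : seq ((R * R) * R * R)) := [seq d.1 | d <- D].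

(** Discs are enlarged one at a time; those already enlarged have become part of the obstacle
    [K]. *)
Lemma packed_inflate k K D : closed K -> packed k K D -> exists E,
  [/\ inner E = D, forall d, d \in E -> d.1.2 < d.2 & packed k K (outer E)].
Proof.
elim: D K => [|[c b] D IH] K cK /=; first by exists [::].
move=> [h1 h2 h3].
have cd : closed (discs D) by exact: closed_discs.
have chull : closed (~` hull k c) by apply: open_closedC; exact: open_interior.
have h4 := packed_disjoint h3; move: h4; rewrite setIUr setU_eq0 => -[h4 h5].
(* The enlarged disc must avoid the obstacle, the discs still to come and the outside of its own
   cell. *)
have dL : disc c b `&` (K `|` discs D `|` ~` hull k c) = set0.
  rewrite !setIUr h1 set0U (setIC _ (discs D)) h5 set0U.
  by apply/seteqP; split => // x [/h2].
have [b' bb' H] := disc_inflate (closedU (closedU cK cd) chull) dL.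
move: H; rewrite !setIUr !setU_eq0 => -[[k1 k2] k3].
have cK' : closed (K `|` disc c b') by apply: closedU => //; exact: closed_disc.
have pD : packed k (K `|` disc c b') D.
  by apply: (packed_change h3); rewrite setIUr h4 set0U setIC.
have [E [E1 E2 E3]] := IH _ cK' pD.
exists ((c, b, b') :: E); split.
- by rewrite /inner /= -E1.
- by move=> d; rewrite inE => /orP[/eqP ->//|]; exact: E2.
split=> //= x xd; apply: contrapT => nh.
by have : (disc c b' `&` ~` hull k c) x by []; rewrite k3.
Qed.

Lemma inner_sub_outer E : (forall d, d \in E -> d.1.2 < d.2) ->
  discs (inner E) `<=` discs (outer E).
Proof.
elim: E => [|d E IH] H; first by [].
move=> x /= [xd|xE]; [left|right].
  have := H d (mem_head _ _) => /ltW; exact: le_trans.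
by apply: IH xE => e eE; apply: H; rewrite inE eE orbT.
Qed.

(** Each disc receives a vortex of amplitude [g c], which is the value of [g] on the whole disc.
    Disjoint supports keep the sum within the bound of [g]. *)
Lemma packed_eddy k K E (g : R * R -> R) M :
  (forall x y, gindex k x = gindex k y -> g x = g y) -> (forall x, `|g x| <= M) ->
  (forall d, d \in E -> d.1.2 < d.2) -> packed k K (outer E) ->
  exists F p, [/\ eddy (discs (outer E)) F p,
    forall x, discs (inner E) x -> F x = g x & forall x, `|F x| <= M].
Proof.
move=> gk gM; have M0 : 0 <= M by apply: le_trans (gM 0).
elim: E K => [|[[c b] b'] E IH] K HE /=.
  move=> _; exists (fun=> 0), (fun=> 0); split=> //; first exact: eddy0.
  by move=> x; rewrite normr0.
move=> [h1 h2 h3].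
have HE' d : d \in E -> d.1.2 < d.2 by move=> dE; apply: HE; rewrite inE dE orbT.
have bb' : b < b' by exact: (HE (c, b, b') (mem_head _ _)).
have [F [p [eF Fg FM]]] := IH _ HE' h3.
have [G [H [sG sH G1 GH0 [G01 _ _ dH]]]] := cutoff_exists bb'.
have := packed_disjoint h3; rewrite setIUr setU_eq0 => -[_ dd].
have eV := eddy_vortex c (g c) sG sH GH0 dH.
have FA : forall x, ~ discs (outer E) x -> F x = 0 by case: eF.
have off x : disc c b' x -> F x = 0.
  by move=> xd; apply: FA => xE; have : (discs (outer E) `&` disc c b') x by []; rewrite dd.
have Goff x : ~ disc c b' x -> G (rsq c x) = 0.
  by move=> /negP; rewrite -ltNge => /ltW /GH0[].
exists (fun x => g c * G (rsq c x) + F x), (fun x => g c ^+ 2 / 2 * H (rsq c x) + p x).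
split.
- by apply: eddyU => //; rewrite setIC.
- move=> x [xd|xE].
    have xd' : rsq c x <= b by exact: xd.
    have xd2 : disc c b' x by suff : rsq c x <= b' by []; lra.
    rewrite G1// mulr1 off// addr0; apply: gk.
    by have /h2 /nbhs_singleton := xd2.
  have nxd : ~ disc c b' x.
    move=> xd; have xE' := inner_sub_outer HE' xE.
    by have : (discs (outer E) `&` disc c b') x by []; rewrite dd.
  by rewrite Goff// mulr0 add0r; exact: Fg.
- move=> x; have [xd|nxd] := pselect (disc c b' x).
    rewrite off// addr0 normrM; have /andP[a1 a2] := G01 (rsq c x).
    by rewrite (ger0_norm a1); apply: le_trans (gM c); rewrite ler_piMr.
  by rewrite Goff// mulr0 add0r.
Qed.

(** The exceptional set is what the packing leaves uncovered; on the discs of the packing, now flat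
    cores of enlarged ones, the stream function equals [g]. *)
Lemma fill k (g : R * R -> R) M K (e : R) :
  (forall x y, gindex k x = gindex k y -> g x = g y) -> (forall x, `|g x| <= M) ->
  closed K -> 0 < e -> exists A F p (B : set plane),
  [/\ eddy A F p, A `&` K = set0, forall x, `|F x| <= M,
      measurable B /\ (mu2 B <= e%:E)%E &
      forall x, S x -> ~ K x -> ~ B x -> F x = g x].
Proof.
move=> gk gM cK e0; have [D [pD HD]] := packing_exhaust k cK e0.
have [E [E1 E2 E3]] := packed_inflate cK pD.
have [F [p [eF Fg FM]]] := packed_eddy gk gM E2 E3.
exists (discs (outer E)), F, p, (S `\` (K `|` discs D)); split=> //.
- exact: packed_disjoint E3.
- split=> //; apply: measurableD; first exact: measurable_fundamental_square.
  by apply: closed_measurable2; apply: closedU => //; exact: closed_discs.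
move=> x Sx nK nB; apply: Fg; rewrite E1; apply: contrapT => nD; apply: nB.
by split=> // -[].
Qed.

End Filling.

(** * Step functions and density *)

Section StepApproximation.
Context {R : realType}.
Local Notation plane := (measurableTypeR R * measurableTypeR R)%type.
Local Notation S := (@fundamental_square R).
Implicit Types (E F : set plane).

Definition gridset k (C : set plane) := forall x y, gindex k x = gindex k y -> C x -> C y.

(** Approximation in measure by unions of grid cells. Measurable sets with this property form a
    sigma-algebra containing the open sets. *)
Definition approximable E := forall e : R, 0 < e -> exists k C (B : set plane),
  [/\ gridset k C, measurable B, (mu2 B <= e%:E)%E &
      forall x, S x -> ~ B x -> (E x <-> C x)].

Lemma gridset_mono k l C : (k <= l)%N -> gridset k C -> gridset l C.
Proof. by move=> kl gC x y /(gindex_coarsen kl); exact: gC. Qed.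

Lemma measure_tail (F : nat -> set plane) E (e : R) : measurable E ->
  (forall n, measurable (F n)) -> (forall n m, (n <= m)%N -> F n `<=` F m) ->
  \bigcup_n F n = E -> 0 < e -> exists n, (mu2 (S `&` (E `\` F n)) <= e%:E)%E.
Proof.
move=> mE mF nF UF e0.
have mS := @measurable_fundamental_square R.
have mSF n : measurable (S `&` F n) by exact: measurableI.
have USF : \bigcup_n (S `&` F n) = S `&` E by rewrite -setI_bigcupr UF.
have cv : (mu2 \o (fun n => S `&` F n)) k @[k --> \oo] --> mu2 (S `&` E).
  rewrite -USF; apply: nondecreasing_cvg_mu => //.
    by rewrite USF; exact: measurableI.
  by move=> k l kl; apply/subsetPset; apply: setIS; exact: nF.
have fin A : measurable A -> A `<=` S -> mu2 A \is a fin_num.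
  move=> mA AS; rewrite ge0_fin_numE//.
  by apply: le_lt_trans (@mu2_square_fin R); apply: le_measure; rewrite ?inE.
have f1 := fin _ (measurableI _ _ mS mE) (@subIsetl _ S E).
have f2 n := fin _ (mSF n) (@subIsetl _ S (F n)).
have cv' : fine (mu2 (S `&` F k)) @[k --> \oo] --> fine (mu2 (S `&` E)).
  by apply: fine_cvg; rewrite fineK.
have lt_e : fine (mu2 (S `&` E)) - e < fine (mu2 (S `&` E)) by rewrite gtrBl.
have [n _ H] := cvgr_gt _ cv' _ lt_e.
exists n; have /= := H n (leqnn n); rewrite ltrBlDr => Hn.
have -> : S `&` (E `\` F n) = (S `&` E) `\` (S `&` F n).
  apply/seteqP; split => x; first by move=> [Sx [Ex nF']]; split => // -[].
  by move=> [[Sx Ex] nF']; split=> //; split=> // Fx; exact: nF'.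
have sub : S `&` F n `<=` S `&` E.
  by apply: setIS => x Fx; rewrite -UF; exists n.
have -> : @mu2 R ((S `&` E) `\` (S `&` F n)) = (@mu2 R (S `&` E) - @mu2 R (S `&` F n))%E.
  rewrite measureD ?(setIidr sub)//; first exact: measurableI.
  by rewrite -ge0_fin_numE.
by rewrite -(fineK f1) -(fineK (f2 n)) -EFinB lee_fin lerBlDl ltW// addrC.
Qed.

Lemma approximable_open (A : set (R * R)) : open A -> approximable A.
Proof.
move=> oA e e0.
have [k Hk] := measure_tail (open_measurable2 oA) (fun k => measurable_ginner k A)
  (fun k l => @ginner_mono R A k l) (ginner_bigcup oA) e0.
exists k, (ginner k A), (S `&` (A `\` ginner k A)); split=> //.
- by move=> x y xy Hx z zy; apply: Hx; rewrite zy xy.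
- apply: measurableI; first exact: measurable_fundamental_square.
  by apply: measurableD; [exact: open_measurable2|exact: measurable_ginner].
- move=> x Sx nB; split; last exact: ginner_sub.
  by move=> Ax; apply: contrapT => nI; apply: nB.
Qed.

Lemma approximable_setC E : approximable E -> approximable (~` E).
Proof.
move=> aE e e0; have [k [C [B [gC mB muB H]]]] := aE e e0.
exists k, (~` C), B; split=> //.
- by move=> x y xy nC Cy; apply: nC; exact: gC (esym xy) Cy.
- by move=> x Sx nB; have [h1 h2] := H x Sx nB; split=> n ?; apply: n; [exact: h2|exact: h1].
Qed.

Lemma approximable_setU E F : approximable E -> approximable F -> approximable (E `|` F).
Proof.
move=> aE aF e e0; have e2 : 0 < e / 2 by rewrite divr_gt0.
have [k [C [B [gC mB muB H]]]] := aE _ e2.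
have [k' [C' [B' [gC' mB' muB' H']]]] := aF _ e2.
exists (maxn k k'), (C `|` C'), (B `|` B'); split.
- move=> x y xy [Cx|Cx]; [left|right].
    exact: (gridset_mono (leq_maxl k k') gC xy Cx).
  exact: (gridset_mono (leq_maxr k k') gC' xy Cx).
- exact: measurableU.
- apply: (le_trans (measureU2 _ mB mB')).
  by rewrite (splitr e) EFinD; apply: leeD.
- move=> x Sx /not_orP[n1 n2]; have [h1 h2] := H x Sx n1; have [h3 h4] := H' x Sx n2.
  by split=> -[?|?]; [left; exact: h1|right; exact: h3|left; exact: h2|right; exact: h4].
Qed.

Lemma approximable_set0 : approximable set0.
Proof. by apply: approximable_open; exact: open0. Qed.

(** Half of the tolerance pays for truncating to a finite union, by continuity of the finite measure
    on [S]; the other half for approximating that union. *)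
Lemma approximable_bigcup (F : nat -> set plane) : (forall n, measurable (F n)) ->
  (forall n, approximable (F n)) -> approximable (\bigcup_n F n).
Proof.
move=> mF aF e e0; have e2 : 0 < e / 2 by rewrite divr_gt0.
pose G n := \big[setU/set0]_(i < n) F i.
have mG n : measurable (G n) by apply: bigsetU_measurable.
have aG n : approximable (G n).
  rewrite /G; elim: n => [|n IH]; first by rewrite big_ord0; exact: approximable_set0.
  by rewrite big_ord_recr; exact: approximable_setU.
have GE n x : G n x <-> exists2 i, (i < n)%N & F i x.
  rewrite /G -bigcup_mkord; split=> -[i]; first by move=> /= ? ?; exists i.
  by move=> ? ?; exists i.
have nG n m : (n <= m)%N -> G n `<=` G m.
  by move=> nm x /GE[i ilt Fx]; apply/GE; exists i => //; exact: leq_trans nm.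
have UG : \bigcup_n G n = \bigcup_n F n.
  apply/seteqP; split => x [n _].
    by move=> /GE[i _ Fx]; exists i.
  by move=> Fx; exists n.+1 => //; apply/GE; exists n.
have mU : measurable (\bigcup_n F n) by exact: bigcupT_measurable.
have [n Hn] := measure_tail mU mG nG UG e2.
have [k [C [B [gC mB muB H]]]] := aG n _ e2.
have mT : measurable (S `&` ((\bigcup_n F n) `\` G n)).
  by apply: measurableI; [exact: measurable_fundamental_square|exact: measurableD].
exists k, C, (B `|` (S `&` ((\bigcup_n F n) `\` G n))); split=> //.
- exact: measurableU.
- apply: (le_trans (measureU2 _ mB mT)).
  by rewrite (splitr e) EFinD; apply: leeD.
- move=> x Sx /not_orP[n1 n2]; have [h1 h2] := H x Sx n1; split.
    move=> Ux; apply: h1; apply: contrapT => nGx; apply: n2; by [].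
  by move=> /h2 Gx; rewrite -UG; exists n.
Qed.

Definition approx_class := [set E : set plane | measurable E /\ approximable E].

Lemma approx_class_sigma : sigma_algebra setT approx_class.
Proof.
split.
- by split; [exact: measurable0|exact: approximable_set0].
- move=> E [mE aE]; rewrite setTD; split; [exact: measurableC|exact: approximable_setC].
- move=> F HF; split; first by apply: bigcupT_measurable => n; have [] := HF n.
  by apply: approximable_bigcup => n; have [] := HF n.
Qed.

(** The sets with preimage in [approx_class] form a sigma-algebra on the line that contains the open
    half-lines, hence all Borel sets. *)
Lemma approx_preimage (h : R * R -> R) (A : set R) : continuous h ->
  measurable (A : set (measurableTypeR R)) -> approx_class (h @^-1` A).
Proof.
move=> ch mA.
have H : sigma_algebra setT [set A : set R | approx_class (h @^-1` A)].
  have [c0 cC cU] := approx_class_sigma; split.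
  - by rewrite /= preimage_set0.
  - move=> B /= /cC; by rewrite !setTD preimage_setC.
  - move=> F HF /=; rewrite preimage_bigcup; exact: cU.
have := measurable_realfun.RGenOInfty.measurableE R.
move=> /(f_equal (fun P : set (set R) => P A)) => Q.
have mG : (<<s @measurable_realfun.RGenOInfty.G R >>) A by exact: (@eq_ind Prop _ id mA _ Q).
apply: (smallest_sub H) mG => B [x ->] /=.
have op : open (h @^-1` `]x, +oo[%classic).
  by move/continuousP : ch; apply; exact: interval_open.
by split; [exact: open_measurable2|exact: approximable_open].
Qed.

(** The product sigma-algebra is generated by rectangles, and a rectangle is the intersection of
    preimages under the two continuous coordinates. *)
Lemma measurable_approximable E : measurable E -> approximable E.
Proof.
rewrite measurable_prod_measurableType => mE.
suff : approx_class E by case.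
apply: (smallest_sub approx_class_sigma) mE => _ [A mA [B mB <-]].
have [m1 a1] := @approx_preimage fst A (fun x => cvg_fst) mA.
have [m2 a2] := @approx_preimage snd B (fun x => cvg_snd) mB.
have -> : A `*` B = (fst @^-1` A) `&` (snd @^-1` B) by [].
split; first exact: measurableI.
rewrite -(setCK (_ `&` _)) setCI; apply: approximable_setC.
by apply: approximable_setU; exact: approximable_setC.
Qed.

End StepApproximation.

Section StepFunctions.
Context {R : realType}.
Local Notation plane := (measurableTypeR R * measurableTypeR R)%type.
Local Notation S := (@fundamental_square R).

(** The sum counts the thresholds [h, 2h, ..., nh] passed by [y], so [h * s] is [y] rounded down to
    a multiple of [h] and capped at [n h]. *)
Lemma layer_sum (h y : R) n : 0 < h -> 0 <= y ->
  let s := (\sum_(j < n) nat_of_bool (j.+1%:R * h <= y)%R)%N in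
  [/\ (s <= n)%N, h * s%:R <= y & s = n \/ y - h <= h * s%:R].
Proof.
move=> h0 y0; elim: n => [|n [IH1 IH2 IH3]] /=.
  by rewrite big_ord0 mulr0; split => //; left.
rewrite big_ord_recr /=; move: IH1 IH2 IH3.
set s := (\sum_(_ < _) _)%N => IH1 IH2 IH3.
case: leP => hy.
  rewrite addn1; split=> //.
    by apply: le_trans hy; rewrite mulrC ler_pM2r// ler_nat.
  case: IH3 => [->|IH3]; first by left.
  by right; apply: (le_trans IH3); rewrite ler_pM2l// ler_nat.
rewrite addn0; split=> //; first exact: leqW.
right; case: IH3 => // e; rewrite e lerBlDr; apply: (le_trans (ltW hy)).
by rewrite -natr1 mulrDl mul1r mulrC.
Qed.

Lemma step_approx (f : plane -> R) (M e : R) : measurable_fun setT f ->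
  0 < M -> (forall x, `|f x| <= M) -> 0 < e ->
  exists k (g : R * R -> R) (B : set plane),
  [/\ forall x y, gindex k x = gindex k y -> g x = g y, forall x, `|g x| <= M,
      measurable B, (mu2 B <= e%:E)%E &
      forall x, S x -> ~ B x -> `|f x - g x| <= e].
Proof.
move=> mf M0 fM e0.
(* The values of [f + M] lie in [[0, 2M]], which is cut into [n] layers of height [h <= e]. *)
pose n := (Num.truncn (2 * M / e)).+1.
have n0 : 0 < n%:R :> R by rewrite ltr0n.
pose h := 2 * M / n%:R.
have h0 : 0 < h by rewrite divr_gt0// mulr_gt0.
have he : h <= e.
  rewrite /h ler_pdivrMr// [e * _]mulrC -ler_pdivrMr//; apply: ltW; exact: truncnS_gt.
pose E (j : 'I_n) := [set x : plane | j.+1%:R * h <= f x + M].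
have mE j : measurable (E j).
  have -> : E j = f @^-1` `[j.+1%:R * h - M, +oo[%classic.
    by apply/seteqP; split => x /=; rewrite in_itv/= andbT lerBlDr.
  by rewrite -[X in measurable X]setTI; apply: mf => //.
(* Each of the [n] level sets may be wrong on measure [e / n], so that together they are wrong on
   measure at most [e]. *)
have en : 0 < e / n%:R by rewrite divr_gt0.
have /choice[D HD] : forall j : 'I_n, exists D : nat * (set plane * set plane),
    [/\ gridset D.1 D.2.1, measurable D.2.2, (mu2 D.2.2 <= (e / n%:R)%:E)%E &
      forall x, S x -> ~ D.2.2 x -> (E j x <-> D.2.1 x)].
  move=> j; have [k [C [B H]]] := measurable_approximable (mE j) en.
  by exists (k, (C, B)).
pose K := (\max_(j < n) (D j).1)%N.
pose g (x : R * R) : R := h * (\sum_(j < n) `[< (D j).2.1 x >])%N%:R - M.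
exists K, g, (\big[setU/set0]_(j < n) (D j).2.2); split.
- move=> x y xy; rewrite /g; congr (_ * _%:R - _).
  apply: eq_bigr => j _; have [gC _ _ _] := HD j.
  have gC' := gridset_mono (leq_bigmax (F := fun j => (D j).1) j) gC.
  by congr nat_of_bool; apply: asbool_equiv_eq; split; apply: gC'.
- move=> x; rewrite ler_norml; apply/andP; split.
    by rewrite lerBrDl subrr mulr_ge0// ltW.
  rewrite lerBlDr; apply: (@le_trans _ _ (h * n%:R)); last first.
    by rewrite /h divfK ?gt_eqF//; lra.
  rewrite ler_pM2l// ler_nat; apply: (leq_trans (leq_sum _ (fun i _ => leq_b1 _))).
  by rewrite sum1_card card_ord.
- by apply: bigsetU_measurable => j _; have [] := HD j.
- have Be : e%:E = (\sum_(j < n) (e / n%:R))%:E.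
    by rewrite sumr_const card_ord -(mulr_natr (e / n%:R)) divfK// gt_eqF.
  rewrite Be.
  suff [] : measurable (\big[setU/set0]_(j < n) (D j).2.2) /\
    (mu2 (\big[setU/set0]_(j < n) (D j).2.2) <= (\sum_(j < n) (e / n%:R))%:E)%E by [].
  apply: (big_ind2 (fun (A : set plane) (r : R) => measurable A /\ (mu2 A <= r%:E)%E)).
  - by rewrite measure0.
  - move=> A r A' r' [mA Ar] [mA' Ar']; split; first exact: measurableU.
    by rewrite EFinD; apply: (le_trans (measureU2 _ mA mA')); exact: leeD.
  - by move=> j _; have [] := HD j.
- move=> x Sx nB.
  have Ex j : `[< (D j).2.1 x >] = (j.+1%:R * h <= f x + M).
    have [_ _ _ Hj] := HD j; have nBj : ~ (D j).2.2 x.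
      by move=> Bx; apply: nB; rewrite (bigD1 j)//=; left.
    have [H1 H2] := Hj x Sx nBj.
    by apply/asboolP/idP => [/H2|/H1].
  rewrite /g (eq_bigr (fun j : 'I_n => nat_of_bool (j.+1%:R * h <= f x + M))); last by move=> j _; rewrite Ex.
  have := fM x; rewrite ler_norml => /andP[fM1 fM2].
  have y0 : 0 <= f x + M by rewrite -lerBlDr sub0r.
  have := @layer_sum h _ n h0 y0 => /=.
  set s := (\sum_(_ < _) _)%N => -[_ H1 H2].
  have H3 : f x + M - h <= h * s%:R.
    case: H2 => // ->; rewrite /h divfK ?gt_eqF// lerBlDr.
    apply: (@le_trans _ _ (2 * M)); first by rewrite (_ : 2 * M = M + M) ?lerD2r//; ring.
    by rewrite lerDl ltW.
  rewrite ler_norml; apply/andP; split.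
    apply: (@le_trans _ _ 0); first by rewrite oppr_le0 ltW.
    by rewrite opprB addrA subr_ge0.
  by apply: le_trans he; rewrite opprB addrA lerBlDl -lerBlDr.
Qed.

End StepFunctions.

(** * Truncation and integral bounds *)

Section LpEstimates.
Context d (T : measurableType d) (R : realType).
Context (mu : {measure set T -> \bar R}).
Implicit Types (f h : T -> R).

Lemma Lnorm_le (r : R) f (a : R) : 1 <= r -> 0 <= a ->
  (\int[mu]_x (`|f x| `^ r)%:E <= (a `^ r)%:E)%E ->
  (Lnorm mu r%:E (EFin \o f) <= a%:E)%E.
Proof.
move=> r1 a0 H; have r0 : 0 < r by apply: lt_le_trans r1.
rewrite unlock /Lnorm.
have -> : (\int[mu]_x (`|(EFin \o f) x| `^ r) = \int[mu]_x (`|f x| `^ r)%:E)%E by [].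
have -> : (a%:E = ((a `^ r)%:E `^ r^-1))%E.
  by rewrite poweR_EFin -powRrM divff ?gt_eqF// powRr1.
apply: gt0_ler_poweR => //.
- by rewrite invr_ge0 ltW.
- by rewrite in_itv /= leey andbT; apply: integral_ge0 => x _; rewrite lee_fin powR_ge0.
- by rewrite in_itv /= leey andbT lee_fin powR_ge0.
Qed.

Definition clamp (m y : R) : R := Num.max (- m) (Num.min m y).

Lemma clamp_abs m y : 0 <= m -> `|clamp m y| <= m.
Proof.
move=> m0; rewrite ler_norml /clamp le_max lexx /= ge_max.
by rewrite (le_trans _ m0) ?oppr_le0//= ge_min lexx.
Qed.

Lemma clamp_id m y : `|y| <= m -> clamp m y = y.
Proof.
rewrite ler_norml => /andP[h1 h2]; rewrite /clamp min_r// max_r//.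
Qed.

Lemma clamp_dist m y : 0 <= m -> `|clamp m y - y| <= `|y|.
Proof.
move=> m0; have [h|h] := leP `|y| m; first by rewrite clamp_id// subrr normr0.
rewrite /clamp; have [y0|y0] := leP 0 y.
  move: h; rewrite ger0_norm// => h.
  have -> : Num.min m y = m by rewrite min_l// ltW.
  have -> : Num.max (- m) m = m by rewrite max_r//; lra.
  rewrite ler0_norm; lra.
move: h; rewrite ltr0_norm// => h.
have -> : Num.min m y = y by rewrite min_r//; lra.
have -> : Num.max (- m) y = - m by rewrite max_l//; lra.
by rewrite ger0_norm; lra.
Qed.

Lemma measurable_clamp m f : measurable_fun setT f ->
  measurable_fun setT (fun x => clamp m (f x)).
Proof.
move=> mf; apply: measurable_maxr; first exact: measurable_cst.
by apply: measurable_minr => //; exact: measurable_cst.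
Qed.

Lemma measurable_powR_norm (r : R) f : measurable_fun setT f ->
  measurable_fun setT (fun x => (`|f x| `^ r)%:E).
Proof.
move=> mf; apply/measurable_EFinP.
apply: (measurableT_comp (measurable_powR r)).
exact: measurableT_comp.
Qed.

(** Dominated convergence: the truncation error vanishes at each point once the level exceeds
    [|f x|], and is dominated by [|f|^r]. *)
Lemma Lp_clamp (r a : R) f : 1 <= r -> 0 < a -> measurable_fun setT f ->
  mu.-integrable setT (fun x => (`|f x| `^ r)%:E) ->
  exists2 m : R, 0 < m & (\int[mu]_x (`|clamp m (f x) - f x| `^ r)%:E <= a%:E)%E.
Proof.
move=> r1 a0 mf If; have r0 : 0 < r by apply: lt_le_trans r1.
pose F (n : nat) x := (`|clamp n.+1%:R (f x) - f x| `^ r)%:E.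
have mF n : measurable_fun setT (F n).
  by apply: measurable_powR_norm; apply: measurable_funB => //; exact: measurable_clamp.
have [] := @dominated_convergence _ _ _ mu setT measurableT F (cst 0%E) _ mF (measurable_cst _) _ If.
- apply: nearW => x _; apply: cvg_near_cst.
  exists (Num.truncn `|f x|) => // n /= hn; rewrite /F clamp_id ?subrr ?normr0 ?powR0 ?gt_eqF//.
  apply: ltW; apply: (lt_le_trans (truncnS_gt _)); by rewrite ler_nat.
- apply: nearW => x n _ /=; rewrite ger0_norm ?powR_ge0// lee_fin.
  apply: ge0_ler_powR; rewrite ?nnegrE ?normr_ge0//; first exact: ltW.
  exact: clamp_dist.
move=> _ /= cv _.
have cv' : (\int[mu]_x F n x)%E @[n --> \oo] --> 0%E.
  apply: cvg_trans cv; apply: near_eq_cvg; apply: nearW => n.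
  by apply: eq_integral => x _ /=; rewrite subr0 ger0_norm// powR_ge0.
have /fine_cvgP[finF /cvgrPdist_le /(_ _ a0) dF] := cv'.
near \oo => n.
exists n.+1%:R => //.
have fn : (\int[mu]_x F n x)%E \is a fin_num by near: n.
have dn : `|0 - fine (\int[mu]_x F n x)%E| <= a by near: n.
rewrite -(fineK fn) lee_fin; apply: le_trans dn.
by rewrite sub0r normrN ler_norm.
Unshelve. all: end_near.
Qed.

(** Off [B] one has [|h|^r <= e^r <= e], which uses [e <= 1] and [1 <= r]; on [B], of measure at
    most [e], the uniform bound [K] is used. *)
Lemma Lp_small (r e K V : R) h (B : set T) : 1 <= r -> 0 <= e -> e <= 1 -> 0 <= K ->
  (mu setT <= V%:E)%E -> measurable B -> (mu B <= e%:E)%E -> measurable_fun setT h ->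
  (forall x, `|h x| <= K) -> (forall x, ~ B x -> `|h x| <= e) ->
  (\int[mu]_x (`|h x| `^ r)%:E <= (e * V + K `^ r * e)%:E)%E.
Proof.
move=> r1 e0 e1 K0 muT mB muB mh hK he; have r0 : 0 < r by apply: lt_le_trans r1.
apply: (@le_trans _ _ (\int[mu]_x ((e%:E + (K `^ r)%:E * (\1_B x)%:E)))%E).
  apply: (ge0_le_integral mu measurableT) (measurable_powR_norm r mh) _ _.
  - by move=> x _; rewrite lee_fin powR_ge0.
  - apply: (emeasurable_funD (measurable_cst _) (emeasurable_funM (measurable_cst _) _)).
    by apply/measurable_EFinP; exact: measurable_indic.
  move=> x _; rewrite indicE -EFinM -EFinD lee_fin.
  have [Bx|/negP Bx] := boolP (x \in B).
    rewrite mulr1; apply: (@le_trans _ _ (K `^ r)); last by rewrite lerDr.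
    by apply: ge0_ler_powR; rewrite ?nnegrE// ltW.
  rewrite mulr0 addr0; apply: (@le_trans _ _ (e `^ r)).
    apply: (ge0_ler_powR (ltW r0)); rewrite ?nnegrE//; apply: he => Bx'; apply: Bx.
    exact: mem_set.
  have [->|en0] := eqVneq e 0; first by rewrite powR0 ?gt_eqF.
  by apply: ge1r_powR => //; rewrite e1 andbT lt_neqAle eq_sym en0.
have mI : measurable_fun setT (fun x => (\1_B x)%:E : \bar R).
  by apply/measurable_EFinP; exact: measurable_indic.
rewrite ge0_integralD//; [|by move=> x _; rewrite mule_ge0// lee_fin powR_ge0
  |exact: (emeasurable_funM (measurable_cst _) mI)].
rewrite integral_cst// ge0_integralZl//; last by rewrite lee_fin powR_ge0.
rewrite integral_indic// setIT EFinD !EFinM; apply: leeD; apply: lee_wpmul2l => //.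
by rewrite lee_fin powR_ge0.
Qed.

End LpEstimates.

(** * Weak-* convergence from bounds off small sets *)

Section WeakConvergence.
Context d (T : measurableType d) (R : realType).
Context (mu : {measure set T -> \bar R}).
Implicit Types (f g h k : T -> R).

Lemma integrable_bounded_mul h k (K : R) : mu.-integrable setT (EFin \o h) ->
  measurable_fun setT k -> (forall x, `|k x| <= K) ->
  mu.-integrable setT (fun x => (k x * h x)%:E).
Proof.
move=> Ih mk kK; have mh : measurable_fun setT h.
  by have := measurable_int _ Ih; move/measurable_EFinP.
apply: (le_integrable measurableT) (integrableZl measurableT K Ih).
  by apply/measurable_EFinP; exact: measurable_funM.
move=> x _ /=; rewrite lee_fin !normrM; apply: ler_wpM2r => //.
by apply: (le_trans (kK x)); exact: ler_norm.
Qed.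

Lemma weak_bound h k (K e I : R) (B : set T) : mu.-integrable setT (EFin \o h) ->
  measurable_fun setT k -> (forall x, `|k x| <= K) -> measurable B -> 0 <= e ->
  (forall x, ~ B x -> `|k x| <= e) -> (\int[mu]_x `|(h x)%:E| = I%:E)%E ->
  (`|\int[mu]_x (k x * h x)%:E| <= (e * I + K * (\int[mu]_(x in B) `|h x|)%R)%:E)%E.
Proof.
move=> Ih mk kK mB e0 ke hI; have mh : measurable_fun setT h.
  by have := measurable_int _ Ih; move/measurable_EFinP.
have K0 (x : T) : 0 <= K.
  exact: le_trans (normr_ge0 (k x)) (kK x).
have mkh : measurable_fun setT (fun x => (k x * h x)%:E).
  by apply/measurable_EFinP; exact: measurable_funM.
have mnh : measurable_fun setT (fun x => `|(h x)%:E|%E).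
  by apply: measurableT_comp => //; apply/measurable_EFinP.
have mI : measurable_fun setT (fun x => (\1_B x)%:E : \bar R).
  by apply/measurable_EFinP; exact: measurable_indic.
have mIh : measurable_fun setT (fun x => ((\1_B x)%:E * `|(h x)%:E|)%E).
  exact: emeasurable_funM mI mnh.
apply: (le_trans (le_abse_integral _ measurableT mkh)).
apply: (@le_trans _ _ (\int[mu]_x (e%:E * `|(h x)%:E| + K%:E * ((\1_B x)%:E * `|(h x)%:E|)))%E).
  apply: (ge0_le_integral mu measurableT).
  - by [].
  - exact: measurableT_comp.
  - apply: emeasurable_funD; exact: (emeasurable_funM (measurable_cst _)).
  move=> x _; rewrite indicE /= -!EFinM -EFinD lee_fin normrM.
  have [Bx|/negP Bx] := boolP (x \in B).
    rewrite mul1r; apply: (@le_trans _ _ (K * `|h x|)); first exact: ler_wpM2r.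
    by rewrite lerDr mulr_ge0.
  rewrite mul0r mulr0 addr0; apply: ler_wpM2r => //; apply: ke => Bx'; apply: Bx.
  exact: mem_set.
(* Nonnegativity of [K] is read off from a point of [T]; if [T] is empty all integrals vanish. *)
have [x0|noT] := pselect (exists x : T, True); last first.
  have T0 : [set: T] = set0.
    by apply/seteqP; split=> // x _; apply: noT; exists x.
  have B0 : B = set0 by apply/seteqP; split=> // x _; apply: noT; exists x.
  move: hI; rewrite T0 B0 integral_set0 => -[<-].
  by rewrite integral_set0 Rintegral_set0 !mulr0 addr0.
have {x0}K0 : 0 <= K by case: x0 => x _; exact: K0 x.
have p1 x : setT x -> (0 <= e%:E * `|(h x)%:E|)%E by move=> _; rewrite mule_ge0// lee_fin.
have p2 x : setT x -> (0 <= (\1_B x)%:E * `|(h x)%:E|)%E.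
  by move=> _; rewrite mule_ge0// lee_fin.
have p3 x : setT x -> (0 <= K%:E * ((\1_B x)%:E * `|(h x)%:E|))%E.
  by move=> Tx; apply: mule_ge0 (p2 x Tx); rewrite lee_fin.
rewrite (ge0_integralD mu measurableT p1 (emeasurable_funM (measurable_cst _) mnh)
  p3 (emeasurable_funM (measurable_cst _) mIh)).
rewrite (ge0_integralZl mu measurableT mnh) //.
rewrite (ge0_integralZl mu measurableT mIh p2); last by rewrite lee_fin.
rewrite hI EFinD !EFinM; apply: leeD => //; apply: lee_wpmul2l; first by rewrite lee_fin.
have -> : (\int[mu]_x ((\1_B x)%:E * `|(h x)%:E|) = \int[mu]_(x in B) `|(h x)%:E|)%E.
  rewrite [RHS]integral_mkcond; apply: eq_integral => x _; rewrite patchE indicE.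
  by case: ifP; rewrite ?mul1e ?mul0e.
rewrite fineK//; apply: integrable_fin_num => //.
exact: (integrableS measurableT mB (@subsetT _ B) (integrable_abse Ih)).
Qed.

(** The error is uniformly small off [B n], and on [B n] it is bounded while the integral of [|h|]
    over [B n] tends to 0. The bounded function [g] replaces [f], which need only agree with it
    almost everywhere. *)
Lemma weak_cvg h f g (psi : nat -> T -> R) (B : nat -> set T) (K : R) : 0 < K ->
  mu.-integrable setT (EFin \o h) ->
  measurable_fun setT f -> measurable_fun setT g -> (forall n, measurable_fun setT (psi n)) ->
  (forall x, `|g x| <= K) -> (forall n x, `|psi n x| <= K) ->
  (forall n, measurable (B n)) -> (forall n, (mu (B n) <= (n.+1%:R^-1)%:E)%E) ->
  (forall n x, ~ B n x -> `|psi n x - g x| <= n.+1%:R^-1) ->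
  {ae mu, forall x, f x = g x} ->
  (\int[mu]_x (psi n x * h x)%:E)%E @[n --> \oo] --> (\int[mu]_x (f x * h x)%:E)%E.
Proof.
move=> K0 Ih mf mg mpsi gK psiK mB muB Hpsi aefg.
have mh : measurable_fun setT h by have := measurable_int _ Ih; move/measurable_EFinP.
have -> : (\int[mu]_x (f x * h x)%:E = \int[mu]_x (g x * h x)%:E)%E.
  apply: ae_eq_integral => //.
  - by apply/measurable_EFinP; exact: measurable_funM.
  - by apply/measurable_EFinP; exact: measurable_funM.
  - by apply: filterS aefg => x /= -> _.
have Ig := integrable_bounded_mul Ih mg gK.
have Ipsi n := integrable_bounded_mul Ih (mpsi n) (psiK n).
have fg := integrable_fin_num measurableT Ig.
have fpsi n := integrable_fin_num measurableT (Ipsi n).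
have fh := integrable_fin_num measurableT (integrable_abse Ih).
rewrite -(fineK fg); apply: cvg_EFin; first by apply: nearW.
pose I := fine (\int[mu]_x (abse \o (EFin \o h)) x)%E.
have hI : (\int[mu]_x `|(h x)%:E| = I%:E)%E by rewrite /I fineK.
have I0 : 0 <= I by rewrite -lee_fin -hI; exact: integral_ge0.
apply/cvgrPdist_le => a a0.
have a1 : 0 < a / 2 / (K + K) by rewrite !divr_gt0// addr_gt0.
(* Absolute continuity of the integral of [|h|], with the share of [a / 2] left after the factor
   [K + K]. *)
have [del [del0 Hdel]] := integral_normr_continuous Ih a1.
have a2 : 0 < Num.min del (a / 2 / (I + 1)).
  by rewrite lt_min del0 !divr_gt0// ltr_wpDl.
exists (Num.truncn (Num.min del (a / 2 / (I + 1)))^-1).+1 => // n /= hn.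
have ea : n.+1%:R^-1 < Num.min del (a / 2 / (I + 1)).
  rewrite invf_plt ?posrE//; apply: (lt_le_trans (truncnS_gt _)).
  by rewrite ler_nat ltnW// ltnS.
move: ea; rewrite lt_min => /andP[ed eI].
have bK x : `|(psi n \- g) x| <= K + K by apply: (le_trans (ler_normB _ _)); exact: lerD.
have n0 : 0 <= n.+1%:R^-1 :> R by rewrite invr_ge0.
have := weak_bound Ih (measurable_funB (mpsi n) mg) bK (mB n) n0 (Hpsi n) hI.
have -> : (\int[mu]_x ((psi n \- g) x * h x)%:E =
    \int[mu]_x (psi n x * h x)%:E - \int[mu]_x (g x * h x)%:E)%E.
  rewrite -integralB//; apply: eq_integral => x _ /=.
  by rewrite -EFinB mulrBl.
rewrite -(fineK fg) -(fineK (fpsi n)) -EFinB lee_fin distrC => H.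
apply: (le_trans H); rewrite (splitr a); apply: lerD.
  apply: (@le_trans _ _ (a / 2 / (I + 1) * I)).
    by apply: ler_wpM2r => //; exact: ltW.
  rewrite mulrAC ler_pdivrMr ?ltr_wpDl//; apply: ler_wpM2l; first by rewrite divr_ge0// ltW.
  by rewrite lerDl.
have KK : 0 < K + K by rewrite addr_gt0.
rewrite mulrC -ler_pdivlMr//; apply: ltW; apply: Hdel => //.
by apply: (le_lt_trans (muB n)); rewrite lte_fin.
Qed.

End WeakConvergence.

(** * The approximation criterion *)

Section Density.
Context {R : realType}.
Local Notation plane := (measurableTypeR R * measurableTypeR R)%type.
Local Notation S := (@fundamental_square R).
Local Notation tau := (@torus_measure R).

(** Step functions are to be matched up to [e] off a set of measure [e], with a uniform bound
    exceeding theirs by at most 1, whatever [e]. The extra 1 is room for the auxiliary shear and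
    vortices. *)
Definition rich (Good : (R * R -> R) -> Prop) := forall k (g : R * R -> R) (M e : R),
  (forall x y, gindex k x = gindex k y -> g x = g y) -> 0 < M ->
  (forall x, `|g x| <= M) -> 0 < e ->
  exists (psi : R * R -> R) (B : set plane), [/\ Good psi /\ continuous psi,
    forall x, `|psi x| <= M + 1, measurable B /\ (mu2 B <= e%:E)%E &
    forall x, S x -> ~ B x -> `|psi x - g x| <= e].

Lemma torus_measureE (A : set plane) : tau A = mu2 (A `&` S).
Proof. by []. Qed.

Lemma torus_measure_gt0 : (0 < tau setT)%E.
Proof.
have -> : tau setT = (((2 * pi) * (2 * pi))%R%:E : \bar R).
  have p0 : 0 <= (2 * pi : R) by rewrite ltW// twopi_gt0.
  by have := mu2_rect p0 p0; rewrite !subr0 torus_measureE setTI.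
by rewrite lte_fin mulr_gt0// twopi_gt0.
Qed.

Lemma torus_measure_fin : exists2 V : R, 0 <= V & (tau setT <= V%:E)%E.
Proof.
have f : tau setT \is a fin_num.
  by rewrite ge0_fin_numE// torus_measureE setTI; exact: mu2_square_fin.
exists (fine (tau setT)); first exact: fine_ge0.
by rewrite fineK.
Qed.

Lemma rich_bounded Good (f : plane -> R) (M e : R) : rich Good ->
  measurable_fun setT f -> 0 < M -> (forall x, `|f x| <= M) -> 0 < e ->
  exists (psi : plane -> R) (B : set plane),
    [/\ Good psi /\ measurable_fun setT psi, forall x, `|psi x| <= M + 1,
        measurable B /\ (tau B <= e%:E)%E & forall x, ~ B x -> `|psi x - f x| <= e].
Proof.
move=> rG mf M0 fM e0; have e2 : 0 < e / 2 by rewrite divr_gt0.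
have [k [g [B [gk gM mB muB HB]]]] := step_approx mf M0 fM e2.
have [psi [B' [[Gpsi cpsi] psiM [mB' muB'] HB']]] := rG k g M _ gk M0 gM e2.
have mS := @measurable_fundamental_square R.
(* The complement of [S] is null for the torus measure, so that the estimate can be stated on the
   whole plane. *)
exists psi, (B `|` B' `|` ~` S); split => //.
- by split => //; exact: continuous_measurable2.
- have mBB : measurable (B `|` B') by exact: measurableU.
  split; first by apply: measurableU => //; exact: measurableC.
  rewrite torus_measureE setIUl setICl setU0.
  apply: (@le_trans _ _ (@mu2 R (B `|` B'))).
    apply: le_measure; rewrite ?inE//; exact: measurableI.
  apply: (le_trans (measureU2 _ mB mB')).
  by rewrite (splitr e) EFinD; exact: leeD.
move=> x /not_orP[/not_orP[nB nB'] /contrapT Sx].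
rewrite (_ : psi x - f x = (psi x - g x) - (f x - g x)); last by ring.
rewrite (splitr e); apply: (le_trans (ler_normB _ _)); apply: lerD.
  exact: HB'.
exact: HB.
Qed.

Lemma Lq_close Good (r : R) (f : plane -> R) (a : R) : rich Good -> 1 <= r ->
  f \in Lfun tau r%:E -> 0 < a ->
  exists psi, Good psi /\ (Lnorm tau r%:E (EFin \o (fun x => (psi x - f x)%R)) <= a%:E)%E.
Proof.
move=> rG r1 Lf a0; have r0 : 0 < r by apply: lt_le_trans r1.
have mf : measurable_fun setT f by have /set_mem := sub_Lfun_mfun Lf.
have a2 : 0 < a / 2 by rewrite divr_gt0.
have ar : 0 < (a / 2) `^ r by exact: powR_gt0.
have [m m0 Hm] := Lp_clamp r1 ar mf (Lfun_integrable r1 Lf).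
have [V V0 HV] := torus_measure_fin.
have mc := measurable_clamp m mf.
have C0 : 0 < V + (m + m + 1) `^ r + 1.
  by apply: ltr_wpDl => //; apply: addr_ge0 => //; exact: powR_ge0.
pose e := Num.min 1 ((a / 2) `^ r / (V + (m + m + 1) `^ r + 1)).
have e0 : 0 < e by rewrite lt_min ltr01 divr_gt0.
have [psi [B [[Gpsi mpsi] psiM [mB muB] HB]]] :=
  rich_bounded rG mc m0 (fun x => clamp_abs (f x) (ltW m0)) e0.
exists psi; split => //.
have -> : (fun x => psi x - f x) =
    ((fun x => psi x - clamp m (f x)) \+ (fun x => clamp m (f x) - f x)).
  by apply/funext => x /=; rewrite addrA subrK.
have m1 : measurable_fun setT (fun x => psi x - clamp m (f x)) by exact: measurable_funB.
have m2 : measurable_fun setT (fun x => clamp m (f x) - f x) by exact: measurable_funB.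
have K0 : 0 <= m + m + 1 by rewrite !addr_ge0// ltW.
have hK x : `|psi x - clamp m (f x)| <= m + m + 1.
  apply: (le_trans (ler_normB _ _)).
  by have := psiM x; have := clamp_abs (f x) (ltW m0); lra.
have e1 : e <= 1 by rewrite ge_min lexx.
have L2 := Lnorm_le r1 (ltW a2) Hm.
have E : e * V + (m + m + 1) `^ r * e <= (a / 2) `^ r.
  rewrite -[leRHS](@divfK _ (V + (m + m + 1) `^ r + 1)) ?gt_eqF//.
  apply: (@le_trans _ _ (e * (V + (m + m + 1) `^ r + 1))).
    by rewrite !mulrDr mulr1 [_ `^ r * e]mulrC lerDl ltW.
  by apply: ler_wpM2r; [exact: ltW|rewrite ge_min lexx orbT].
have Ee : ((e * V + (m + m + 1) `^ r * e)%:E <= ((a / 2) `^ r)%:E)%E by rewrite lee_fin.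
have L1 := Lnorm_le r1 (ltW a2)
  (le_trans (Lp_small r1 (ltW e0) e1 K0 HV mB muB m1 hK HB) Ee).
apply: (le_trans (minkowski_EFin tau m1 m2 r1)); apply: (le_trans (leeD L1 L2)).
by rewrite -EFinD -splitr.
Qed.

Lemma dense_Lq Good (q : \bar R) (f : R * R -> R) : rich Good -> (1%:E <= q)%E ->
  torus_Lq q f -> exists psi : nat -> R * R -> R,
    [/\ forall n, Good (psi n), (q < +oo)%E -> Lq_cvg q psi f &
        q = +oo%E -> weak_star_cvg psi f].
Proof.
move=> rG q1 [Lf _]; case: q q1 Lf => [r| |]//; last first.
- move=> _ Lf.
  have mf : measurable_fun setT f by have /set_mem := sub_Lfun_mfun Lf.
  have : (Lnorm tau +oo%E (EFin \o f) < +oo)%E.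
    by have /set_mem := sub_Lfun_finLfun Lf.
  rewrite unlock /Lnorm torus_measure_gt0 => Hsup.
  have [K K0 aeK] : exists2 K : R, 0 < K & {ae tau, forall x, `|f x| <= K}.
    have := ess_sup_inf.ess_sup_ge tau (abse \o (EFin \o f)).
    move: Hsup; set s := ess_sup_inf.ess_sup _ _; case: s => [s| |]// _ Hs.
      exists (Num.max s 1); first by rewrite lt_max ltr01 orbT.
      by apply: filterS Hs => x /=; rewrite lee_fin le_max => ->.
    by exists 1 => //; apply: filterS Hs => x /=.
  (* Clamping at an essential bound changes [f] on a null set only, and provides a function bounded
     everywhere. *)
  have mc := measurable_clamp K mf.
  have n0 n : 0 < n.+1%:R^-1 :> R by rewrite invr_gt0.
  have /choice[F HF] : forall n, exists F : (plane -> R) * set plane,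
      [/\ Good F.1 /\ measurable_fun setT F.1, forall x, `|F.1 x| <= K + 1,
        measurable F.2 /\ (tau F.2 <= (n.+1%:R^-1)%:E)%E &
        forall x, ~ F.2 x -> `|F.1 x - clamp K (f x)| <= n.+1%:R^-1].
    move=> n; have [psi [B H]] := rich_bounded rG mc K0 (fun x => clamp_abs (f x) (ltW K0)) (n0 n).
    by exists (psi, B).
  exists (fun n => (F n).1); split=> // [n|_ h [Lh _]]; first by have [[]] := HF n.
  have Ih : tau.-integrable setT (EFin \o h) by apply/Lfun1_integrable.
  apply: (@weak_cvg _ _ _ tau h f (fun x => clamp K (f x)) (fun n => (F n).1)
    (fun n => (F n).2) (K + 1)) => //.
  - by rewrite addr_gt0.
  - by move=> n; have [[]] := HF n.
  - by move=> x; apply: (le_trans (clamp_abs (f x) (ltW K0))); rewrite lerDl.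
  - by move=> n; have [] := HF n.
  - by move=> n; have [_ _ []] := HF n.
  - by move=> n; have [_ _ []] := HF n.
  - by move=> n; have [_ _ _] := HF n.
  - by apply: (@filterS _ _ (ae_filter_ringOfSetsType tau) _ _ _ aeK) => x fK; rewrite clamp_id.
move=> r1 Lf.
have n0 n : 0 < n.+1%:R^-1 :> R by rewrite invr_gt0.
have r1' : 1 <= r by rewrite -lee_fin.
have /choice[F HF] := fun n => Lq_close rG r1' Lf (n0 n).
exists F; split=> // [n|_]; first by have [] := HF n.
apply: (@squeeze_cvge _ _ _ _ (cst 0%E) _ (fun n => (n.+1%:R^-1)%:E)).
- by apply: nearW => n; rewrite Lnorm_ge0 /=; have [] := HF n.
- exact: cvg_cst.
- by apply: cvg_EFin; [exact: nearW|exact: cvg_harmonic].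
Qed.

End Density.

(** * Embedded tori of drifting vortices *)

Section Embedding.
Context {R : realType} {N : nat}.
Implicit Types (A u : CinftyDiv R) (w : 'I_N -> CinftyDiv R) (th : 'rV[R]_N).

(** A profile positive on [(p, q)] and nonpositive on the rest of a period has no smaller period:
    each nonzero translation moves some point of the positive arc out of it. *)
Lemma shift_period (v : R -> R) (p q tau : R) : p < q -> q - p <= pi ->
  (forall s, p < s < q -> 0 < v s) -> (forall s, q <= s <= p + 2 * pi -> v s <= 0) ->
  (forall s, v (s + tau) = v s) -> 0 <= tau < 2 * pi -> tau = 0.
Proof.
move=> pq pqpi vpos vneg vtau /andP[t0 t2]; apply/eqP; apply: contraTT isT => tn0.
have {}t0 : 0 < tau by rewrite lt_neqAle eq_sym tn0.
have pi0 := pi_gt0 R.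
suff [s [h1 h2 h3 h4]] : exists s, [/\ p < s, s < q, q <= s + tau & s + tau <= p + 2 * pi].
  have := vpos s; rewrite h1 h2 => /(_ isT) H1.
  have := vneg (s + tau); rewrite h3 h4 vtau => /(_ isT) H2.
  by move: (lt_le_trans H1 H2); rewrite ltxx.
have [h|h] := leP tau (2 * pi - (q - p)); last by exists (p + (2 * pi - tau) / 2); split; lra.
have [h'|h'] := leP tau (q - p).
  by exists (q - tau / 2); split; lra.
by exists (q - (q - p) / 2); split; lra.
Qed.

Lemma cdiv_sumE (F : 'I_N -> CinftyDiv R) (x : R * R) :
  (\sum_i F i) x = \sum_i F i x.
Proof. exact: (multi_derive_sum (0%N, 0%N) F x). Qed.

Lemma driftE A w th (x : R * R) :
  drift A w th x = A x + \sum_i w i (x + th 0 i *: (-1, 0)).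
Proof.
have -> : drift A w th x = A x + (\sum_i trans (th 0 i) (w i)) x by [].
by rewrite cdiv_sumE.
Qed.

Context (y : 'I_N -> R) (p q : R).

(* On the line [x2 = y i] only the [i]-th field is alive, and the sign of its
   vertical component along that line determines its position. *)
Definition line_separated w := forall i,
  (forall j (s : R), j != i -> w j (s, y i) = 0) /\
  (forall s, p < s < q -> 0 < (w i (s, y i)).2) /\
  (forall s, q <= s <= p + 2 * pi -> (w i (s, y i)).2 <= 0).

Lemma line_shift (s a : R) (z : R) : (s, z) + a *: ((-1, 0) : R * R) = (s - a, z).
Proof. by apply: pair_ext; rewrite /= /GRing.scale/= ?mulrN1 ?mulr0 ?addr0. Qed.

Lemma drift_line A w th i (s : R) : line_separated w ->
  drift A w th (s, y i) = A (s, y i) + w i (s - th 0 i, y i).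
Proof.
move=> /(_ i)[H _]; rewrite driftE (bigD1 i)//= big1 ?addr0 ?line_shift// => j ji.
by rewrite line_shift H.
Qed.

Lemma cdiv_periodic1 u (s z : R) (k : int) : u (s + 2 * pi * k%:~R, z) = u (s, z).
Proof.
rewrite -[RHS](cdiv_periodic u _ k 0); congr (u _).
by apply: pair_ext; rewrite /= ?mulr0 ?addr0.
Qed.

(** Restricted to the line of height [y i], the fields at [th] and [th'] are translates of one
    profile; their equality makes the difference of the angles a period of it, and [shift_period]
    concludes. *)
Lemma drift_injective A w : p < q -> q - p <= pi -> line_separated w ->
  forall th th', drift A w th = drift A w th' -> torus_eq th th'.
Proof.
move=> pq pqpi sw th th' E.
exists (\row_i Num.floor ((th' 0 i - th 0 i) / (2 * pi))).
apply/rowP => i; rewrite !mxE.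
have [_ [vpos vneg]] := sw i.
set tau := th' 0 i - th 0 i; set k := Num.floor _.
suff : tmod tau = 0.
  by rewrite /tmod -/k => /eqP; rewrite subr_eq0 => /eqP <-; rewrite addrC subrK.
apply: (shift_period pq pqpi vpos vneg); last exact: tmod_itv.
move=> s; congr (_.2); rewrite /tmod -/k addrA.
have -> : s + tau - 2 * pi * k%:~R = s + tau + 2 * pi * (- k)%:~R by rewrite intrN mulrN.
rewrite cdiv_periodic1.
have := f_equal (fun u : CinftyDiv R => u (s + th' 0 i, y i)) E.
by rewrite !(drift_line _ _ _ _ sw) => /addrI; rewrite addrA addrAC addrK.
Qed.

Lemma derive_line0 u (s z : R) : (forall s, u (s, z) = 0) ->
  'D_((-1, 0) : R * R) u (s, z) = 0.
Proof.
move=> H; have [_ <-] : is_derive (s, z) ((-1, 0) : R * R) u (0 : R * R).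
  apply/is_derive_slice0.
  rewrite (_ : (fun _ => _) = cst 0); first exact: is_derive_cst.
  by apply/funext => h; rewrite line_shift H.
by [].
Qed.

(** If the differential killed a vector with [v 0 i] nonzero, [w i] would be constant along its
    central line, against the change of sign of its vertical component. *)
Lemma drift_immersion A w : p < q -> q - p <= pi -> line_separated w -> immersion (drift A w).
Proof.
move=> pq pqpi sw th v v0; apply/eqP; rewrite frechet_derive_drift => E.
have [i vi] : exists i, v 0 i != 0.
  apply/existsP; apply: contraNT v0 => /existsPn H.
  by apply/eqP/rowP => i; have := H i; rewrite negbK mxE => /eqP.
have sw' := cdiv_smooth (w i); have [H [vpos vneg]] := sw i.
have D0 s : 'D_((-1, 0) : R * R) (w i) (s, y i) = 0.
  have := f_equal (fun u : CinftyDiv R => u (s + th 0 i, y i)) E.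
  rewrite driftE (bigD1 i)//= big1 => [|j ji].
    rewrite line_shift addrK add0r addr0 => Ei; apply/eqP.
    have /eqP : v 0 i *: 'D_((-1, 0) : R * R) (w i) (s, y i) = 0 by [].
    by rewrite scaler_eq0 (negbTE vi).
  rewrite line_shift; apply: etrans (scaler0 _ (v 0 j)); congr (_ *: _).
  by apply: derive_line0 => r; exact: H.
have ss : smooth (fun x => (w i x).2) by exact: smooth_snd.
(* Compares the end [q] of the positive arc with its midpoint. *)
have [t _] := mvt1 (q, y i) (((q - p) / 2) *: ((-1, 0) : R * R)) ss.
rewrite derive_dirZ// line_shift => Et.
have pos : 0 < (w i (q - (q - p) / 2, y i)).2 by apply: vpos; lra.
have neg : (w i (q, y i)).2 <= 0 by apply: vneg; have := pi_ge0 R; lra.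
have : (w i (q - (q - p) / 2, y i)).2 - (w i (q, y i)).2 = 0.
  rewrite Et scalerA line_shift -derive_snd// D0 mulr0; by [].
by move: pos neg; lra.
Qed.

Lemma drift_embedding A w : p < q -> q - p <= pi -> line_separated w -> smooth_embedding (drift A w).
Proof.
move=> pq pqpi sw; have inj := drift_injective (A := A) pq pqpi sw.
split.
- exact: drift_torus_periodic.
- exact: drift_frechet_smooth.
- exact: inj.
- exact: drift_immersion.
- apply: homeo_of_compact => //; [exact: drift_continuous|exact: drift_torus_periodic].
Qed.

End Embedding.

(** * Assembling the flow *)

Section Shear.
Context {R : realType}.

Lemma derive_affine_near (f : R -> R) (z k c : R) :
  (\forall z' \near z, f z' = k * (z' - c)) ->
  'D_1 f z = k /\ 'D_1 ('D_1 f) z = 0.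
Proof.
have D z' : is_derive z' (1 : R) (fun z : R => k * (z - c)) k.
  have := isD_scale k (isD_sub (is_derive_id z' (1 : R)) (is_derive_cst c z' (1 : R))).
  by rewrite subr0 mulr1.
move=> near_f.
have D1 z' : (\forall u \near z', f u = (fun z : R => k * (z - c)) u) -> 'D_1 f z' = k.
  by move=> H; rewrite (near_eq_derive (1 : R) H); have [_ e] := D z'; exact: e.
split; first exact: D1.
have H : \near z, ('D_1 f) z = cst k z.
  by apply: filterS (nbhs_interior near_f) => u; exact: D1.
by rewrite (near_eq_derive (1 : R) H) derive_cst.
Qed.

Context (N : nat) (y nu : 'I_N -> R) (eta : R).
Context (eta0 : 0 < eta) (ybox : forall i, eta <= y i <= 2 * pi - eta).
Context (ysep : forall i j, i != j -> 2 * eta <= `|y i - y j|).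

(** [b] is the stream function of the shear: near the line [y i] it equals [nu i * (z - y i)], so
    its derivative is the prescribed speed, while its size is proportional to the width [eta]. *)
Lemma shear_exists (C : R) : (forall i, `|nu i| <= C) -> 0 <= C ->
  exists b : R -> R, [/\ smooth b,
    forall z (k : int), b (z + 2 * pi * k%:~R) = b z,
    forall z, `|b z| <= C * eta,
    forall i z, `|tmod z - y i| < eta / 2 -> 'D_1 b z = nu i /\ 'D_1 ('D_1 b) z = 0 &
    forall z, (forall i, eta <= `|tmod z - y i|) ->
      [/\ b z = 0, 'D_1 b z = 0 & 'D_1 ('D_1 b) z = 0]].
Proof.
move=> nuC C0.
have absq (u : R) : u * u = `|u| * `|u| by rewrite -normrM ger0_norm// -expr2 sqr_ge0.
have sq (u v : R) : 0 <= v -> `|u| <= v -> u * u <= v * v.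
  by move=> v0 uv; rewrite absq ler_pM.
have sq' (u v : R) : 0 <= v -> v <= `|u| -> v * v <= u * u.
  by move=> v0 uv; rewrite (absq u) ler_pM.
have ab : (eta / 2) * (eta / 2) < (3 * eta / 4) * (3 * eta / 4) by have e2 := mulr_gt0 eta0 eta0; lra.
have [g [H [sg _ g1 g0 [g01 _ _ _]]]] := cutoff_exists ab.
have [kap [H' [skap _ kap1 kap0 _]]] := cutoff_exists (@ltr01 R).
have eta2 : 0 <= eta / 2 by rewrite divr_ge0// ltW.
have eta34 : 0 <= 3 * eta / 4 by rewrite divr_ge0// mulr_ge0// ltW.
(* The identity up to [eta / 2] and zero from [3 eta / 4] on; centres are [2 eta] apart, so the
   profiles have disjoint supports. *)
pose lam (z : R) := z * g (z * z).
have lam1 z : `|z| <= eta / 2 -> lam z = z.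
  by move=> hz; rewrite /lam g1 ?mulr1//; exact: sq.
have lam0 z : 3 * eta / 4 <= `|z| -> lam z = 0.
  by move=> hz; rewrite /lam (g0 _ _).1 ?mulr0//; exact: sq'.
have lamE z : `|lam z| <= eta.
  have [h|h] := leP (3 * eta / 4) `|z|; first by rewrite lam0// normr0 ltW.
  have [ge gl] := andP (g01 (z * z)).
  rewrite /lam normrM (ger0_norm ge); apply: (@le_trans _ _ `|z|); last lra.
  by rewrite ler_piMr.
have sid : smooth (fun z : R => z) by exact: (@smooth_id R R).
have slam : smooth lam.
  exact: (smoothM sid (smooth_comp1 sg (smoothM sid sid))).
pose beta (z : R) := \sum_i nu i * lam (z - y i).
have beta_strip i z : `|z - y i| < eta -> beta z = nu i * lam (z - y i).
  move=> hz; rewrite /beta (bigD1 i)//= big1 ?addr0// => j ji.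
  rewrite lam0 ?mulr0//; have := ysep ji.
  have := ler_distD z (y j) (y i); rewrite (distrC (y j) z); lra.
have beta0 z : (forall i, 3 * eta / 4 <= `|z - y i|) -> beta z = 0.
  by move=> hz; rewrite /beta big1// => i _; rewrite lam0 ?mulr0.
(* The profile is made a compactly supported function of the plane, so that the planar periodization
   applies; [b] is then read on the line [x.1 = pi], where the factor [kap] is 1. *)
pose F2 (x : R * R) := kap ((x.1 - pi) * (x.1 - pi)) * beta x.2.
have sF2 : smooth F2.
  have s1 : smooth (fun x : R * R => x.1 - pi) by exact: smoothB smooth_coord1 (@smooth_cst R _ R pi).
  apply: (smoothM (smooth_comp1 skap (smoothM s1 s1))).
  apply: smooth_sum => i _.
  have s2 : smooth (fun x : R * R => x.2 - y i) by exact: smoothB smooth_coord2 (@smooth_cst R _ R (y i)).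
  exact: (smoothZ (W := R) (nu i) (smooth_comp1 slam s2)).
pose rho := Num.min 1 (eta / 4).
have rho0 : 0 < rho by rewrite lt_min ltr01 divr_gt0.
have pi2 := pi_ge2 R.
have F2box : vanish_off (box rho) F2.
  move=> x nx; rewrite /F2.
  have [h1|h1] := leP 1 `|x.1 - pi|.
    by rewrite (kap0 _ _).1 ?mul0r//; have := sq' _ _ ler01 h1; rewrite mulr1.
  rewrite [X in _ * X]beta0 ?mulr0// => i.
  rewrite leNgt; apply/negP => h2; apply: nx.
  have r1 : rho <= 1 by rewrite ge_min lexx.
  have r2 : rho <= eta / 4 by rewrite ge_min lexx orbT.
  have := ybox i; move: h1 h2; rewrite !ltr_norml => /andP[? ?] /andP[? ?] /andP[? ?].
  by split; apply/andP; split; lra.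
pose b (z : R) := per F2 (pi, z).
have tpi : tmod pi = pi :> R by apply: tmod_id; lra.
have bE z : b z = beta (tmod z).
  by rewrite /b /per /F2 /trep /= tpi subrr mulr0 kap1// mul1r.
have near_b z : \forall z' \near z, b z' = beta (z' - (z - tmod z)).
  have cP : {for z, continuous (fun z' : R => (pi : R, z'))}.
    exact: continuous_pairr.
  apply: (@filterS _ (nbhs z) _ _ _ _ (cP _ (per_local (pi, z) rho0))) => z' /(_ F2 F2box).
  rewrite /b => ->; rewrite /F2 /trep /= tpi subrr addr0 subrr mulr0 kap1// mul1r.
  by congr beta; ring.
exists b; split.
- have L : forall (u v h : R), (pi : R, u + h *: v) = (pi, u) + h *: ((0, v) : R * R).
    by move=> u v h; apply: pair_ext; rewrite /= /GRing.scale/= ?mulr0 ?addr0.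
  apply: (@smooth_affine R _ _ R (fun z : R => (pi : R, z)) (fun v => (0, v)) (per F2) L).
    exact: continuous_pairr.
  exact: per_smooth rho0 F2box sF2.
- by move=> z k; rewrite !bE tmod_addz.
- move=> z; rewrite bE.
  have [[i hi]|no] := pselect (exists i, `|tmod z - y i| < eta).
    by rewrite (beta_strip i)// normrM ler_pM.
  rewrite beta0 => [|i]; first by rewrite normr0 mulr_ge0// ltW.
  rewrite leNgt; apply/negP => h; apply: no; exists i; lra.
- move=> i z hz; apply: (@derive_affine_near _ _ _ (y i + (z - tmod z))).
  have : \forall z' \near z, `|z' - z| < eta / 2 - `|tmod z - y i|.
    by apply/nbhs_normP; exists (eta / 2 - `|tmod z - y i|) => /=; rewrite ?subr_gt0// => z'; rewrite /ball_/= distrC.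
  apply: filterS2 (near_b z) => z' -> h.
  have h' : `|z' - (z - tmod z) - y i| < eta / 2.
    rewrite (_ : z' - (z - tmod z) - y i = (z' - z) + (tmod z - y i)); last by ring.
    by apply: (le_lt_trans (ler_normD _ _)); rewrite -ltrBrDr.
  rewrite (beta_strip i); last by apply: (lt_trans h'); rewrite gtr_pMr// invf_lt1// ltr1n.
  by rewrite lam1 ?ltW//; congr (_ * _); ring.
- move=> z hz.
  have H0 : \forall z' \near z, b z' = 0 * (z' - 0).
    have e4 : 0 < eta / 4 by rewrite divr_gt0.
    have : \forall z' \near z, `|z' - z| < eta / 4.
      by apply/nbhs_normP; exists (eta / 4) => //= z'; rewrite /ball_/= distrC.
    apply: filterS2 (near_b z) => z' -> h; rewrite mul0r beta0// => i.
    have := hz i; have := ler_distD z' (tmod z + (z' - z)) (y i).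
    have := ler_normB (z' - (z - tmod z) - y i) (z' - z).
    rewrite (_ : z' - (z - tmod z) - y i - (z' - z) = tmod z - y i); last by ring.
    by move=> A B D; lra.
  have [e1 e2] := derive_affine_near H0; split=> //.
  by rewrite (nbhs_singleton H0) mul0r.
Qed.

End Shear.

Section DriftSolution.
Context {R : realType}.

Lemma grad_perp_div_free (f : R * R -> R) : smooth f -> periodic2 f ->
  grad_perp f \in smooth_div_free.
Proof.
move=> sf pf; have s1 := smooth_d1 sf; have s2 := smooth_d2 sf.
apply/asboolP; split.
- exact: smooth_pair s2 (smoothN s1).
- move=> x m n; apply: pair_ext; first exact: derive_periodic2.
  by congr (- _); exact: derive_periodic2.
move=> x; have D v : 'D_v (grad_perp f) x = ('D_v (d2 f) x, - 'D_v (d1 f) x).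
  have [_ e] := is_derive_pair (smooth_is_derive x v s2) (is_deriveN (smooth_is_derive x v s1)).
  exact: e.
rewrite /divergence /d1 /d2 !D /=; apply/eqP; rewrite subr_eq0; apply/eqP.
exact: (f_equal (fun h : R * R -> R => h x) (derive_comm _ _ sf)).
Qed.

Lemma derive_bigsum (I : Type) (r : seq I) (f : I -> R * R -> R) x v :
  (forall i, smooth (f i)) ->
  'D_v (fun y => \sum_(i <- r) f i y) x = \sum_(i <- r) 'D_v (f i) x.
Proof.
by move=> sf; have [_ e] := isD_sum r (fun i => smooth_is_derive x v (sf i)); exact: e.
Qed.

Lemma smooth_shear (b : R -> R) : smooth b -> smooth (fun x : R * R => b x.2).
Proof. by move=> sb; exact: (smooth_comp1 sb smooth_coord2). Qed.

Lemma grad_perp_shear (b : R -> R) (f : R * R -> R) x : smooth b -> smooth f ->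
  grad_perp (fun y => b y.2 + f y) x = ('D_1 b x.2 + d2 f x, - d1 f x).
Proof.
move=> sb sf; have D v : 'D_v (fun y => b y.2 + f y) x = 'D_1 b x.2 * v.2 + 'D_v f x.
  have D1 := is_derive_comp1 (is_derive_coord2 x v) (smooth_is_derive x.2 (1 : R) sb).
  by have [_ e] := isD_add D1 (smooth_is_derive x v sf); exact: e.
apply: pair_ext.
  by apply: etrans (D (0, 1)) _; rewrite mulr1.
by congr (- _); apply: etrans (D (1, 0)) _; rewrite mulr0 add0r.
Qed.

Lemma pair_sum (I : Type) (r : seq I) (f g : I -> R) :
  \sum_(i <- r) ((f i, - g i) : R * R) = (\sum_(i <- r) f i, - \sum_(i <- r) g i).
Proof.
elim: r => [|i r IH]; first by rewrite !big_nil oppr0.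
by rewrite !big_cons IH opprD.
Qed.

(** Index [ord0] has speed 0 and forms the resting part [A] together with the shear; the other [N]
    flows travel at speeds [nu 0 i] and become the fields [w]. *)
Lemma drift_solution N (nu : 'rV[R]_N) (Psi Pi : 'I_N.+1 -> R * R -> R)
    (s : 'I_N.+1 -> R) (Y : 'I_N.+1 -> R -> Prop) (b : R -> R) :
  (forall i, smooth (Psi i)) -> (forall i, smooth (Pi i)) ->
  (forall i, periodic2 (Psi i)) -> (forall i, periodic2 (Pi i)) ->
  (forall i, steady (Psi i) (Pi i)) ->
  (forall i (x : R * R), ~ Y i x.2 ->
    (forall v, 'D_v (Psi i) x = 0) /\ (forall v w, 'D_w ('D_v (Psi i)) x = 0)) ->
  (forall i j y, Y i y -> Y j y -> i = j) ->
  smooth b -> (forall y (k : int), b (y + 2 * pi * k%:~R) = b y) ->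
  (forall i y, Y i y -> 'D_1 b y = s i /\ 'D_1 ('D_1 b) y = 0) ->
  s ord0 = 0 -> (forall i, s (lift ord0 i) = nu 0 i) ->
  let psi x := b x.2 + \sum_i Psi i x in
  exists A w, [/\ smooth psi /\ periodic2 psi,
    the_euler_solution (grad_perp psi) (fun t => drift A w (t *: nu) : R * R -> R * R),
    forall x, A x = ('D_1 b x.2 + d2 (Psi ord0) x, - d1 (Psi ord0) x) &
    forall i, w i = grad_perp (Psi (lift ord0 i)) :> (R * R -> R * R)].
Proof.
move=> sPsi sPi pPsi pPi stPsi offY disjY sb pb bY s0 snu psi.
have pbx : periodic2 (fun x : R * R => b x.2) by move=> x m n; exact: pb.
have sS : smooth (fun x => \sum_i Psi i x) by apply: smooth_sum => i _; exact: sPsi.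
have spsi : smooth psi by exact: smoothD (smooth_shear sb) sS.
have ppsi : periodic2 psi.
  move=> x m n; rewrite /psi; congr (_ + _); first exact: pb.
  by apply: eq_bigr => i _; exact: pPsi.
have sA : smooth (fun x : R * R => b x.2 + Psi ord0 x) by exact: smoothD (smooth_shear sb) (sPsi _).
have pA : periodic2 (fun x : R * R => b x.2 + Psi ord0 x).
  by move=> x m n; congr (_ + _); [exact: pb|exact: pPsi].
have [A EA] : exists A : CinftyDiv R,
    A = grad_perp (fun x => b x.2 + Psi ord0 x) :> (R * R -> R * R).
  by exists (MkCinftyDiv (grad_perp_div_free sA pA)).
have /choice[w Ew] : forall i, exists w : CinftyDiv R,
    w = grad_perp (Psi (lift ord0 i)) :> (R * R -> R * R).
  by move=> i; exists (MkCinftyDiv (grad_perp_div_free (sPsi (lift ord0 i)) (pPsi (lift ord0 i)))).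
have AE x : A x = ('D_1 b x.2 + d2 (Psi ord0) x, - d1 (Psi ord0) x).
  by rewrite EA; exact: (grad_perp_shear x sb (sPsi ord0)).
have sol := velocity_solution sPsi sPi pPsi pPi stPsi offY disjY sb pb bY.
have E0 : velocity Psi s b 0 = grad_perp psi.
  apply/funext => x; apply: etrans (esym (grad_perp_shear x sb sS)).
  have e i : shifted s i 0 x = x by rewrite /shifted mulr0 scale0r addr0.
  apply: pair_ext; rewrite /velocity /=.
    congr (_ + _); apply: etrans (esym (derive_bigsum (index_enum 'I_N.+1) x (0, 1) sPsi)).
    by apply: eq_bigr => i _; rewrite e.
  congr (- _); apply: etrans (esym (derive_bigsum (index_enum 'I_N.+1) x (1, 0) sPsi)).
  by apply: eq_bigr => i _; rewrite e.
have Et : (fun t => drift A w (t *: nu) : R * R -> R * R) = velocity Psi s b.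
  apply/funext => t; apply/funext => x; rewrite driftE AE.
  have -> : \sum_i w i (x + (t *: nu) 0 i *: (-1, 0)) =
      (\sum_i d2 (Psi (lift ord0 i)) (shifted s (lift ord0 i) t x),
       - \sum_i d1 (Psi (lift ord0 i)) (shifted s (lift ord0 i) t x)).
    rewrite -pair_sum; apply: eq_bigr => i _; rewrite Ew /shifted snu mxE mulrC; by [].
  rewrite /velocity !big_ord_recl /=.
  have -> : shifted s ord0 t x = x by rewrite /shifted s0 mul0r scale0r addr0.
  by apply: pair_ext => /=; rewrite ?addrA ?opprD.
exists A, w; split=> //.
rewrite Et -E0; split=> // v; exact: euler_unique.
Qed.

End DriftSolution.

(** * Layout of the strips, the vortices and the probe *)

Section Layout.
Context {R : realType}.

Lemma off_per (rho : R) (A : set (R * R)) (F : R * R -> R) (x : R * R) : 0 < rho ->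
  vanish_off (box rho) F -> smooth F -> closed A -> vanish_off A F -> ~ A (trep x) ->
  (forall v, 'D_v (per F) x = 0) /\ (forall v w, 'D_w ('D_v (per F)) x = 0).
Proof.
move=> r0 FB sF cA FA nA; have cB := @closed_box R rho.
have D v : vanish_off (box rho) ('D_v F) by exact: vanish_derive.
have DA v : vanish_off A ('D_v F) by exact: vanish_derive.
have E v : 'D_v (per F) = per ('D_v F) by exact: per_derive v r0 FB sF.
split=> [v|v w].
  by apply: etrans (f_equal (fun f : R * R -> R => f x) (E v)) _; exact: DA.
rewrite (E v); apply: etrans (f_equal (fun f : R * R -> R => f x)
  (per_derive w r0 (D v) (smooth_derive v sF))) _.
exact: (@vanish_derive _ A ('D_v F) w cA (DA v) _ nA).
Qed.

Lemma derive_vortex (g : R -> R) c al x v : smooth g ->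
  'D_v (fun x => al * g (rsq c x)) x =
  al * 'D_1 g (rsq c x) * (2 * ((x.1 - c.1) * v.1 + (x.2 - c.2) * v.2)).
Proof.
move=> sg; have [_ e] := isD_scale al (is_derive_comp1 (is_derive_rsq c x v)
  (smooth_is_derive (rsq c x) (1 : R) sg)).
by rewrite -mulrA; exact: e.
Qed.

Lemma disc_coord (c x : R * R) (r : R) : 0 <= r -> rsq c x <= r * r ->
  `|x.1 - c.1| <= r /\ `|x.2 - c.2| <= r.
Proof.
move=> r0 H.
have sqb (u : R) : u * u <= r * r -> `|u| <= r.
  move=> h; rewrite leNgt; apply/negP => h'.
  have := ltr_pM r0 r0 h' h'; rewrite -normrM ger0_norm -?expr2 ?sqr_ge0// expr2; lra.
have u2 (u : R) : 0 <= u * u by rewrite -expr2 sqr_ge0.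
by split; apply: sqb; apply: le_trans H; rewrite /rsq ?lerDl ?lerDr.
Qed.

Context (N : nat) (nu : 'rV[R]_N) (eta C : R).
Context (eta0 : 0 < eta) (eta1 : 2 * eta * N.+1%:R <= 1).
Context (nuC : forall i, `|nu 0 i| <= C) (C0 : 0 <= C) (Ceta : C * eta <= 1 / 2).

(** The frame of width [delta] has room at the bottom for [N + 1] stacked strips of height [2 eta]
    with central lines [hgt j]; the last one, [j = N], hosts the probe. *)
Let delta := 2 * eta * N.+1%:R.
Let hgt (j : nat) : R := eta * (2 * j%:R + 1).
Let ctr j : R * R := (pi, hgt j).

Definition core : set (R * R) :=
  [set x | delta < x.1 < 2 * pi - delta /\ delta < x.2 < 2 * pi - delta].

Lemma hgt_bounds j : (j <= N)%N -> eta <= hgt j <= delta - eta.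
Proof.
move=> jN; have j0 : (0 : R) <= j%:R by exact: ler0n.
have jN' : (j%:R : R) <= N%:R by rewrite ler_nat.
rewrite /hgt /delta -natr1; move: eta0 => e0; apply/andP; split.
  by rewrite ler_pMr//; lra.
have := ler_wpM2l (ltW e0) jN'; lra.
Qed.

Lemma hgt_sep i j : i != j -> 2 * eta <= `|hgt i - hgt j|.
Proof.
wlog ij : i j / (j < i)%N.
  by move=> H ij; case: (ltngtP i j) ij => // h _; [rewrite distrC|]; apply: H; rewrite ?gt_eqF// lt_eqF.
move=> _; have h : (j%:R : R) + 1 <= i%:R by rewrite natr1 ler_nat.
have := ler_wpM2l (ltW eta0) h => h'.
apply: le_trans (ler_norm _); rewrite /hgt; lra.
Qed.

Lemma delta_small : 2 * eta <= delta /\ delta <= 1.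
Proof.
split => //; rewrite /delta ler_pMr ?ler1n//.
by rewrite mulr_gt0.
Qed.

Lemma ctr_disc j x : (j <= N)%N -> disc (ctr j) (eta / 4 * (eta / 4)) x ->
  `|x.2 - hgt j| <= eta / 4 /\ box (eta / 2) x.
Proof.
move=> jN Dx; have e0 : 0 <= eta / 4 by rewrite divr_ge0// ltW.
have [] := disc_coord e0 Dx; rewrite /ctr /= => h1 h2; split => //.
have := hgt_bounds jN; have [d1 d2] := delta_small; have := pi_ge2 R.
move: h1 h2; rewrite !ler_norml => /andP[? ?] /andP[? ?] ? /andP[? ?].
by move: eta0 => ?; split; apply/andP; split; lra.
Qed.

Lemma core_strip x i : core x -> (i <= N)%N -> eta <= `|x.2 - hgt i|.
Proof.
move=> [_ /andP[h _]] iN; have /andP[_ h2] := hgt_bounds iN.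
by apply: le_trans (ler_norm _); lra.
Qed.

Lemma core_box x : core x -> box (eta / 2) x.
Proof.
move=> [/andP[? ?] /andP[? ?]]; have [d1 _] := delta_small; move: eta0 => ?.
by split; apply/andP; split; lra.
Qed.

(** The factor [1] is the constant [c n] of the final statement. *)
Definition realizes (psi : R * R -> R) := smooth psi /\ periodic2 psi /\
  exists U : 'rV[R]_N -> CinftyDiv R, [/\ smooth_embedding U, non_symmetric U &
    the_euler_solution (grad_perp psi) (fun t => U ((1 * t) *: nu) : R * R -> R * R)].

Let aa := eta / 8 * (eta / 8).
Let bb := eta / 4 * (eta / 4).

Context (g H : R -> R).
Context (sg : smooth g) (sH : smooth H) (g0 : forall s, bb <= s -> g s = 0 /\ H s = 0).
Context (g01 : forall s, 0 <= g s <= 1) (dg_lt0 : forall s, aa < s < bb -> 'D_1 g s < 0).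
Context (dg_eq0 : forall s, s <= aa \/ bb <= s -> 'D_1 g s = 0).
Context (dH : forall s : R, 'D_1 H s = 4 * 'D_1 g s ^+ 2).

Context (A : set (R * R)) (F p : R * R -> R) (M : R).
Context (eF : eddy A F p) (Acore : A `<=` core) (FM : forall x, `|F x| <= M).

(** With amplitude 1/2, a vortex and the shear, itself at most [C * eta <= 1 / 2], together exceed
    the bound [M] by at most 1. *)
Let V j x := 2^-1 * g (rsq (ctr j) x).
Let W j x := 2^-1 ^+ 2 / 2 * H (rsq (ctr j) x).

(** Index [ord0] gathers everything at rest, that is the filling of the core and the probe; the
    others are the drifting vortices. *)
Definition support (i : 'I_N.+1) := match unlift ord0 i with
  Some j => disc (ctr j) bb | None => A `|` disc (ctr N) bb end.
Definition stream (i : 'I_N.+1) := match unlift ord0 i with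
  Some j => V j | None => fun x => F x + V N x end.
Definition potential (i : 'I_N.+1) := match unlift ord0 i with
  Some j => W j | None => fun x => p x + W N x end.
(** For [ord0] this is the set of heights away from all carrying strips, where the shear vanishes;
    it contains the heights of the core and of the probe. *)
Definition strip (i : 'I_N.+1) (z : R) : Prop := match unlift ord0 i with
  Some j => `|tmod z - hgt j| < eta / 2
| None => forall j : 'I_N, eta <= `|tmod z - hgt j| end.

Lemma disc_strip j x : (j <= N)%N -> disc (ctr j) bb x ->
  `|x.2 - hgt j| <= eta / 4 /\ box (eta / 2) x.
Proof. exact: ctr_disc. Qed.

Lemma eddy_probe : A `&` disc (ctr N) bb = set0.
Proof.
apply/seteqP; split => // x [Ax Dx]; have := core_strip (Acore Ax) (leqnn N).
have [h _] := disc_strip (leqnn N) Dx; move: eta0 h; lra.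
Qed.

Lemma eddy_stream i : eddy (support i) (stream i) (potential i).
Proof.
have eV j : eddy (disc (ctr j) bb) (V j) (W j) by exact: (eddy_vortex _ _ sg sH g0 dH).
rewrite /support /stream /potential; case: unlift => [j|]; first exact: eV.
exact: (eddyU eF (eV N) eddy_probe).
Qed.

Lemma support_box i x : support i x -> box (eta / 2) x.
Proof.
rewrite /support; case: unlift => [j|[Ax|Dx]].
- by move=> Dx; have [] := disc_strip (ltnW (ltn_ord j)) Dx.
- exact: core_box (Acore Ax).
- by have [] := disc_strip (leqnn N) Dx.
Qed.

Lemma support_strip i x : support i (trep x) -> strip i x.2.
Proof.
rewrite /support /strip; case: unlift => [j Dx|[Ax|Dx] j].
- have [h _] := disc_strip (ltnW (ltn_ord j)) Dx; apply: le_lt_trans h _.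
  by move: eta0; lra.
- exact: core_strip (Acore Ax) (ltnW (ltn_ord j)).
- have [h _] := disc_strip (leqnn N) Dx; have := @hgt_sep N j; rewrite gtn_eqF// => /(_ isT).
  have := ler_distD (tmod x.2) (hgt N) (hgt j); move: h; rewrite /trep /= (distrC (hgt N) (tmod x.2)).
  by move: eta0; lra.
Qed.

Lemma strip_disjoint i j z : strip i z -> strip j z -> i = j.
Proof.
have e0 := eta0; rewrite /strip.
case: (unliftP ord0 i) => [i'|] ->; case: (unliftP ord0 j) => [j'|] -> //.
- move=> h1 h2; congr (lift _ _); apply/eqP; apply: contraT => ij.
  have := @hgt_sep i' j'; have -> : (i' : nat) != j' by apply: contraNneq ij => /val_inj ->.
  move=> /(_ isT); have := ler_distD (tmod z) (hgt i') (hgt j').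
  rewrite (distrC (hgt i') (tmod z)) => h3 h4; exfalso; lra.
- by move=> h1 /(_ i') h2; exfalso; lra.
- by move=> /(_ j') h1 h2; exfalso; lra.
Qed.

Let eta2 : 0 < eta / 2. Proof. by rewrite divr_gt0. Qed.

Lemma stream_box i : vanish_off (box (eta / 2)) (stream i) /\
  vanish_off (box (eta / 2)) (potential i).
Proof.
have [_ _ h1 h2 _] := eddy_stream i.
by split=> x nx; [apply: h1|apply: h2] => /support_box.
Qed.

Lemma stream_off i x : ~ strip i x.2 -> [/\ per (stream i) x = 0,
  forall v, 'D_v (per (stream i)) x = 0 &
  forall v w, 'D_w ('D_v (per (stream i))) x = 0].
Proof.
move=> nS; have [cS [sF _] SF _ _] := eddy_stream i; have [FB _] := stream_box i.
have nA : ~ support i (trep x) by move=> /support_strip.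
have [h1 h2] := off_per eta2 FB sF cS SF nA; split=> //; exact: SF.
Qed.

Lemma stream_lift (j : 'I_N) : stream (lift ord0 j) = V j.
Proof. by rewrite /stream liftK. Qed.

Lemma stream0 : stream ord0 = fun x => F x + V N x.
Proof. by rewrite /stream unlift_none. Qed.

Lemma strip_lift (j : 'I_N) z : strip (lift ord0 j) z = (`|tmod z - hgt j| < eta / 2) :> Prop.
Proof. by rewrite /strip liftK. Qed.

Lemma strip0 z : strip ord0 z = (forall j : 'I_N, eta <= `|tmod z - hgt j|).
Proof. by rewrite /strip unlift_none. Qed.

Lemma derive_stream i x v : 'D_v (per (stream i)) x = 'D_v (stream i) (trep x).
Proof.
have [_ [sF _] _ _ _] := eddy_stream i; have [FB _] := stream_box i.
exact: (f_equal (fun f : R * R -> R => f x) (per_derive v eta2 FB sF)).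
Qed.

Lemma tmod_hgt j : (j <= N)%N -> tmod (hgt j) = hgt j.
Proof.
move=> jN; apply: tmod_id; have /andP[h1 h2] := hgt_bounds jN; have [d1 d2] := delta_small.
have pi2 := pi_ge2 R; move: eta0 => ?; apply/andP; split; lra.
Qed.

Lemma dg_le0 s : 'D_1 g s <= 0.
Proof.
have [h1|h1] := leP s aa; first by rewrite dg_eq0//; left.
have [h2|h2] := leP bb s; first by rewrite dg_eq0//; right.
by apply: ltW; apply: dg_lt0; rewrite h1 h2.
Qed.

Lemma vertical_speed (j : 'I_N) s :
  (grad_perp (per (stream (lift ord0 j))) (s, hgt j)).2 =
  - ('D_1 g ((tmod s - pi) * (tmod s - pi)) * (tmod s - pi)).
Proof.
rewrite /grad_perp /=; congr (- _).
apply: etrans (derive_stream (lift ord0 j) (s, hgt j) (1, 0)) _.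
rewrite stream_lift; apply: etrans (derive_vortex _ _ _ _ sg) _.
rewrite /rsq /trep /ctr /= tmod_hgt ?(ltnW (ltn_ord j))// subrr mul0r !addr0 mulr1.
by field.
Qed.

(** The vortices turn counterclockwise in the ring between radii [eta / 8] and [eta / 4]: on the
    central line the vertical velocity is positive to the right of the centre, negative to the left,
    and zero in the core and outside. *)
Lemma separated_layout (w : 'I_N -> CinftyDiv R) :
  (forall i, w i = grad_perp (per (stream (lift ord0 i))) :> (R * R -> R * R)) ->
  line_separated (fun i : 'I_N => hgt i) (pi + eta / 8) (pi + eta / 4) w.
Proof.
move=> Ew i; have e0 := eta0; have pi2 := pi_ge2 R; have [dl1 dl2] := delta_small.
split; [move=> j s ji|split=> s /andP[h1 h2]].
- have nS : ~ strip (lift ord0 j) (s, hgt i).2.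
    rewrite strip_lift /= tmod_hgt ?(ltnW (ltn_ord i))//.
    have := @hgt_sep i j; rewrite eq_sym ji => /(_ isT); lra.
  have [_ h _] := stream_off nS; rewrite Ew.
  by apply: pair_ext; [exact: h|apply: etrans (f_equal _ (h (1, 0))) _; rewrite oppr0].
- rewrite Ew vertical_speed; have -> : tmod s = s by apply: tmod_id; apply/andP; split; lra.
  rewrite oppr_gt0 pmulr_llt0; last lra.
  apply: dg_lt0; rewrite /aa /bb; apply/andP; split; apply: ltr_pM; lra.
rewrite Ew vertical_speed oppr_le0.
have [s2|s2] := ltP s (2 * pi).
  have -> : tmod s = s by apply: tmod_id; apply/andP; split; lra.
  rewrite dg_eq0 ?mul0r//; right; rewrite /bb; apply: ler_pM; lra.
(* The rest of the period is the part of the line left of the centre, followed by the flat core up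
   to [pi + eta / 8]. *)
have -> : tmod s = s - 2 * pi.
  have := tmod_addz (s - 2 * pi) 1; rewrite mulr1 subrK => ->.
  by apply: tmod_id; apply/andP; split; lra.
set z := s - 2 * pi; have hz : z - pi <= eta / 8 by rewrite /z; lra.
have [h|h] := leP (z - pi) 0; first by rewrite mulr_le0// dg_le0.
by rewrite dg_eq0 ?mul0r//; left; rewrite /aa; apply: ler_pM => //; lra.
Qed.

(** At the heights of the probe the shear is at rest and the drifting vortices are absent, so the
    field there is that of the probe alone, for every [th]. *)
Lemma probe_field (A' : CinftyDiv R) (w : 'I_N -> CinftyDiv R) (b : R -> R) th (x : R * R) :
  (forall i, w i = grad_perp (per (stream (lift ord0 i))) :> (R * R -> R * R)) ->
  (forall x, A' x = ('D_1 b x.2 + d2 (per (stream ord0)) x, - d1 (per (stream ord0)) x)) ->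
  (forall z, strip ord0 z -> 'D_1 b z = 0) -> disc (ctr N) bb x ->
  drift A' w th x = ('D_1 g (rsq (ctr N) x) * (x.2 - hgt N), - ('D_1 g (rsq (ctr N) x) * (x.1 - pi))).
Proof.
move=> Ew EA b0 Dx; have [h2 [/andP[b1 b2] /andP[b3 b4]]] := disc_strip (leqnn N) Dx.
have e0 := eta0.
have tx : trep x = x.
  by apply: pair_ext; rewrite /trep /=; apply: tmod_id; apply/andP; split; lra.
have S0 : strip ord0 x.2.
  by apply: support_strip; rewrite tx /support unlift_none; right.
rewrite driftE big1 => [|i _]; last first.
  have nS : ~ strip (lift ord0 i) (x + th 0 i *: (-1, 0)).2.
    rewrite /= scaler0 addr0 => /strip_disjoint /(_ S0) /eqP.
    by rewrite eq_sym (negbTE (neq_lift _ _)).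
  have [_ h _] := stream_off nS; rewrite Ew.
  by apply: pair_ext; [exact: h|apply: etrans (f_equal _ (h (1, 0))) _; rewrite oppr0].
rewrite addr0 EA b0// add0r.
have nA : ~ A x by move=> Ax; have := core_strip (Acore Ax) (leqnn N); lra.
have [cA [sF _] AF _ _] := eF.
have D v : 'D_v (per (stream ord0)) x =
    2^-1 * 'D_1 g (rsq (ctr N) x) * (2 * ((x.1 - pi) * v.1 + (x.2 - hgt N) * v.2)).
  apply: etrans (derive_stream ord0 x v) _; rewrite tx stream0.
  have sV : smooth (V N) by exact: (smoothZ (W := R) _ (smooth_comp1 sg (smooth_rsq (ctr N)))).
  have [_ e] := isD_add (smooth_is_derive x v sF) (smooth_is_derive x v sV).
  apply: etrans e _; rewrite (@vanish_derive _ A F v cA AF x nA) add0r.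
  exact: derive_vortex.
apply: pair_ext => /=.
  by apply: etrans (D (0, 1)) _; rewrite mulr0 add0r mulr1; field.
by congr (- _); apply: etrans (D (1, 0)) _; rewrite mulr0 addr0 mulr1; field.
Qed.

(* Moving perpendicularly to the radius of the probe vortex leads from its
   rotating ring to its boundary, where the fluid is at rest. *)
Lemma probe_non_symmetric (A' : CinftyDiv R) (w : 'I_N -> CinftyDiv R) (b : R -> R) :
  (forall i, w i = grad_perp (per (stream (lift ord0 i))) :> (R * R -> R * R)) ->
  (forall x, A' x = ('D_1 b x.2 + d2 (per (stream ord0)) x, - d1 (per (stream ord0)) x)) ->
  (forall z, strip ord0 z -> 'D_1 b z = 0) -> non_symmetric (drift A' w).
Proof.
move=> Ew EA b0 th a an0 sym; have e0 := eta0.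
have n0 : 0 < a.1 * a.1 + a.2 * a.2.
  have u2 (u : R) : 0 <= u * u by rewrite -expr2 sqr_ge0.
  rewrite lt_neqAle addr_ge0// andbT eq_sym paddr_eq0//.
  apply: contra an0 => /andP[]; rewrite !mulf_eq0 !orbb => /eqP a1 /eqP a2.
  by apply/eqP; apply: pair_ext.
have ab : 0 < aa /\ aa < bb.
  have e2 := mulr_gt0 e0 e0; rewrite /aa /bb; split; lra.
set n2 := a.1 * a.1 + a.2 * a.2 in n0.
pose m := (aa + bb) / 2.
(* By Pythagoras: [z] is the centre plus [t] times the vector perpendicular to [a], at squared
   distance [m] inside the ring, and [z + s a] is at squared distance exactly [bb]. *)
pose t := Num.sqrt (m / n2); pose s := Num.sqrt ((bb - m) / n2).
have tt : t * t * n2 = m.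
  by rewrite -expr2 sqr_sqrtr ?divfK ?gt_eqF// divr_ge0 ?ltW// /m; case: ab; lra.
have ss : s * s * n2 = bb - m.
  by rewrite -expr2 sqr_sqrtr ?divfK ?gt_eqF// divr_ge0 ?ltW// /m; case: ab; lra.
pose z : R * R := (pi - t * a.2, hgt N + t * a.1).
have r0 : rsq (ctr N) z = m.
  by rewrite -tt /rsq /z /n2 /=; ring.
have r1 : rsq (ctr N) (z + s *: a) = bb.
  have -> : bb = t * t * n2 + s * s * n2 by rewrite tt ss; ring.
  by rewrite /rsq /z /n2 /= /GRing.scale /=; ring.
have mb : m < bb by rewrite /m; case: ab; lra.
have D0 : disc (ctr N) bb z by rewrite /disc /= r0 ltW.
have D1 : disc (ctr N) bb (z + s *: a) by rewrite /disc /= r1.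
have := sym z s; rewrite (probe_field th Ew EA b0 D0) (probe_field th Ew EA b0 D1) r0 r1.
rewrite (dg_eq0 (or_intror (lexx bb))) !mul0r oppr0 => -[/esym/eqP + /esym/eqP].
have dm : 'D_1 g m != 0.
  by rewrite lt_eqF// dg_lt0// mb andbT /m; case: ab; lra.
rewrite oppr_eq0 !mulf_eq0 (negbTE dm) /= => /eqP z2 /eqP z1.
have : m = 0 by rewrite -r0 /rsq /ctr /= z1 z2 !mul0r addr0.
by rewrite /m; case: ab; lra.
Qed.

Lemma vortex_le j x : `|V j x| <= 1 / 2.
Proof.
have /andP[h1 h2] := g01 (rsq (ctr j) x).
rewrite /V ger0_norm ?mulr_ge0 ?invr_ge0//; lra.
Qed.

Lemma vortex_off j x : ~ disc (ctr j) bb x -> V j x = 0.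
Proof.
by move=> /negP; rewrite -ltNge => /ltW /g0[h _]; rewrite /V h mulr0.
Qed.

(** At each height either the shear and a single drifting vortex contribute, each at most 1/2, or
    only the component at rest, which is at most [M + 1 / 2]. On the core neither the probe nor the
    strips interfere. *)
Lemma layout_flow : exists psi : R * R -> R, [/\ realizes psi,
  forall x, `|psi x| <= M + 1 &
  forall x, core x -> psi x = F x].
Proof.
have e0 := eta0; have [dl1 dl2] := delta_small; have pi2 := pi_ge2 R.
have ybox (i : 'I_N) : eta <= hgt i <= 2 * pi - eta.
  have /andP[h1 h2] := hgt_bounds (ltnW (ltn_ord i)); apply/andP; split; lra.
have ysep (i j : 'I_N) : i != j -> 2 * eta <= `|hgt i - hgt j|.
  by move=> ij; apply: hgt_sep; apply: contraNneq ij => /val_inj ->.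
have [b [sb pb bC b1 b2]] := @shear_exists R N (fun i : 'I_N => hgt i) (fun i => nu 0 i)
  eta e0 ybox ysep C nuC C0.
pose s i := match unlift ord0 i with Some j => nu 0 j | None => 0 end.
have bY i z : strip i z -> 'D_1 b z = s i /\ 'D_1 ('D_1 b) z = 0.
  rewrite /strip /s; case: unlift => [j|] h; first exact: b1.
  by have [_ h1 h2] := b2 z h.
have sStream i : smooth (per (stream i)).
  have [_ [sF _] _ _ _] := eddy_stream i; have [FB _] := stream_box i.
  exact: per_smooth eta2 FB sF.
have sPot i : smooth (per (potential i)).
  have [_ [_ sP] _ _ _] := eddy_stream i; have [_ PB] := stream_box i.
  exact: per_smooth eta2 PB sP.
have stS i : steady (per (stream i)) (per (potential i)).
  have [_ [sF sP] _ _ st] := eddy_stream i; have [FB PB] := stream_box i.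
  exact: (steady_per eta2 FB PB sF sP st).
have offY i (x : R * R) : ~ strip i x.2 -> (forall v, 'D_v (per (stream i)) x = 0) /\
    (forall v w, 'D_w ('D_v (per (stream i))) x = 0).
  by move=> /stream_off[_ h1 h2].
have s0 : s ord0 = 0 by rewrite /s unlift_none.
have sl i : s (lift ord0 i) = nu 0 i by rewrite /s liftK.
have [A' [w [[spsi ppsi] sol EA Ew]]] := drift_solution sStream sPot
  (fun i => per_periodic (stream i)) (fun i => per_periodic (potential i)) stS offY
  strip_disjoint sb pb bY s0 sl.
have b0 z : strip ord0 z -> 'D_1 b z = 0 by move=> /bY[-> _].
exists (fun x => b x.2 + \sum_i per (stream i) x); split.
- split=> //; split=> //; exists (drift A' w); split.
  + apply: drift_embedding (separated_layout Ew); lra.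
  + exact: probe_non_symmetric Ew EA b0.
  + by move: sol; congr the_euler_solution; apply/funext => t; rewrite mul1r.
- move=> x; apply: (le_trans (ler_normD _ _)).
  have [[i hi]|no] := pselect (exists i : 'I_N, `|tmod x.2 - hgt i| < eta).
    rewrite (bigD1 (lift ord0 i))//= big1 => [|j ji].
      rewrite addr0 stream_lift /per; have := vortex_le i (trep x); have := bC x.2.
      have M0 : 0 <= M by apply: le_trans (normr_ge0 _) (FM x).
      move: Ceta; lra.
    suff nS : ~ strip j x.2 by have [h _ _] := stream_off nS.
    case: (unliftP ord0 j) ji => [j'|] -> ji; last by rewrite strip0 => /(_ i); lra.
    rewrite strip_lift => h; have := @hgt_sep i j'.
    rewrite (_ : (i : nat) != j'); last by apply: contraNneq ji => /val_inj ->.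
    move=> /(_ isT); have := ler_distD (tmod x.2) (hgt i) (hgt j').
    rewrite (distrC (hgt i) (tmod x.2)); lra.
  have S0 : strip ord0 x.2.
    rewrite strip0 => i; rewrite leNgt; apply/negP => h; apply: no; by exists i.
  rewrite (bigD1 ord0)//= big1 => [|j j0]; last first.
    suff nS : ~ strip j x.2 by have [h _ _] := stream_off nS.
    by move=> /strip_disjoint /(_ S0) j0'; rewrite j0' eqxx in j0.
  have [-> _ _] : [/\ b x.2 = 0, 'D_1 b x.2 = 0 & 'D_1 ('D_1 b) x.2 = 0].
    by apply: b2; move: S0; rewrite strip0.
  rewrite addr0 normr0 add0r stream0 /per; apply: (le_trans (ler_normD _ _)).
  by have := FM (trep x); have := vortex_le N (trep x); lra.
move=> x cx; have tx : trep x = x.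
  have [/andP[h1 h2] /andP[h3 h4]] := cx.
  by apply: pair_ext; rewrite /trep /=; apply: tmod_id; apply/andP; split; lra.
have S0 : strip ord0 x.2.
  rewrite strip0 => i; rewrite -[tmod x.2]/((trep x).2) tx.
  exact: core_strip cx (ltnW (ltn_ord i)).
rewrite (bigD1 ord0)//= big1 => [|j j0]; last first.
  suff nS : ~ strip j x.2 by have [h _ _] := stream_off nS.
  by move=> /strip_disjoint /(_ S0) j0'; rewrite j0' eqxx in j0.
have [-> _ _] : [/\ b x.2 = 0, 'D_1 b x.2 = 0 & 'D_1 ('D_1 b) x.2 = 0].
  by apply: b2; move: S0; rewrite strip0.
rewrite addr0 add0r stream0 /per tx vortex_off ?addr0// => Dx.
have [h _] := disc_strip (leqnn N) Dx; have := core_strip cx (leqnn N); lra.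
Qed.

End Layout.

(** * Choice of the strip width *)

Section Richness.
Context {R : realType}.
Local Notation plane := (measurableTypeR R * measurableTypeR R)%type.
Local Notation S := (@fundamental_square R).

(** Four rectangles of length [2 pi] and widths [2 del], [del], [2 del], [del], of total area
    [12 pi del]. Two widths are doubled because a half-open interval of length [del] would miss the
    points with coordinate [del]. *)
Lemma frame_small (del e : R) : 0 < del -> del <= 1 -> 12 * pi * del <= e ->
  exists B : set plane, [/\ measurable B, (mu2 B <= e%:E)%E &
    forall x : R * R, S x ->
      ~ (del < x.1 < 2 * pi - del /\ del < x.2 < 2 * pi - del) -> B x].
Proof.
move=> d0 d1 de; have pi2 := pi_ge2 R.
pose r1 : set plane := `[0, 2 * del[%classic `*` `[0, 2 * pi[%classic.
pose r2 : set plane := `[2 * pi - del, 2 * pi[%classic `*` `[0, 2 * pi[%classic.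
pose r3 : set plane := `[0, 2 * pi[%classic `*` `[0, 2 * del[%classic.
pose r4 : set plane := `[0, 2 * pi[%classic `*` `[2 * pi - del, 2 * pi[%classic.
have mR (a b c d : R) : measurable (`[a, b[%classic `*` `[c, d[%classic : set plane).
  by apply: measurableX; exact: measurable_itv.
have m1 := mR 0 (2 * del) 0 (2 * pi); have m2 := mR (2 * pi - del) (2 * pi) 0 (2 * pi).
have m3 := mR 0 (2 * pi) 0 (2 * del); have m4 := mR 0 (2 * pi) (2 * pi - del) (2 * pi).
have h1 : (0 : R) <= 2 * del by lra.
have dl : del < 2 * del by lra.
have h2 : (0 : R) <= 2 * pi by lra.
have h3 : 2 * pi - del <= 2 * pi by lra.
exists ((r1 `|` r2) `|` (r3 `|` r4)); split.
- by apply: measurableU; exact: measurableU.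
- have m12 := measurableU _ _ m1 m2; have m34 := measurableU _ _ m3 m4.
  apply: (le_trans (measureU2 mu2 m12 m34)).
  apply: (le_trans (leeD (measureU2 mu2 m1 m2) (measureU2 mu2 m3 m4))).
  have L (a b c d : R) : a <= b -> c <= d ->
    (@mu2 R (`[a, b[%classic `*` `[c, d[%classic) <= ((b - a) * (d - c))%:E)%E.
    by move=> ab cd; rewrite mu2_rect.
  apply: (le_trans (leeD (leeD (L _ _ _ _ h1 h2) (L _ _ _ _ h3 h2))
    (leeD (L _ _ _ _ h2 h1) (L _ _ _ _ h2 h3)))).
  rewrite -!EFinD lee_fin; apply: le_trans de; rewrite le_eqVlt; apply/orP; left.
  by apply/eqP; ring.
move=> x [] /=; rewrite !in_itv /= => /andP[a1 a2] /andP[a3 a4] nx.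
have [b1|b1] := leP x.1 del.
  by left; left; rewrite /r1; split; rewrite /= in_itv /= ?a1 ?a3 ?a4 ?(le_lt_trans b1 dl).
have [b2|b2] := leP (2 * pi - del) x.1.
  by left; right; split; rewrite /= in_itv /= ?b2 ?a2 ?a3 ?a4.
have [b3|b3] := leP x.2 del.
  by right; left; split; rewrite /= in_itv /= ?a1 ?a2 ?a3 ?(le_lt_trans b3 dl).
have [b4|b4] := leP (2 * pi - del) x.2.
  by right; right; split; rewrite /= in_itv /= ?a1 ?a2 ?b4 ?a4.
by exfalso; apply: nx; rewrite b1 b2 b3 b4.
Qed.

Lemma open_core (N : nat) (eta : R) : open (core N eta).
Proof.
have -> : core N eta = (fst @^-1` `]2 * eta * N.+1%:R, 2 * pi - 2 * eta * N.+1%:R[%classic)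
    `&` (snd @^-1` `]2 * eta * N.+1%:R, 2 * pi - 2 * eta * N.+1%:R[%classic).
  by apply/seteqP; split => x; rewrite /core /= !in_itv.
apply: openI; apply: open_comp; try exact: interval_open.
- by move=> x _; exact: cvg_fst.
- by move=> x _; exact: cvg_snd.
Qed.

Lemma realizes_rich (N : nat) (nu : 'rV[R]_N) : rich (realizes nu).
Proof.
move=> k g M e gk M0 gM e0.
pose C := \sum_i `|nu 0 i|.
have nuC i : `|nu 0 i| <= C.
  by rewrite /C (bigD1 i)//= lerDl; apply: sumr_ge0.
have C0 : 0 <= C by apply: sumr_ge0.
have pi0 := pi_gt0 R.
have n0 : 0 < N.+1%:R :> R by rewrite ltr0n.
have P1 : 0 < 2 * N.+1%:R :> R by rewrite mulr_gt0.
have P2 : 0 < 2 * (C + 1) by rewrite mulr_gt0// ltr_wpDl.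
have P3 : 0 < 24 * pi * (2 * N.+1%:R) :> R.
  have p24 : 0 < 24 :> R by rewrite ltr0n.
  exact: mulr_gt0 (mulr_gt0 p24 pi0) P1.
(* Three requirements: the strips fit in a frame of width at most 1, the shear has amplitude at most
   1/2, and the frame has area at most [e / 2]. *)
pose eta := Num.min (2 * N.+1%:R)^-1 (Num.min (2 * (C + 1))^-1 (e / (24 * pi * (2 * N.+1%:R)))).
have eta0 : 0 < eta by rewrite /eta !lt_min !invr_gt0 P1 P2 divr_gt0.
have le1 : eta <= (2 * N.+1%:R)^-1 by rewrite /eta ge_min lexx.
have le2 : eta <= (2 * (C + 1))^-1 by rewrite /eta !ge_min lexx orbT.
have le3 : eta <= e / (24 * pi * (2 * N.+1%:R)) by rewrite /eta !ge_min lexx !orbT.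
have eta1 : 2 * eta * N.+1%:R <= 1.
  by move: le1; rewrite -[X in eta <= X]div1r ler_pdivlMr//; lra.
have Ceta : C * eta <= 1 / 2.
  move: le2; rewrite -[X in eta <= X]div1r ler_pdivlMr// => h.
  have := mulr_ge0 C0 (ltW eta0); lra.
have small : 12 * pi * (2 * eta * N.+1%:R) <= e / 2.
  by move: le3; rewrite ler_pdivlMr//; lra.
have d0 : 0 < 2 * eta * N.+1%:R by rewrite !mulr_gt0.
have [B1 [mB1 muB1 HB1]] := frame_small d0 eta1 small.
have e2 : 0 < e / 2 by rewrite divr_gt0.
(* Taking the complement of the core as obstacle confines the packing to the core and leaves the
   frame free. *)
have cK : closed (~` core N eta) by rewrite closedC; exact: open_core.
have [A [F [p [B [eF AK FM [mB muB] HF]]]]] := fill gk gM cK e2.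
have Acore : A `<=` core N eta.
  move=> x Ax; apply: contrapT => nc; have : (A `&` ~` core N eta) x by [].
  by rewrite AK.
have ab : eta / 8 * (eta / 8) < eta / 4 * (eta / 4).
  by have e2' := mulr_gt0 eta0 eta0; lra.
have [gc [Hc [sg sH _ g0 [g01 dg_lt0 dg_eq0 dH]]]] := cutoff_exists ab.
have [psi [Rpsi psiM psiF]] := layout_flow eta0 eta1 nuC C0 Ceta sg sH g0 g01 dg_lt0
  dg_eq0 dH eF Acore FM.
exists psi, (B `|` B1); split.
- by split=> //; case: Rpsi => spsi _; exact: smooth_cont spsi.
- exact: psiM.
- split; first exact: measurableU.
  by apply: (le_trans (measureU2 mu2 mB mB1)); rewrite (splitr e) EFinD; exact: leeD.
move=> x Sx /not_orP[nB nB1].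
have cx : core N eta x by apply: contrapT => nc; apply: nB1; exact: HB1.
rewrite (psiF _ cx) HF//; first by rewrite subrr normr0 ltW.
Qed.

End Richness.

Theorem theorem1p3 (R : realType) (q : \bar R) (hq : (1%:E <= q)%E)
    (psi0 : R * R -> R) (hpsi0 : torus_Lq q psi0)
    (N : nat) (nu : 'rV[R]_N) (hnu : (0 < N)%N -> nu != 0) :
  exists (psi : nat -> R * R -> R) (c : nat -> R)
         (U : nat -> 'rV[R]_N -> CinftyDiv R),
    (forall n, [/\ smooth (psi n), periodic2 (psi n), 0 < c n,
                   smooth_embedding (U n) & non_symmetric (U n)]) /\
    (forall n, the_euler_solution (grad_perp (psi n))
                 (fun t => U n ((c n * t) *: nu) : R * R -> R * R)) /\
    ((q < +oo)%E -> Lq_cvg q psi psi0) /\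
    (q = +oo%E -> weak_star_cvg psi psi0).
Proof.
have [psi [Rpsi cvq cvy]] := dense_Lq (realizes_rich nu) hq hpsi0.
have /choice[U HU] := fun n => (Rpsi n).2.2.
(* No rescaling of time is required: the thinness of the strips alone makes the shear small in the
   stream function. *)
exists psi, (fun=> 1), U; split; [|split; [|split]] => //.
- by move=> n; have [s1 [s2 _]] := Rpsi n; have [h1 h2 _] := HU n; split.
- by move=> n; have [_ _ h] := HU n.
Qed.
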